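(* Let $n\ge1$. The following statements hold: (1) Let $u \in \mathrm{Lip}^\alpha(\mathbb R^n)$ for $\alpha \in \,]0,1]$. Then $u\chi_{\mathbf B(0,r)} \in \mathrm{BV}^\beta_c(\mathbb R^n)$ for all $r > 0$ whenever $\beta + \alpha > 1$, i.e. $\beta \in \,]1-\alpha,1]$. Moreover, if $x \in \mathbf B(0,r)$, then \[\mathbf V^\beta\bigl((u-u(x))\chi_{\mathbf B(0,r)}\bigr) \leq C(n,\alpha,\beta)\,r^{\alpha+\beta+n-1}\, \mathrm{Lip}^\alpha(u|_{\mathbf B(0,r)}),\] with a finite constant depending only on $n,\alpha,\beta$. (2) Let $\alpha,\beta\in \,]0,1[$. If $u \in \mathrm{BV}^\beta_c(\mathbb R^n)$ and $\alpha + \beta < 1$, then there exist $C \geq 0$ and an exhaustion by measurable sets $D_1 \subset D_2 \subset \cdots \subset \mathbb R^n$ such that $\mathscr L^n(\mathbb R^n\setminus D_k) \leq C k^{-1}$ and $|u(x) - u(y)| \leq Ck|x-y|^{\alpha}$ for all $x,y \in D_k$. (3) If $U \subset \mathbb R^n$ is bounded and open with $\dim_{\rm box}(\partial U) \in [n-1,n[$, then $\chi_U \in \mathrm{BV}^{\delta - (n-1)}_c(\mathbb R^n)$ for all $\delta \in \,]\dim_{\rm box}(\partial U),n]$. (4) If $u \in \mathrm{BV}^\alpha_c(\mathbb R^n)$ for $\alpha \in [0,1[$ and $x \in \mathbb R^n$, then $u\chi_{\mathbf B(x,r)} \in \bigcap_{\alpha < \beta < 1} \mathrm{BV}^{\beta}_c(\mathbb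 R^n)$ for almost all $r > 0$.
   Context: $\mathbf B(x,r)$ is the closed ball, $\mathscr L^n$ Lebesgue measure, $L^1_c(\mathbb R^n)$ integrable functions with (essentially) compact support. For $\alpha\in[0,1]$, $\mathrm{Lip}^\alpha(g)=\sup_{x\ne y}|g(x)-g(y)|/|x-y|^\alpha$; $\mathrm{Lip}^\alpha(\mathbb R^n)$ is the set of real functions on $\mathbb R^n$ for which this is finite, and $\mathrm{Lip}=\mathrm{Lip}^1$. For $u\in L^1_c(\mathbb R^n)$, $\mathbf V^\alpha(u)$ is the smallest $C\in[0,\infty]$ such that $\bigl|\int_{\mathbb R^n} u\det D(f,g^1,\dots,g^{n-1})\,dx\bigr|\le C\,\mathrm{Lip}^\alpha(f)\,\mathrm{Lip}(g^1)\cdots\mathrm{Lip}(g^{n-1})$ for all $f,g^1,\dots,g^{n-1}\in\mathrm{Lip}(\mathbb R^n)$, and $\mathrm{BV}^\alpha_c(\mathbb R^n)=\{u\in L^1_c(\mathbb R^n):\mathbf V^\alpha(u)<\infty\}$. In (2), the pointwise statement holds for a suitable representative of $u$. For a bounded set $A\subset\mathbb R^n$ let $N_A(\epsilon)$ be the minimal number of balls of radius $\epsilon$ needed to cover $A$; $\dim_{\rm box}(A)=\lim_{\epsilon\downarrow0}\log N_A(\epsilon)/\log(1/\epsilon)$, in case the limit exists. *)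

(* Defs.v *)
From HB Require Import structures.
From mathcomp Require Import all_boot all_order all_algebra.
From mathcomp Require Import all_classical all_reals all_analysis.

Set Implicit Arguments.
Unset Strict Implicit.
Unset Printing Implicit Defensive.

Import Order.TTheory GRing.Theory Num.Theory.
Import numFieldNormedType.Exports.

Local Open Scope classical_set_scope.
Local Open Scope ring_scope.

(* [R^n] is ['rV[R]_n] with its library topology and differential structure.
   Its sigma-algebra is the one generated by the coordinate maps, i.e. the
   Borel sigma-algebra.  An element of [L^1] is represented by Borel functions;
   every Lebesgue measurable function is a.e. equal to one. *)
Section measurable_rV.
Context {R : realType} (n : nat).

Let coord (i : 'I_n) (x : 'rV[R]_n) : measurableTypeR R := x ord0 i.

Let rV_set0 : g_sigma_preimage coord set0.
Proof. exact: sigma_algebra0. Qed.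

Let rV_setC A : g_sigma_preimage coord A -> g_sigma_preimage coord (~` A).
Proof. exact: sigma_algebraC. Qed.

Let rV_bigcup (F : (set 'rV[R]_n)^nat) :
  (forall i, g_sigma_preimage coord (F i)) ->
  g_sigma_preimage coord (\bigcup_i F i).
Proof. exact: sigma_algebra_bigcup. Qed.

HB.instance Definition _ := @isMeasurable.Build default_measure_display
  'rV[R]_n (g_sigma_preimage coord) rV_set0 rV_setC rV_bigcup.

Lemma measurable_coord_rV (i : 'I_n) :
  measurable_fun [set: 'rV[R]_n] (fun x => x ord0 i : measurableTypeR R).
Proof.
move=> _ Y mY; rewrite setTI; apply: sub_sigma_algebra => /=.
rewrite -bigcup_seq/=; exists i => /=; first by rewrite mem_index_enum.
by exists Y => //; rewrite setTI.
Qed.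

Lemma measurable_fun_rVP d (T : measurableType d) (f : T -> 'rV[R]_n) :
  (forall i, measurable_fun [set: T] (fun t => f t ord0 i : measurableTypeR R)) ->
  measurable_fun [set: T] f.
Proof.
move=> mf _ A mA; rewrite setTI.
have : preimage_set_system [set: T] f measurable (f @^-1` A).
  by exists A => //; rewrite setTI.
rewrite /measurable/= -g_sigma_preimage_comp; apply: smallest_sub.
  exact: sigma_algebra_measurable.
move=> B; rewrite -bigcup_seq => -[i _] [C mC <-]; exact: mf.
Qed.

End measurable_rV.

Definition cons_rV {R : realType} n (p : measurableTypeR R * 'rV[R]_n)
  : 'rV[R]_n.+1 := row_mx (p.1)%:M p.2.

(* Lebesgue measure on [R^n], as an iterated product of [lebesgue_measure]. *)
Fixpoint lebesgue_rV {R : realType} (n : nat) : set 'rV[R]_n -> \bar R :=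
  match n with
  | 0 => \d_(0 : 'rV[R]_0)
  | m.+1 => pushforward (@lebesgue_measure R \x @lebesgue_rV R m)%E (@cons_rV R m)
  end.
Arguments lebesgue_rV {R} n _.

Section lebesgue_rV_measure.
Context {R : realType}.
Local Open Scope ereal_scope.

Lemma cons_rV0 n (x : R) (v : 'rV[R]_n) : cons_rV (x, v) ord0 ord0 = x.
Proof.
rewrite /cons_rV mxE; case: splitP => //= j _.
by rewrite (ord1 j) mxE eqxx mulr1n.
Qed.

Lemma cons_rVS n (x : R) (v : 'rV[R]_n) (i : 'I_n) :
  cons_rV (x, v) ord0 (lift ord0 i) = v ord0 i.
Proof.
rewrite /cons_rV mxE; case: splitP => [j|j].
  by rewrite (ord1 j).
by rewrite lift0 add1n => -[] /val_inj ->.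
Qed.

Lemma measurable_cons_rV n :
  measurable_fun [set: measurableTypeR R * 'rV[R]_n] (@cons_rV R n).
Proof.
apply: measurable_fun_rVP => i; case: (unliftP ord0 i) => [j|] ->.
  rewrite (_ : (fun _ => _) = (fun x : 'rV[R]_n => x ord0 j : measurableTypeR R)
    \o snd); last by apply/funext => -[x v] /=; rewrite cons_rVS.
  by apply: measurableT_comp => //; exact: measurable_coord_rV.
rewrite (_ : (fun _ => _) = fst) //.
by apply/funext => -[x v] /=; rewrite cons_rV0.
Qed.

Let box n (A : 'I_n -> set R) := [set x : 'rV[R]_n | forall i, A i (x ord0 i)].

Let measurable_box n (A : 'I_n -> set (measurableTypeR R)) :
  (forall i, measurable (A i)) -> measurable (box A).
Proof.
move=> mA; rewrite (_ : box A = \big[setI/setT]_(i < n)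
    ((fun x : 'rV[R]_n => x ord0 i : measurableTypeR R) @^-1` A i)).
  apply: bigsetI_measurable => i _; rewrite -[X in measurable X]setTI.
  exact: measurable_coord_rV.
rewrite -bigcap_seq; apply/seteqP; split => x /= h i; first by move=> _; exact: h.
by apply: (h i); rewrite /= mem_index_enum.
Qed.

Let lebesgue_rV_spec n :
  exists2 mu : {sigma_finite_measure set 'rV[R]_n -> \bar R},
    lebesgue_rV n = mu :> (set 'rV[R]_n -> \bar R) &
    forall A : 'I_n -> set (measurableTypeR R), (forall i, measurable (A i)) ->
      mu (box A) = \prod_(i < n) lebesgue_measure (A i).
Proof.
elim: n => [|n [mu IH muE]] /=.
  exists (\d_(0%R : 'rV[R]_0)) => // A _; rewrite big_ord0.
  by rewrite /= diracE mem_set// => -[].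
rewrite IH.
pose nu : {measure set (measurableTypeR R * 'rV[R]_n)%type -> \bar R} :=
  (@lebesgue_measure R \x mu).
have mc := @measurable_cons_rV n.
pose m := pushforward nu (@cons_rV R n).
pose m1 : {measure set 'rV[R]_n.+1 -> \bar R} := m.
have mE (A : 'I_n.+1 -> set (measurableTypeR R)) : (forall i, measurable (A i)) ->
    m (box A) = \prod_(i < n.+1) lebesgue_measure (A i).
  move=> mA; rewrite /m /= /pushforward.
  rewrite (_ : _ @^-1` _ = A ord0 `*` box (fun i => A (lift ord0 i))).
    by rewrite product_measure1E//; [rewrite big_ord_recl muE|exact: measurable_box].
  apply/seteqP; split=> -[x v] /=.
    move=> h; split; first by have := h ord0; rewrite cons_rV0.
    by move=> i; have := h (lift ord0 i); rewrite cons_rVS.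
  move=> [h0 hS] i; case: (unliftP ord0 i) => [j|] ->.
    by rewrite cons_rVS; exact: hS.
  by rewrite cons_rV0.
have sf : sigma_finite setT m.
  exists (fun k => box (fun=> `[(- k%:R)%R, k%:R]%classic)).
    apply/esym; rewrite -subTset => x _.
    exists (Num.trunc `|x|%R).+1 => //= i.
    rewrite /= in_itv/= -ler_norml.
    apply: le_trans (ltW (truncnS_gt _)).
    rewrite [leRHS]/Num.norm /= mx_normrE.
    exact: (le_bigmax _ (fun ij => `|x ij.1 ij.2|%R) (ord0, i)).
  move=> k; split; first by apply: measurable_box.
  rewrite mE// -ge0_fin_numE; last exact: prode_ge0.
  by apply: prode_fin_num => i _; rewrite lebesgue_measure_itv/=; case: ifP.
pose M := Measure_isSigmaFinite.Build _ _ _ (m1 mc) sf.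
pose m2 := HB.pack_for {sigma_finite_measure set 'rV[R]_n.+1 -> \bar R}
  (Measure.sort (m1 mc)) M.
by exists m2.
Qed.

Let lebesgue_rV0 n : lebesgue_rV n (@set0 'rV[R]_n) = 0.
Proof. by have [mu -> _] := lebesgue_rV_spec n; exact: measure0. Qed.

Let lebesgue_rV_ge0 n (A : set 'rV[R]_n) : 0 <= lebesgue_rV n A.
Proof. by have [mu -> _] := lebesgue_rV_spec n; exact: measure_ge0. Qed.

Let lebesgue_rV_sigma_additive n : semi_sigma_additive (@lebesgue_rV R n).
Proof.
by have [mu -> _] := lebesgue_rV_spec n; exact: measure_semi_sigma_additive.
Qed.

Let lebesgue_rV_sigma_finite n : sigma_finite setT (@lebesgue_rV R n).
Proof. by have [mu -> _] := lebesgue_rV_spec n; exact: sigma_finiteT. Qed.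

HB.instance Definition _ n := isMeasure.Build _ _ _ (@lebesgue_rV R n)
  (@lebesgue_rV0 n) (@lebesgue_rV_ge0 n) (@lebesgue_rV_sigma_additive n).

HB.instance Definition _ n := Measure_isSigmaFinite.Build _ _ _ (@lebesgue_rV R n)
  (@lebesgue_rV_sigma_finite n).

Lemma lebesgue_rV_box n (A : 'I_n -> set (measurableTypeR R)) :
  (forall i, measurable (A i)) ->
  lebesgue_rV n [set x | forall i, A i (x ord0 i)] =
  \prod_(i < n) lebesgue_measure (A i).
Proof. by move=> mA; have [mu -> ->] := lebesgue_rV_spec n. Qed.

End lebesgue_rV_measure.

Section open_rV.
Context {R : realType} (n : nat).

Lemma open_measurable_rV (U : set 'rV[R]_n) : open U -> measurable U.
Proof.
move=> oU.
pose B (p : 'rV[rat]_n * 'rV[rat]_n) := \big[setI/setT]_(i < n)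
  ((fun x : 'rV[R]_n => x ord0 i : measurableTypeR R) @^-1`
    `]ratr (p.1 ord0 i), ratr (p.2 ord0 i)[).
have mB p : measurable (B p).
  apply: bigsetI_measurable => i _; rewrite -[X in measurable X]setTI.
  by apply: measurable_coord_rV => //; exact: measurable_itv.
have BP p x : B p x <->
    forall i, x ord0 i \in `]ratr (p.1 ord0 i), ratr (p.2 ord0 i)[.
  rewrite /B -bigcap_seq; split => [h i|h i _]; last exact: h.
  by apply: (h i); rewrite /= mem_index_enum.
rewrite (_ : U = \bigcup_p (if `[< B p `<=` U >] then B p else set0)).
  apply: countable_bigcupT_measurable; first exact: countableP.
  by move=> p; case: ifP.
apply/seteqP; split => [x Ux|x [p _]]; last by case: asboolP => // pU; exact: pU.
have /nbhs_ballP[e /= e0 xeU] : nbhs x U by exact: open_nbhs_nbhs.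
have /choice[p pP] i : exists q, ratr q \in `](x ord0 i - e), (x ord0 i)[.
  by apply: rat_in_itvoo; rewrite ltrBlDr ltrDl.
have /choice[q qP] i : exists q, ratr q \in `](x ord0 i), (x ord0 i + e)[.
  by apply: rat_in_itvoo; rewrite ltrDl.
have Bx : B (\row_i p i, \row_i q i) x.
  apply/BP => i; rewrite /= !mxE in_itv/=.
  by have := pP i; have := qP i; rewrite !in_itv/= => /andP[-> _] /andP[_ ->].
exists (\row_i p i, \row_i q i) => //; case: asboolP => // -[] y /BP /= By.
apply: xeU; split => // i j; rewrite (ord1 i).
have := By j; have := pP j; have := qP j; rewrite !mxE !in_itv/=.
move=> /andP[_ h1] /andP[h2 _] /andP[h3 h4].
rewrite /ball /= ltr_distlC (lt_trans h2 h3)/=.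
exact: lt_trans h4 h1.
Qed.

End open_rV.

Section definitions.
Context {R : realType} (n : nat).
Implicit Types (A K : set 'rV[R]_n) (a d e r : R) (u f : 'rV[R]_n -> R).

(* The library norm of ['rV[R]_n] is the maximum norm. *)
Definition enorm (x : 'rV[R]_n) : R := Num.sqrt (\sum_(i < n) x ord0 i ^+ 2).

Definition cball (x : 'rV[R]_n) r : set 'rV[R]_n := [set y | enorm (y - x) <= r].

(* [-oo] if [A] has at most one point. *)
Definition Lip_on A a f : \bar R :=
  ereal_sup [set q | exists x y, [/\ A x, A y, x != y &
    q = (`|f x - f y| / enorm (x - y) `^ a)%:E]].

Definition Lip a f : \bar R := Lip_on setT a f.

Definition is_Lip a f : Prop := (Lip a f < +oo)%E.

Definition L1c u : Prop :=
  (lebesgue_rV n).-integrable setT (EFin \o u) /\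
  exists2 K, compact K & {ae lebesgue_rV n, forall x, ~ K x -> u x = 0}.

(* The Jacobian determinant of [(f, g^1, ..., g^{n-1})]; where some partial
   derivative does not exist, which for Lipschitz functions happens only on a
   null set, it has an irrelevant value. *)
Definition det_D f (g : n.-1.-tuple ('rV[R]_n -> R)) (x : 'rV[R]_n) : R :=
  \det (\matrix_(i < n, j < n) 'D_(delta_mx ord0 j) (nth f (f :: g) i) x).

(* The products are in [\bar R], where [0 * +oo = 0]; [Lip a f = +oo] is
   possible for [a < 1]. *)
Definition frac_var a u : \bar R :=
  ereal_inf [set C : \bar R | (0 <= C)%E /\
    forall f (g : n.-1.-tuple ('rV[R]_n -> R)),
      is_Lip 1 f -> (forall i, is_Lip 1 (tnth g i)) ->
      (`| \int[lebesgue_rV n]_x (u x * det_D f g x)%:E | <=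
        C * Lip a f * \prod_(i < n.-1) Lip 1 (tnth g i))%E].

Definition BVc a u : Prop := L1c u /\ (frac_var a u < +oo)%E.

Definition covers A e (k : nat) : Prop :=
  exists c : 'I_k -> 'rV[R]_n, A `<=` \bigcup_i cball (c i) e.

(* The junk value [0] is never used for bounded [A] and [0 < e]. *)
Definition covering_number A e : nat :=
  xget 0%N [set k | covers A e k /\ forall j, covers A e j -> (k <= j)%N].

Definition box_dim A d : Prop :=
  ln (covering_number A e)%:R / ln e^-1 @[e --> 0^'+] --> d.

Definition boundary A : set 'rV[R]_n := closure A `\` A°.

End definitions.

(* Main.v *)
(* Let T(w; f, g) be the integral of w det D(f, g).  Null Lagrangian: T(w; f, g)
   = - T(f; w, g) for compactly supported Lipschitz w.

   Upper bounds (1), (3), (4).  With rho_k = 2^-k rho_0, a beta-Hoelder f is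
   replaced by its inf-convolution f_k of Lipschitz constant of order
   rho_k^(beta-1), at distance of order rho_k^beta from f, and w by some w_k;
   the increments of T(w_k; f_k, g) are controlled by
     |w_{k+1} - w_k|_1 rho_k^(beta-1)  and  |D w_k|_1 rho_k^beta,
   the second one thanks to the null Lagrangian.  In (1), w_k is an
   inf-convolution of u times a radial cutoff; in (3), the inf-convolution of
   the indicator of U, which differs from it on a neighbourhood of the boundary
   whose volume is estimated by the covering numbers; in (4), u times a radial
   cutoff, whose cost is the mass of |u| on thin shells, summable over k for
   almost every radius by Tonelli.

   Exhaustion (2).  Taking coordinates for g bounds the integral of u d_j f by
   V [f]_beta, hence that of u (f(. + h) - f) by n |h| V [f]_beta.  If |phi| <= 1,
   averages of phi over cubes of side rho have beta-Hoelder constant of order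
   rho^-beta, and the average over a cube is the mean of translates of the
   average over a cube of half the side; summing over dyadic sides and dualizing,
   |u(. + h) - u|_1 is of order |h|^(1-beta).  Therefore
   G = sum_k rho_k^(-alpha) (mean of |u(. + s) - u| over |s| <= rho_k) is
   integrable, |u x - u y| <= C |x - y|^alpha (G x + G y) when |x - y| <= 1, and
   D_k = {G <= k, |u| <= k}. *)
Require Import Defs.
From HB Require Import structures.
From mathcomp Require Import all_boot all_order all_algebra.
From mathcomp Require Import all_classical all_reals all_analysis.
From mathcomp Require Import measurable_realfun.
From mathcomp Require Import ring lra.
Set Implicit Arguments.
Unset Strict Implicit.
Unset Printing Implicit Defensive.
Import Order.TTheory GRing.Theory Num.Theory.
Import numFieldNormedType.Exports.
Local Open Scope classical_set_scope.
Local Open Scope ring_scope.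

(** * Lebesgue measure under affine maps *)

(** The null Lagrangian property of Lipschitz functions is not obtained by smooth approximation but
    by closure: the functions admissible in a row of the Jacobian contain the coordinates and are
    stable under linear combinations, positive parts and equi-Lipschitz limits; this yields minima
    of finitely many cones, hence all Lipschitz functions. Partial derivatives exist almost
    everywhere because, on an interval, a Lipschitz function is an affine function plus an
    indefinite integral. Test functions are Lipschitz, so f_k coincides with f from some scale on.
    Telescoping sums are therefore finite, only the L^1 convergence of w_k passes to the limit, and
    the Lipschitz constant of f disappears from the final bound. Internal estimates use the maximum
    norm; the Euclidean norm enters through the balls and seminorms of the statement and costs
    powers of n. A partial derivative that does not exist has the value 0, so pointwise bounds hold
    everywhere and only identities are restricted to almost every point. *)

Section lebesgue_rV_affine.
Context {R : realType}.
Local Open Scope ereal_scope.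

Definition rV_box n (A : 'I_n -> set (measurableTypeR R)) :=
  [set x : 'rV[R]_n | forall i, A i (x ord0 i)].

Lemma measurable_rV_box n (A : 'I_n -> set (measurableTypeR R)) :
  (forall i, measurable (A i)) -> measurable (rV_box A).
Proof.
move=> mA; rewrite (_ : rV_box A = \big[setI/setT]_(i < n)
    ((fun x : 'rV[R]_n => x ord0 i : measurableTypeR R) @^-1` A i)).
  apply: bigsetI_measurable => i _; rewrite -[X in measurable X]setTI.
  exact: measurable_coord_rV.
rewrite -bigcap_seq; apply/seteqP; split => x /= h i; first by move=> _; exact: h.
by apply: (h i); rewrite /= mem_index_enum.
Qed.

Lemma lebesgue_rV_rV_box n (A : 'I_n -> set (measurableTypeR R)) :
  (forall i, measurable (A i)) ->
  lebesgue_rV n (rV_box A) = \prod_(i < n) lebesgue_measure (A i).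
Proof. exact: lebesgue_rV_box. Qed.

Lemma lebesgue_rV_cube_lty n (k : R) :
  lebesgue_rV n (rV_box (fun=> `[(- k)%R, k]%classic)) < +oo.
Proof.
rewrite lebesgue_rV_rV_box// -ge0_fin_numE; last exact: prode_ge0.
by apply: prode_fin_num => i _; rewrite lebesgue_measure_itv/=; case: ifP.
Qed.

(** A coordinate preimage is a box whose other sides are the whole line. Unlike such preimages,
    boxes are stable under intersection, as the uniqueness theorem for measures requires. *)
Lemma measurable_rV_generated n :
  (measurable : set (set 'rV[R]_n)) `<=`
  <<s [set X | exists2 A : 'I_n -> set (measurableTypeR R),
                 (forall i, measurable (A i)) & X = rV_box A] >>.
Proof.
rewrite {1}/measurable /= /g_sigma_preimage; apply: smallest_sub.
  exact: smallest_sigma_algebra.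
rewrite -bigcup_seq => X [i _] [Y mY <-]; rewrite setTI.
apply: sub_sigma_algebra => /=.
exists (fun j => if j == i then Y else setT); first by move=> j; case: ifP.
apply/seteqP; split => x /=; last by move=> /(_ i); rewrite eqxx.
by move=> Yx j; case: eqP => // ->.
Qed.

Lemma rV_measure_unique n (m1 m2 : {measure set 'rV[R]_n -> \bar R}) :
  (forall A : 'I_n -> set (measurableTypeR R), (forall i, measurable (A i)) ->
     m1 (rV_box A) = m2 (rV_box A)) ->
  (forall k, m1 (rV_box (fun=> `[(- k%:R)%R, k%:R]%classic)) < +oo) ->
  forall E, measurable E -> m1 E = m2 E.
Proof.
move=> m12 mfin E mE.
pose G := [set X | exists2 A : 'I_n -> set (measurableTypeR R),
             (forall i, measurable (A i)) & X = rV_box A].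
apply: (@g_sigma_algebra_measure_unique _ _ _ G _
  (fun k => rV_box (fun=> `[(- k%:R)%R, k%:R]%classic)));
  last exact: measurable_rV_generated.
- by move=> _ [A mA ->]; exact: measurable_rV_box.
- by move=> k; exists (fun=> `[(- k%:R)%R, k%:R]%classic).
- rewrite -subTset => x _; exists (Num.truncn `|x|%R).+1 => //= i /=.
  rewrite in_itv/= -ler_norml; apply: le_trans (ltW (truncnS_gt _)).
  rewrite [leRHS]/Num.norm /= mx_normrE.
  exact: (le_bigmax _ (fun ij => `|x ij.1 ij.2|%R) (ord0, i)).
- move=> _ _ [A mA ->] [B mB ->]; exists (fun i => A i `&` B i).
    by move=> i; exact: measurableI.
  by apply/seteqP; split => x /= => [[hA hB] i|h]; split => // i; have [] := h i.
- by move=> _ [A mA ->]; exact: m12.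
- exact: mfin.
Qed.

Lemma lebesgue_measure_affine (a t : R) (A : set (measurableTypeR R)) :
  (0 < t)%R -> measurable A ->
  t%:E * lebesgue_measure ((fun x => a + t * x)%R @^-1` A) = lebesgue_measure A.
Proof.
move=> t0 mA.
have mf : measurable_fun [set: measurableTypeR R]
  ((fun x => a + t * x)%R : measurableTypeR R -> measurableTypeR R).
  by apply: measurable_funD => //; exact: measurable_funM.
pose nu : {measure set (measurableTypeR R) -> \bar R} := pushforward (@lebesgue_measure R)
  ((fun x => a + t * x)%R : measurableTypeR R -> measurableTypeR R).
pose tn : {nonneg R} := NngNum (ltW t0).
rewrite [RHS](_ : _ = mscale tn (nu mf) A)//.
apply: lebesgue_measure_unique => // _ [[c d] _ <-] /=.
rewrite [RHS]/mscale /= /pushforward.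
rewrite (_ : _ @^-1` _ = `](c - a) / t, (d - a) / t]%classic)%R; last first.
  apply/seteqP; split => x /=; rewrite !in_itv/= ltr_pdivrMr// ler_pdivlMr//;
    by rewrite ltrBlDl lerBrDl (mulrC x).
rewrite !lebesgue_measure_itv/= !lte_fin ltr_pM2r ?invr_gt0// ltrD2r.
case: ifP => _; last by rewrite mule0.
rewrite -!EFinB -EFinM; congr EFin; field; exact: lt0r_neq0.
Qed.

Definition rV_affine n (a : 'rV[R]_n) (t : R) (x : 'rV[R]_n) : 'rV[R]_n :=
  (a + t *: x)%R.

Lemma measurable_rV_affine n a t :
  measurable_fun [set: 'rV[R]_n] (@rV_affine n a t).
Proof.
apply: measurable_fun_rVP => i.
rewrite (_ : (fun _ => _) = (fun x : 'rV[R]_n => a ord0 i + t * x ord0 i)%R).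
  by apply: measurable_funD => //; apply: measurable_funM => //;
    exact: measurable_coord_rV.
by apply/funext => x; rewrite /rV_affine !mxE.
Qed.

Lemma lebesgue_rV_affine n (a : 'rV[R]_n) (t : R) (A : set 'rV[R]_n) :
  (0 < t)%R -> measurable A ->
  (t ^+ n)%:E * lebesgue_rV n (rV_affine a t @^-1` A) = lebesgue_rV n A.
Proof.
move=> t0 mA.
pose nu : {measure set 'rV[R]_n -> \bar R} :=
  pushforward (@lebesgue_rV R n) (rV_affine a t).
have tn0 : (0 <= t ^+ n)%R by rewrite exprn_ge0// ltW.
pose tn : {nonneg R} := NngNum tn0.
have mnu := @measurable_rV_affine n a t.
have E : forall B : 'I_n -> set (measurableTypeR R), (forall i, measurable (B i)) ->
    lebesgue_rV n (rV_box B) = mscale tn (nu mnu) (rV_box B).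
  move=> B mB; rewrite [RHS]/mscale /= /pushforward.
  rewrite (_ : _ @^-1` _ =
    rV_box (fun i => (fun x => a ord0 i + t * x)%R @^-1` B i)); last first.
    by apply/seteqP; split => x /= h i; have := h i; rewrite /rV_affine !mxE.
  rewrite !lebesgue_rV_rV_box//; last first.
    move=> i; rewrite -[X in measurable X]setTI.
    have : measurable_fun [set: measurableTypeR R]
      ((fun x => a ord0 i + t * x)%R : measurableTypeR R -> measurableTypeR R).
      by apply: measurable_funD => //; exact: measurable_funM.
    exact.
  rewrite (_ : (t ^+ n)%:E = \prod_(i < n) t%:E); last first.
    by rewrite prodEFin prodr_const card_ord.
  rewrite -big_split/=; apply: eq_bigr => i _.
  by rewrite lebesgue_measure_affine.
rewrite [LHS](_ : _ = mscale tn (nu mnu) A)//; apply/esym.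
by apply: rV_measure_unique => // k; exact: lebesgue_rV_cube_lty.
Qed.

Lemma ge0_integral_rV_affine n (a : 'rV[R]_n) (t : R) (f : 'rV[R]_n -> \bar R) :
  (0 < t)%R -> measurable_fun setT f -> (forall x, 0 <= f x) ->
  (t ^+ n)%:E * \int[lebesgue_rV n]_x f (rV_affine a t x) =
  \int[lebesgue_rV n]_x f x.
Proof.
move=> t0 mf f0.
pose nu : {measure set 'rV[R]_n -> \bar R} :=
  pushforward (@lebesgue_rV R n) (rV_affine a t).
have tn0 : (0 <= t ^+ n)%R by rewrite exprn_ge0// ltW.
pose tn : {nonneg R} := NngNum tn0.
have mnu := @measurable_rV_affine n a t.
transitivity (\int[mscale tn (nu mnu)]_x f x).
  rewrite ge0_integral_mscale//; congr (_ * _).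
  by rewrite [RHS](@ge0_integral_pushforward _ _ _ _ _ _ mnu).
by apply: eq_measure_integral => A mA _; exact: lebesgue_rV_affine.
Qed.

Lemma integral_rV_translate n (a : 'rV[R]_n) (f : 'rV[R]_n -> \bar R) :
  measurable_fun setT f ->
  \int[lebesgue_rV n]_x f (x + a)%R = \int[lebesgue_rV n]_x f x.
Proof.
move=> mf.
have E g : measurable_fun setT g -> (forall x, 0 <= g x) ->
    \int[lebesgue_rV n]_x g (x + a)%R = \int[lebesgue_rV n]_x g x.
  move=> mg g0; rewrite -(ge0_integral_rV_affine a ltr01 mg g0) expr1n mul1e.
  by apply: eq_integral => x _; rewrite /rV_affine scale1r addrC.
rewrite integralE [RHS]integralE; congr (_ - _).
  rewrite -[RHS](E _ (measurable_funepos mf)).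
    by apply: eq_integral => x _; rewrite !funeposE.
  by move=> x; exact: funepos_ge0.
rewrite -[RHS](E _ (measurable_funeneg mf)).
  by apply: eq_integral => x _; rewrite !funenegE.
by move=> x; exact: funeneg_ge0.
Qed.

End lebesgue_rV_affine.

(** * Almost everywhere differentiability of Lipschitz functions *)

Section lipschitz_derivable.
Context {R : realType}.
Notation mu := (@lebesgue_measure R).

Lemma lipschitz1_continuous (f : R -> R) (L : R) :
  (forall x y, `|f x - f y| <= L * `|x - y|) -> continuous f.
Proof.
move=> fL x; apply/cvgrPdist_le => e e0; near=> y.
apply: (le_trans (fL _ _)).
have L1 : 0 < `|L| + 1 by rewrite ltr_wpDl.
apply: (@le_trans _ _ ((`|L| + 1) * `|x - y|)).
  by rewrite ler_wpM2r// (le_trans (ler_norm _))// lerDl.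
rewrite mulrC -ler_pdivlMr//; near: y.
by apply: cvgr_dist_le; [exact: cvg_id|rewrite divr_gt0].
Unshelve. all: by end_near. Qed.

(* Half of the Lebesgue measure dominates the Stieltjes measure of
   [x / 2 + f x], because the complementary function [x / 2 - f x] is also
   nondecreasing. *)
Let stieltjes_density (f : R -> R) (a b : R) :
  (forall x y, `|f x - f y| <= 2^-1 * `|x - y|) ->
  exists h : R -> R, mu.-integrable setT (EFin \o h) /\
    forall x, a <= x <= b ->
      2^-1 * x + f x = 2^-1 * a + f a + \int[mu]_(t in `]a, x]) h t.
Proof.
move=> fL.
have cf : continuous f := lipschitz1_continuous fL.
pose g1 x := 2^-1 * x + f x; pose g2 x := 2^-1 * x - f x.
have nd1 : nondecreasing_fun g1.
  move=> x y xy; rewrite /g1; have := fL x y; rewrite ler_norml distrC.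
  rewrite ger0_norm ?subr_ge0// => /andP[]; lra.
have nd2 : nondecreasing_fun g2.
  move=> x y xy; rewrite /g2; have := fL x y; rewrite ler_norml distrC.
  rewrite ger0_norm ?subr_ge0// => /andP[]; lra.
have c2 : continuous (fun x : R => 2^-1 * x) by move=> x; exact: mulrl_continuous.
have c1 : continuous g1 by move=> x; apply: cvgD; [exact: c2|exact: cf].
have c2' : continuous g2 by move=> x; apply: cvgB; [exact: c2|exact: cf].
pose m1 := isCumulative.Build _ _ R g1 nd1 (right_continuousW c1).
pose m2 := isCumulative.Build _ _ R g2 nd2 (right_continuousW c2').
pose h1 : cumulative R R := HB.pack g1 m1.
pose h2 : cumulative R R := HB.pack g2 m2.
pose nu1 : {measure set (measurableTypeR R) -> \bar R} := lebesgue_stieltjes_measure h1.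
pose nu2 : {measure set (measurableTypeR R) -> \bar R} := lebesgue_stieltjes_measure h2.
have nuE (h : cumulative R R) x y : x <= y ->
    lebesgue_stieltjes_measure h `]x, y]%classic = (h y - h x)%:E.
  move=> xy; rewrite /lebesgue_stieltjes_measure /measure_extension measurable_mu_extE/=.
    by rewrite wlength_itv_bnd.
  exact: is_ocitv.
have muE A : measurable A -> mu A = (nu1 A + nu2 A)%E.
  move=> mA; transitivity (measure_add nu1 nu2 A); last by rewrite measure_addE.
  apply: lebesgue_measure_unique => // _ [[c d] _ <-].
  rewrite [RHS]measure_addE /=; have [cd|cd] := leP c d.
    rewrite [X in (_ = X + _)%E](nuE h1)// [X in (_ = _ + X)%E](nuE h2)//.
    rewrite lebesgue_measure_itv/= lte_fin -EFinB -EFinD /= /g1 /g2.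
    by case: ltgtP cd => // [_ _|-> _]; congr EFin; lra.
  by rewrite set_itv_ge ?bnd_simp -?leNgt ?(ltW cd)// !measure0 adde0.
have dom : forall A, measurable A -> mu A = 0 -> nu1 A = 0.
  move=> A mA; rewrite muE// => /eqP; rewrite padde_eq0 ?measure_ge0//.
  by move=> /andP[/eqP].
(* [nu1] may have infinite mass on the line; its restriction to [D] is finite, and Radon-Nikodym is
   applied to that restriction. *)
pose D : set (measurableTypeR R) := `]a, b]%classic.
have mD : measurable D by exact: measurable_itv.
have nu1D : (nu1 D < +oo)%E.
  have [ab|ba] := leP a b; first by rewrite [X in (X < _)%E](nuE h1)// ltry.
  by rewrite /D set_itv_ge ?bnd_simp -?leNgt ?(ltW ba)// measure0.
pose nu : {finite_measure set (measurableTypeR R) -> \bar R} := mfrestr mD nu1D.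
have numu : nu `<< mu.
  apply/null_content_dominatesP => A mA muA0.
  apply/eqP; rewrite eq_le measure_ge0 andbT.
  rewrite -(dom _ mA muA0); apply: le_measure => //; rewrite inE//.
  exact: measurableI.
have [h [h0 hfin hint hE]] := radon_nikodym_sigma_finite numu.
have hfE : EFin \o (fine \o h) = h.
  by apply/funext => x /=; rewrite fineK.
exists (fine \o h); split; first by rewrite hfE.
move=> x /andP[ax xb].
have := hE `]a, x]%classic (measurable_itv _).
rewrite /= /mfrestr /mrestr (_ : _ `&` D = `]a, x]%classic); last first.
  apply/seteqP; split => y; rewrite /D /= !in_itv/=; first by case.
  by move=> /andP[ay yx]; rewrite ay yx (le_trans yx xb).
rewrite nuE// -hfE => H; rewrite /Rintegral -H /= /g1; ring.
Qed.

(** On each []-N, N[] the function is an affine function plus the integral of an integrable density,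
    which is differentiable almost everywhere by Lebesgue's theorem; countably many [N] exhaust the
    line. *)
Let half_lipschitz_derivable (f : R -> R) :
  (forall x y, `|f x - f y| <= 2^-1 * `|x - y|) ->
  {ae mu, forall x, derivable f x 1}.
Proof.
move=> fL; have aeF := ae_filter_ringOfSetsType mu.
have H (N : nat) : {ae mu, forall x, `|x| < N%:R -> derivable f x 1}.
  have [h [hint hE]] := stieltjes_density (- N%:R) N%:R fL.
  have loc : locally_integrable [set: R] h.
    by apply: open_integrable_locally => //; exact: openT.
  have := @FTC1 R h (BRight (- N%:R)) _ loc.
  have hint' y : mu.-integrable [set` Interval (BRight (- N%:R)) (BRight y)]
      (EFin \o h).
    exact: integrableS hint.
  move=> /(_ hint'); apply: filterS => x hx.
  rewrite ltr_norml => /andP[Nx xN].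
  have [|dF _] := hx; first exact: Nx.
  have : derivable (fun y : R => (2^-1 * - N%:R + f (- N%:R) +
      \int[mu]_(t in `]- N%:R, y]) h t) - 2^-1 * y : R) x 1.
    apply: derivableB; first by apply: derivableD; [exact: derivable_cst|exact: dF].
    by apply: derivableM; [exact: derivable_cst|exact: derivable_id].
  apply: near_eq_derivable; near=> y.
  rewrite -hE; first by rewrite addrAC subrr add0r.
  apply/andP; split; apply: ltW; near: y.
    exact: lt_nbhsr.
  exact: lt_nbhsl.
have := ae_foralln H; apply: filterS => x hx.
exact: (hx _ (truncnS_gt _)).
Unshelve. all: by end_near. Qed.

Lemma lipschitz1_derivable_ae (f : R -> R) (L : R) :
  (forall x y, `|f x - f y| <= L * `|x - y|) ->
  {ae mu, forall x, derivable f x 1}.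
Proof.
(* Division by [M] brings the Lipschitz constant down to 1/2; the added 1 keeps [M] positive when
   [L] is 0. *)
move=> fL; have aeF := ae_filter_ringOfSetsType mu; pose M := 2 * (`|L| + 1).
have L1 : 0 < `|L| + 1 by rewrite ltr_wpDl.
have M0 : 0 < M by rewrite mulr_gt0.
have : {ae mu, forall x, derivable (fun x => M^-1 * f x) x 1}.
  apply: half_lipschitz_derivable => x y.
  rewrite -mulrBr normrM gtr0_norm ?invr_gt0// ler_pdivrMl// mulrA.
  rewrite (_ : M * 2^-1 = `|L| + 1); last by rewrite /M mulrAC divff ?mul1r.
  apply: (le_trans (fL _ _)); rewrite ler_wpM2r//.
  by rewrite (le_trans (ler_norm _))// lerDl.
apply: filterS => x dx.
rewrite (_ : f = (fun x => M * (M^-1 * f x))).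
  by apply: derivableM; [exact: derivable_cst|exact: dx].
by apply/funext => y; rewrite mulrA divff ?mul1r// gt_eqF.
Qed.

End lipschitz_derivable.

Section lipschitz_rV.
Context {R : realType} {n : nat}.
Implicit Types (f g : 'rV[R]_n -> R) (x y v : 'rV[R]_n).

Lemma coord_le_norm x i : `|x ord0 i| <= `|x|.
Proof.
rewrite [leRHS]/Num.norm /= mx_normrE.
exact: (le_bigmax _ (fun ij => `|x ij.1 ij.2|) (ord0, i)).
Qed.

Lemma norm_rV_le x (M : R) : 0 <= M -> (forall i, `|x ord0 i| <= M) -> `|x| <= M.
Proof.
move=> M0 xM; rewrite [leLHS]/Num.norm /= mx_normrE.
by apply: bigmax_le => // -[i j] _ /=; rewrite (ord1 i).
Qed.

Lemma norm_delta_mx (i : 'I_n) : `|delta_mx ord0 i : 'rV[R]_n| = 1.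
Proof.
apply/eqP; rewrite eq_le; apply/andP; split.
  by apply: norm_rV_le => // j; rewrite mxE eqxx /=; case: eqP => _; rewrite ?normr1 ?normr0 ?lexx ?ler01.
by rewrite -[leLHS](normr1 R) -[X in `|X|](_ : (delta_mx ord0 i : 'rV[R]_n) ord0 i = 1)
  ?coord_le_norm// mxE !eqxx.
Qed.

Definition is_lip (L : R) f := forall x y, `|f x - f y| <= L * `|x - y|.

Lemma is_lip_le (L L' : R) f : L <= L' -> is_lip L f -> is_lip L' f.
Proof. by move=> LL' fL x y; apply: le_trans (fL x y) _; rewrite ler_wpM2r. Qed.

Lemma is_lip_cst (c : R) : is_lip 0 (fun=> c).
Proof. by move=> x y; rewrite subrr normr0 mul0r. Qed.

Lemma is_lipD (L M : R) f g :
  is_lip L f -> is_lip M g -> is_lip (L + M) (fun x => f x + g x).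
Proof.
move=> fL gM x y; rewrite opprD addrACA mulrDl.
by rewrite (le_trans (ler_normD _ _))// lerD.
Qed.

Lemma is_lipN (L : R) f : is_lip L f -> is_lip L (fun x => - f x).
Proof. by move=> fL x y; rewrite -opprD normrN; exact: fL. Qed.

Lemma is_lipB (L M : R) f g :
  is_lip L f -> is_lip M g -> is_lip (L + M) (fun x => f x - g x).
Proof. by move=> fL gM; apply: is_lipD => //; exact: is_lipN. Qed.

Lemma is_lipZ (L c : R) f : is_lip L f -> is_lip (`|c| * L) (fun x => c * f x).
Proof. by move=> fL x y; rewrite -mulrBr normrM -mulrA ler_wpM2l. Qed.

Lemma is_lipM (L M a b : R) f g : is_lip L f -> is_lip M g ->
  (forall x, `|f x| <= a) -> (forall x, `|g x| <= b) ->
  is_lip (a * M + b * L) (fun x => f x * g x).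
Proof.
move=> fL gM fa gb x y.
rewrite (_ : f x * g x - f y * g y = f x * (g x - g y) + g y * (f x - f y)); last by ring.
rewrite (le_trans (ler_normD _ _))// mulrDl !normrM -!mulrA lerD// ler_pM//.
Qed.

Lemma is_lip_max0 (L : R) f : is_lip L f -> is_lip L (fun x => Num.max 0 (f x)).
Proof.
move=> fL x y; apply: le_trans (fL x y).
rewrite ler_norml.
have := ler_norm (f x - f y); have := ler_norm (f y - f x); rewrite (distrC (f y)).
rewrite /Num.max; case: ltP => ?; case: ltP => ? h1 h2; apply/andP; split; lra.
Qed.

Lemma is_lip_continuous (L : R) f : is_lip L f -> continuous f.
Proof.
move=> fL x; apply/(@cvgrPdist_le _ _ _ _ (nbhs_filter x)) => e e0.
have L1 : 0 < `|L| + 1 by rewrite ltr_wpDl.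
have : \forall y \near x, `|x - y| <= e / (`|L| + 1).
  apply: (@filterS _ _ (nbhs_filter x)) (nbhsx_ballx x _ (divr_gt0 e0 L1)) => y.
  by rewrite -ball_normE /= => /ltW.
apply: (@filterS _ _ (nbhs_filter x)) => y; rewrite ler_pdivlMr// mulrC => xy.
apply: le_trans (fL x y) (le_trans _ xy); rewrite ler_wpM2r//.
by rewrite (le_trans (ler_norm _))// lerDl.
Qed.

Lemma continuous_measurable_rV f : continuous f -> measurable_fun setT f.
Proof.
move=> /continuousP cf.
apply: (measurability _ (RGenOpens.measurableE R)) => //.
by move=> _ [_ [a [b ->]] <-]; rewrite setTI; apply: open_measurable_rV;
  apply: cf; exact: interval_open.
Qed.

Lemma is_lip_measurable (L : R) f : is_lip L f -> measurable_fun setT f.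
Proof. by move=> /is_lip_continuous; exact: continuous_measurable_rV. Qed.

Definition diff_quot v f (t : R) x := t^-1 * (f (t *: v + x) - f x).

Lemma derivableE v f x :
  derivable f x v = (cvg (diff_quot v f t x @[t --> 0^'])).
Proof. by []. Qed.

Lemma derive_diff_quot v f x : 'D_v f x = lim (diff_quot v f t x @[t --> 0^']).
Proof. by []. Qed.

(** The derivative is a [lim], whose default value for a divergent quotient is 0 in [R]. Bounds on
    derivatives thus hold at every point. *)
Lemma derive_dvg v f x : ~ derivable f x v -> 'D_v f x = 0.
Proof. by rewrite derivableE => /dvgP; rewrite -derive_diff_quot. Qed.

Lemma near_line v x (P : set 'rV[R]_n) :
  (\forall y \near x, P y) -> \forall t \near (0 : R), P (t *: v + x).
Proof.
move=> Px; have : (fun t : R => t *: v + x) t @[t --> (0 : R)] --> 0 *: v + x.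
  by apply: cvgD; [apply: cvgZr_tmp; exact: cvg_id|exact: cvg_cst].
by rewrite scale0r add0r => /(_ _ Px).
Qed.

Lemma derive_near_eq0 v f x : (\forall y \near x, f y = f x) -> 'D_v f x = 0.
Proof.
move=> fx; rewrite derive_diff_quot; apply: cvg_lim => //.
apply: cvg_near_cst; apply: nbhs_dnbhs.
have := near_line v fx; apply: filterS => t /= ftx.
by rewrite /diff_quot ftx subrr mulr0.
Qed.

(** All difference quotients at [x] with small increments are bounded by [L]. Comparison with the
    single point [x] is enough, which later replaces the product rule where differentiability of the
    factors is unknown. *)
Lemma derive_local_lip v f x (L : R) : 0 <= L -> `|v| = 1 ->
  (\forall y \near x, `|f y - f x| <= L * `|y - x|) -> `|'D_v f x| <= L.
Proof.
move=> L0 v1 fL.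
have [fx|/derive_dvg ->] := pselect (derivable f x v); last by rewrite normr0.
have H : \forall t \near (0 : R)^', `|diff_quot v f t x| <= L.
  near=> t.
  have t0 : t != 0 by near: t; exact: nbhs_dnbhs_neq.
  rewrite /diff_quot normrM normfV ler_pdivrMl ?normr_gt0// mulrC.
  rewrite -[X in _ * X]mulr1 -v1 -normrZ.
  rewrite -[X in _ * `|X|](addrK x); near: t.
  by apply: nbhs_dnbhs; exact: near_line fL.
rewrite ler_norml derive_diff_quot; apply/andP; split.
  apply: limr_ge => //; apply: filterS H => t.
  by rewrite ler_norml => /andP[].
apply: limr_le => //; apply: filterS H => t.
by rewrite ler_norml => /andP[].
Unshelve. all: by end_near. Qed.

Lemma derive_lip v f x (L : R) : 0 <= L -> `|v| = 1 -> is_lip L f ->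
  `|'D_v f x| <= L.
Proof.
move=> L0 v1 fL; apply: derive_local_lip => //.
by apply: (@filterE _ _ (nbhs_filter x)) => y; exact: fL.
Qed.

Lemma diff_quot_continuous v f x : continuous f ->
  forall (t : R), t != 0 -> {for t, continuous (diff_quot v f ^~ x)}.
Proof.
move=> cf t t0; apply: cvgM; first exact: cvgV.
apply: cvgB; last exact: cvg_cst.
apply: continuous_comp; last exact: cf.
by apply: cvgD; [apply: cvgZr_tmp; exact: cvg_id|exact: cvg_cst].
Qed.

Lemma diff_quot_measurable v f t : continuous f ->
  measurable_fun setT (diff_quot v f t).
Proof.
move=> /continuous_measurable_rV mf.
rewrite (_ : diff_quot v f t =
    (fun x => t^-1 * ((f \o rV_affine (t *: v) 1) x - f x))); last first.
  by apply/funext => x; rewrite /diff_quot /rV_affine /= scale1r.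
apply: measurable_funM; first exact: measurable_cst.
apply: measurable_funB => //; apply: measurableT_comp => //.
exact: measurable_rV_affine.
Qed.

(* By continuity of the difference quotient in [t], the Cauchy condition needs
   to be tested on rational increments only. *)
Lemma derivable_rational v f x : continuous f ->
  derivable f x v <-> forall k : nat, exists m : nat, forall p q : rat,
    ratr p != 0 :> R -> ratr q != 0 :> R ->
    `|ratr p| < m.+1%:R^-1 :> R -> `|ratr q| < m.+1%:R^-1 :> R ->
    `|diff_quot v f (ratr p) x - diff_quot v f (ratr q) x| <= k.+1%:R^-1.
Proof.
move=> cf; rewrite derivableE; split=> [/cvg_ex[l ql] k|H].
  have : \forall t \near (0 : R)^', `|l - diff_quot v f t x| <= (k.+1%:R^-1) / 2.
    by move/cvgrPdist_le : ql; apply; rewrite divr_gt0.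
  rewrite near_withinE => /nbhs_ballP[e /= e0 He].
  have e1 : 0 < e^-1 by rewrite invr_gt0.
  exists (Num.truncn e^-1) => p q p0 q0 pm qm.
  have me : (Num.truncn e^-1).+1%:R^-1 < e.
    by rewrite invf_plt ?posrE// truncnS_gt.
  have {}He t : t != 0 -> `|t| < (Num.truncn e^-1).+1%:R^-1 ->
      `|l - diff_quot v f t x| <= (k.+1%:R^-1) / 2.
    by move=> t0 tm; apply: He => //; rewrite -ball_normE /= sub0r normrN (lt_trans tm).
  have := He _ p0 pm; have := He _ q0 qm; rewrite !ler_norml.
  move: (k.+1%:R^-1) => d; move=> /andP[? ?] /andP[? ?]; apply/andP; split; lra.
apply/cauchy_cvgP/cauchy_exP => e e0.
have [k ke] : exists k : nat, k.+1%:R^-1 < e.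
  by exists (Num.truncn e^-1); rewrite invf_plt ?posrE// truncnS_gt.
have [m Hm] := H k.
have m0 : 0 < m.+1%:R^-1 :> R by [].
have [p /[!in_itv]/= /andP[p0 pm]] := rat_in_itvoo m0.
exists (diff_quot v f (ratr p) x).
apply/nbhs_ballP; exists m.+1%:R^-1 => //= t.
rewrite /ball /= sub0r normrN => tm t0.
rewrite /ball /=; apply: le_lt_trans ke.
(* [t] need not be rational: by continuity of the quotient away from 0, a rational [q] slightly to
   the right of [t] has almost the same quotient, and the hypothesis compares [p] with [q]. *)
apply/ler_addgt0Pr => d d0.
have : \forall s \near t, `|diff_quot v f t x - diff_quot v f s x| <= d.
  by have /cvgrPdist_le := @diff_quot_continuous v f x cf t t0; apply.
have : \forall s \near t, s != 0 by apply: (@cvgr_neq0 _ _ _ (nbhs t) _ id t) => //; exact: cvg_id.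
have : \forall s \near t, `|s| < m.+1%:R^-1.
  by apply: (@cvgr_norm_lt _ _ _ (nbhs t) _ id t) => //; exact: cvg_id.
move=> /filterI /[apply] /filterI /[apply] /nbhs_ballP[r /= r0 Hr].
have [q /[!in_itv]/= /andP[q1 q2]] : exists q, ratr q \in `]t, (t + r)[.
  by apply: rat_in_itvoo; rewrite ltrDl.
have [] : (`|ratr q| < m.+1%:R^-1 :> R /\ ratr q != 0 :> R) /\
    `|diff_quot v f t x - diff_quot v f (ratr q) x| <= d.
  by apply: Hr; rewrite -ball_normE /= ltr_distlC; apply/andP; split; lra.
move=> [qm q0] qd.
have := Hm p q (lt0r_neq0 p0) q0 _ qm; rewrite gtr0_norm// => /(_ pm).
move: (k.+1%:R^-1) qd => c; rewrite !ler_norml => /andP[? ?] /andP[? ?]; apply/andP; split; lra.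
Qed.

Lemma bigcapT_measurable_rat (F : rat -> set 'rV[R]_n) :
  (forall q, measurable (F q)) -> measurable (\bigcap_q F q).
Proof.
move=> mF; rewrite -[X in measurable X]setCK setC_bigcap.
by apply: measurableC; apply: bigcupT_measurable_rat => q; exact: measurableC.
Qed.

(** The rational Cauchy condition is a countable combination of conditions on differences of
    measurable quotients. *)
Lemma measurable_derivable v f : continuous f ->
  measurable [set x | derivable f x v].
Proof.
move=> cf.
rewrite (_ : [set _ | _] = \bigcap_k \bigcup_m \bigcap_(p : rat) \bigcap_(q : rat)
  [set x | ratr p != 0 :> R -> ratr q != 0 :> R ->
    `|ratr p| < m.+1%:R^-1 :> R -> `|ratr q| < m.+1%:R^-1 :> R ->
    `|diff_quot v f (ratr p) x - diff_quot v f (ratr q) x| <= k.+1%:R^-1]).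
  apply: bigcapT_measurable => k; apply: bigcupT_measurable => m.
  apply: bigcapT_measurable_rat => p; apply: bigcapT_measurable_rat => q.
  have [pq|pq] := pselect (ratr p != 0 :> R /\ ratr q != 0 :> R /\
    `|ratr p| < m.+1%:R^-1 :> R /\ `|ratr q| < m.+1%:R^-1 :> R); last first.
    rewrite (_ : [set _ | _] = setT)//; apply/seteqP; split => // x _ /= h1 h2 h3 h4.
    by exfalso; apply: pq.
  rewrite (_ : [set _ | _] = [set x | `|diff_quot v f (ratr p) x -
      diff_quot v f (ratr q) x| <= k.+1%:R^-1]); last first.
    apply/seteqP; split => x /= h; last by [].
    by move: pq => [? [? [? ?]]]; exact: h.
  rewrite -[X in measurable X]setTI; apply: measurable_fun_ler => //.
  apply: measurableT_comp => //; apply: measurable_funB;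
    exact: diff_quot_measurable.
apply/seteqP; split => x /=.
  move=> /(derivable_rational v x cf) h k _; have [m hm] := h k.
  by exists m => // p _ q _; exact: hm.
move=> h; apply/(derivable_rational v x cf) => k; have [m _ hm] := h k I.
by exists m => p q; exact: (hm p I q I).
Qed.

Lemma diff_quot_cvgn v f x : derivable f x v ->
  diff_quot v f n.+1%:R^-1 x @[n --> \oo] --> 'D_v f x.
Proof.
rewrite derivableE derive_diff_quot => /cvg_ex[l ql].
rewrite (cvg_lim _ ql)//; move/cvgr_dnbhsP : ql; apply.
split; last exact: cvg_harmonic.
by move=> k; rewrite invr_neq0.
Qed.

(** Multiplied by the indicator of the set of differentiability, the quotients converge everywhere:
    off this set the derivative has its default value 0. *)
Lemma measurable_derive v f : continuous f ->
  measurable_fun setT (fun x => 'D_v f x).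
Proof.
move=> cf; pose D := [set x | derivable f x v].
have mD : measurable D := measurable_derivable v cf.
apply: (@measurable_fun_cvg _ _ _ _
  (fun k x => \1_D x * diff_quot v f k.+1%:R^-1 x)).
- by move=> k; apply: measurable_funM; [exact: measurable_indic|
    exact: diff_quot_measurable].
- move=> x _; have [Dx|nDx] := pselect (D x).
    rewrite indicE mem_set//; under eq_fun do rewrite mul1r.
    exact: diff_quot_cvgn.
  rewrite derive_dvg//; under eq_fun do rewrite indicE memNset// mul0r.
  exact: cvg_cst.
Qed.

End lipschitz_rV.

Section lipschitz_derivable_rV.
Context {R : realType} {n : nat}.
Implicit Types (f g : 'rV[R]_n -> R) (x y v : 'rV[R]_n).
Notation mu := (@lebesgue_measure R).
Notation lam := (@lebesgue_rV R n).

Lemma derivable_line f v x (t : R) :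
  derivable (fun s : R => f (s *: v + x)) t 1 -> derivable f (t *: v + x) v.
Proof.
rewrite /derivable.
rewrite (_ : (fun h : R => h^-1 *: (((fun s : R => f (s *: v + x)) \o shift t) (h *: 1)
   - f (t *: v + x))) = (fun h : R => h^-1 *: ((f \o shift (t *: v + x)) (h *: v)
   - f (t *: v + x))))//.
by apply/funext => h /=; rewrite [h *: 1]mulr1 scalerDl addrA.
Qed.

(* Every line in direction [v] meets the exceptional set in a null set;
   averaging over translations along [v] transfers this to [lam]. *)
Lemma lip_derivable_ae (L : R) f v : is_lip L f ->
  {ae lam, forall x, derivable f x v}.
Proof.
move=> fL; have cf := is_lip_continuous fL.
pose E := ~` [set x | derivable f x v].
have mE : measurable E by apply: measurableC; exact: measurable_derivable.
exists E; split => //.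
pose I01 : set (measurableTypeR R) := `[0, 1]%classic.
pose h (p : measurableTypeR R * 'rV[R]_n) := p.1 *: v + p.2.
have mh : measurable_fun setT h.
  apply: measurable_fun_rVP => i; rewrite /h.
  rewrite (_ : (fun _ => _) = (fun p : measurableTypeR R * 'rV[R]_n =>
    p.1 * v ord0 i + ((fun x : 'rV[R]_n => x ord0 i : measurableTypeR R) \o snd) p)).
    apply: measurable_funD; first exact: measurable_funM.
    by apply: measurableT_comp => //; exact: measurable_coord_rV.
  by apply/funext => p; rewrite !mxE.
pose F (p : measurableTypeR R * 'rV[R]_n) : \bar R :=
  (\1_I01 p.1 * \1_E (h p))%:E.
have mI : measurable I01 by exact: measurable_itv.
have mE1 : measurable_fun setT (\1_E : 'rV[R]_n -> R) by exact: measurable_indic.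
have mI1 : mu I01 = 1%E.
  by rewrite /I01 lebesgue_measure_itv/= lte_fin ltr01 -EFinB subr0.
have mF : measurable_fun setT F.
  apply/measurable_EFinP; apply: measurable_funM.
    by apply: measurableT_comp => //; exact: measurable_indic.
  exact: (measurableT_comp mE1 mh).
have mEh t : measurable_fun setT (fun x => \1_E (h (t, x)) : R).
  exact: (measurableT_comp mE1 (measurableT_comp mh (pair1_measurable t))).
have lamE : lam E = (\int[lam]_x (\1_E x)%:E)%E by rewrite integral_indic// setIT.
have F0 p : (0 <= F p)%E by rewrite lee_fin mulr_ge0.
have := @fubini_tonelli _ _ _ _ _ mu lam F mF F0.
(* Integrating over space first: by translation invariance the inner integral is [lam E] for each
   [t] in [[0, 1]], and these [t] have total mass 1. The other order of integration gives 0. *)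
rewrite (_ : (\int[mu]_x \int[lam]_y F (x, y))%E = lam E); last first.
  transitivity (\int[mu]_x ((\1_I01 x)%:E * lam E))%E.
    apply: eq_integral => t _; rewrite /F /=.
    under eq_integral do rewrite EFinM.
    rewrite ge0_integralZl//; last by apply/measurable_EFinP; exact: mEh.
    congr (_ * _)%E.
    rewrite lamE.
    have mE2 : measurable_fun setT (EFin \o (\1_E : 'rV[R]_n -> R)).
      exact/measurable_EFinP.
    rewrite -[RHS](integral_rV_translate (t *: v) mE2).
    by apply: eq_integral => x _; rewrite /h /= addrC.
  rewrite ge0_integralZr//; last first.
    by apply/measurable_EFinP; exact: measurable_indic.
  rewrite [X in (X * _)%E](_ : _ = mu I01); last by rewrite integral_indic// setIT.
  by rewrite mI1 mul1e.
move=> ->; apply: integral0_eq => x _.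
transitivity (\int[mu]_(y in setT) cst 0%E y)%E; last by rewrite integral_cst// mul0e.
apply: ae_eq_integral; [exact: measurableT|exact: measurable_fun_pair1|exact: measurable_cst|].
pose phi (s : R) := f (s *: v + x).
have philip s t : `|phi s - phi t| <= (L * `|v|) * `|s - t|.
  apply: le_trans (fL _ _) _; rewrite opprD addrACA subrr addr0 -scalerBl normrZ.
  by rewrite -mulrA (mulrC `|v|).
have := lipschitz1_derivable_ae philip.
apply: (@filterS _ _ (ae_filter_ringOfSetsType mu)).
move=> t /derivable_line dt _ /=; rewrite /F /E /= indicE [in X in _ * X]indicE.
by rewrite [X in _ * X](_ : _ = 0) ?mulr0// memNset//=; apply.
Qed.

End lipschitz_derivable_rV.

(** * Integrable functions and Lipschitz approximation *)

Section L1.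
Context {R : realType} {n : nat}.
Implicit Types (f g w b : 'rV[R]_n -> R) (x y v : 'rV[R]_n).
Notation lam := (@lebesgue_rV R n).

Definition L1 w := lam.-integrable setT (EFin \o w).

Lemma L1_measurable w : L1 w -> measurable_fun setT w.
Proof. by move=> /measurable_int/measurable_EFinP. Qed.

Lemma L1D f g : L1 f -> L1 g -> L1 (fun x => f x + g x).
Proof.
move=> If Ig; rewrite /L1 (_ : EFin \o _ = (EFin \o f) \+ (EFin \o g))%E//.
exact: integrableD.
Qed.

Lemma L1N f : L1 f -> L1 (fun x => - f x).
Proof.
move=> If; rewrite /L1 (_ : EFin \o _ = \- (EFin \o f))%E//; exact: integrableN.
Qed.

Lemma L1B f g : L1 f -> L1 g -> L1 (fun x => f x - g x).
Proof. by move=> If Ig; apply: L1D => //; exact: L1N. Qed.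

Lemma L1Z (c : R) f : L1 f -> L1 (fun x => c * f x).
Proof.
move=> If; rewrite /L1 (_ : EFin \o _ = (fun x => c%:E * (EFin \o f) x)%E)//.
exact: integrableZl.
Qed.

Lemma L1_sum (I : Type) (s : seq I) (F : I -> 'rV[R]_n -> R) :
  (forall i, L1 (F i)) -> L1 (fun x => \sum_(i <- s) F i x).
Proof.
move=> IF; elim: s => [|i s IHs].
  rewrite (_ : (fun _ => _) = cst 0); first exact: integrable0.
  by apply/funext => x; rewrite big_nil.
rewrite (_ : (fun _ => _) = fun x => F i x + \sum_(j <- s) F j x); first exact: L1D.
by apply/funext => x; rewrite big_cons.
Qed.

Lemma L1_norm f : L1 f -> L1 (fun x => `|f x|).
Proof.
move=> If; rewrite /L1 (_ : EFin \o _ = (abse \o (EFin \o f))%E)//.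
exact: integrable_abse.
Qed.

Lemma L1_le f g : measurable_fun setT f -> (forall x, `|f x| <= g x) -> L1 g -> L1 f.
Proof.
move=> mf fg; apply: le_integrable => //; first exact/measurable_EFinP.
by move=> x _ /=; rewrite lee_fin (le_trans (fg x))// ler_norm.
Qed.

Lemma L1M w b (M : R) : L1 w -> measurable_fun setT b -> (forall x, `|b x| <= M) ->
  L1 (fun x => w x * b x).
Proof.
move=> Iw mb bM; apply: (@L1_le _ (fun x => M * `|w x|)).
- by apply: measurable_funM => //; exact: L1_measurable.
- by move=> x; rewrite normrM mulrC ler_wpM2r.
- by apply: L1Z; exact: L1_norm.
Qed.

Lemma integral_EFin w : L1 w -> (\int[lam]_x (w x)%:E = (\int[lam]_x w x)%:E)%E.
Proof. by move=> Iw; rewrite /Rintegral fineK//; exact: integrable_fin_num. Qed.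

Lemma le_norm_integral f g : measurable_fun setT f -> (forall x, `|f x| <= g x) ->
  L1 g -> `|\int[lam]_x f x| <= \int[lam]_x g x.
Proof.
move=> mf fg Ig; have If := L1_le mf fg Ig.
apply: le_trans (le_normr_Rintegral measurableT If) _.
by apply: le_Rintegral => //; exact: L1_norm.
Qed.

Lemma L1_norm_mul_le w b (M : R) : L1 w -> measurable_fun setT b ->
  (forall x, `|b x| <= M) ->
  `|\int[lam]_x (w x * b x)| <= M * \int[lam]_x `|w x|.
Proof.
move=> Iw mb bM; rewrite -RintegralZl//; last exact: L1_norm.
apply: le_norm_integral; last by apply: L1Z; exact: L1_norm.
- by apply: measurable_funM => //; exact: L1_measurable.
- by move=> x; rewrite normrM mulrC ler_wpM2r.
Qed.

Lemma eq_integral_ae f g : measurable_fun setT f -> measurable_fun setT g ->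
  {ae lam, forall x, f x = g x} -> \int[lam]_x f x = \int[lam]_x g x.
Proof.
move=> mf mg fg; rewrite /Rintegral; congr fine.
apply: ae_eq_integral => //; try exact/measurable_EFinP.
by apply: (@filterS _ _ (ae_filter_ringOfSetsType lam)) fg => x -> _.
Qed.

Lemma L1_dominated (f_ : nat -> 'rV[R]_n -> R) f g :
  (forall k, measurable_fun setT (f_ k)) -> measurable_fun setT f ->
  {ae lam, forall x, f_ k x @[k --> \oo] --> f x} -> L1 g ->
  (forall k x, `|f_ k x| <= g x) ->
  \int[lam]_x f_ k x @[k --> \oo] --> \int[lam]_x f x.
Proof.
move=> mf_ mf f_f Ig f_g.
have mfE k : measurable_fun setT (EFin \o f_ k) by exact/measurable_EFinP.
have mE : measurable_fun setT (EFin \o f) by exact/measurable_EFinP.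
have [||If _ H] := @dominated_convergence _ _ _ lam setT measurableT _ _ (EFin \o g)
  mfE mE _ Ig _.
- apply: (@filterS _ _ (ae_filter_ringOfSetsType lam)) f_f => x fx _.
  by apply: cvg_EFin => //; exact: nearW.
- by apply: aeW => x k _ /=; rewrite lee_fin.
by apply: fine_cvg; rewrite -integral_EFin.
Qed.

Lemma L1_dominatedM (b_ : nat -> 'rV[R]_n -> R) b w (M : R) :
  L1 w -> (forall k, measurable_fun setT (b_ k)) -> measurable_fun setT b ->
  {ae lam, forall x, b_ k x @[k --> \oo] --> b x} ->
  (forall k x, `|b_ k x| <= M) ->
  \int[lam]_x (w x * b_ k x) @[k --> \oo] --> \int[lam]_x (w x * b x).
Proof.
move=> Iw mb_ mb b_b b_M; have mw := L1_measurable Iw.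
apply: (@L1_dominated _ _ (fun x => M * `|w x|)).
- by move=> k; exact: measurable_funM.
- exact: measurable_funM.
- apply: (@filterS _ _ (ae_filter_ringOfSetsType lam)) b_b => x bx.
  by apply: cvgM => //; exact: cvg_cst.
- by apply: L1Z; exact: L1_norm.
- by move=> k x; rewrite normrM mulrC ler_wpM2r.
Qed.

Lemma L1_translate f v : L1 f -> L1 (fun x => f (x + v)).
Proof.
move=> /integrableP[mf If]; apply/integrableP; split.
  rewrite (_ : EFin \o _ = (EFin \o f) \o rV_affine v 1).
    by apply: measurableT_comp => //; exact: measurable_rV_affine.
  by apply/funext => x; rewrite /rV_affine /= scale1r addrC.
have mf' : measurable_fun setT (fun x => `|(f x)%:E|)%E.
  exact: (measurableT_comp (@abse_measurable _ setT) mf).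
by have := integral_rV_translate v mf' => /= ->.
Qed.

Lemma integral_translate f v : measurable_fun setT f ->
  \int[lam]_x f (x + v) = \int[lam]_x f x.
Proof.
move=> /measurable_EFinP mf; rewrite /Rintegral; congr fine.
exact: (integral_rV_translate v mf).
Qed.

Definition cube (M : R) := [set x : 'rV[R]_n | `|x| <= M].

Lemma cubeE (M : R) : 0 <= M -> cube M = rV_box (fun=> `[- M, M]%classic).
Proof.
move=> M0; apply/seteqP; split => x /=.
  by move=> xM i /=; rewrite in_itv/= -ler_norml (le_trans (coord_le_norm _ _)).
by move=> xM; apply: norm_rV_le => // i; have := xM i; rewrite /= in_itv/= -ler_norml.
Qed.

Lemma cube_lt0 (M : R) : M < 0 -> cube M = set0.
Proof.
move=> M0; rewrite -subset0 => x; rewrite /cube /= => xM.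
by have := le_lt_trans xM M0; rewrite ltNge normr_ge0.
Qed.

Lemma measurable_cube (M : R) : measurable (cube M).
Proof.
have [M0|M0] := leP 0 M; first by rewrite cubeE//; exact: measurable_rV_box.
by rewrite cube_lt0.
Qed.

Lemma lam_cube_lty (M : R) : (lam (cube M) < +oo)%E.
Proof.
have [M0|M0] := leP 0 M; first by rewrite cubeE//; exact: lebesgue_rV_cube_lty.
by rewrite cube_lt0// measure0.
Qed.

Lemma indic_norm_le1 (A : set 'rV[R]_n) x : `|\1_A x : R| <= 1.
Proof. by rewrite indicE; case: (_ \in _); rewrite ?normr1 ?normr0 ?lexx ?ler01. Qed.

Lemma L1_indic (A : set 'rV[R]_n) : measurable A -> (lam A < +oo)%E -> L1 (\1_A).
Proof.
move=> mA Aoo; apply/integrableP; split.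
  by apply/measurable_EFinP; exact: measurable_indic.
rewrite (eq_integral (EFin \o \1_A)); first by rewrite integral_indic// setIT.
by move=> x _ /=; rewrite ger0_norm.
Qed.

Lemma L1_indic_cube (M : R) : L1 (\1_(cube M)).
Proof. by apply: L1_indic; [exact: measurable_cube|exact: lam_cube_lty]. Qed.

Lemma integral_indicR (A : set 'rV[R]_n) : measurable A ->
  \int[lam]_x \1_A x = fine (lam A).
Proof. by move=> mA; rewrite /Rintegral integral_indic// setIT. Qed.

Lemma L1_bounded_cube f (M b : R) : measurable_fun setT f ->
  (forall x, `|f x| <= b) -> (forall x, M < `|x| -> f x = 0) -> L1 f.
Proof.
move=> mf fb f0; apply: (@L1_le _ (fun x => b * \1_(cube M) x)) => //.
  move=> x; rewrite indicE; have [xM|xM] := leP `|x| M.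
    by rewrite mem_set ?mulr1.
  by rewrite f0// normr0 memNset ?mulr0//= => /(lt_le_trans xM); rewrite ltxx.
by apply: L1Z; exact: L1_indic_cube.
Qed.

End L1.

Section inf_convolution.
Context {R : realType} {n : nat}.
Implicit Types (A : set 'rV[R]_n) (f : 'rV[R]_n -> R) (x y : 'rV[R]_n).

(** McShane's formula: when the values are bounded below, the largest [M]-Lipschitz function that is
    at most [f] on [A]. The [inf] of a set unbounded below is a default value, whence the lower
    bounds required by [infconv_le] and [infconv_lip]. *)
Definition infconv A f (M : R) x := inf [set f y + M * `|x - y| | y in A].

Lemma infconv_le A f (M c : R) x y : (forall z, A z -> c <= f z + M * `|x - z|) ->
  A y -> infconv A f M x <= f y + M * `|x - y|.
Proof.
move=> fc Ay; apply: ge_inf; last by exists y.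
by exists c => _ [z Az <-]; exact: fc.
Qed.

Lemma infconv_ge A f (M c : R) x : A !=set0 ->
  (forall z, A z -> c <= f z + M * `|x - z|) -> c <= infconv A f M x.
Proof.
move=> [y Ay] fc; apply: lb_le_inf; first by exists (f y + M * `|x - y|), y.
by move=> _ [z Az <-]; exact: fc.
Qed.

Lemma infconv_lip A f (M : R) : 0 <= M -> A !=set0 ->
  (forall x, exists c, forall z, A z -> c <= f z + M * `|x - z|) ->
  is_lip M (infconv A f M).
Proof.
move=> M0 A0 fc.
have H x y : infconv A f M x <= infconv A f M y + M * `|x - y|.
  have [c xc] := fc x; rewrite -lerBlDr; apply: infconv_ge => // z Az.
  rewrite lerBlDr; apply: le_trans (infconv_le xc Az) _.
  by rewrite -addrA -mulrDr lerD2l ler_wpM2l// [leRHS]addrC ler_distD.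
move=> x y; rewrite ler_norml; have := H x y; have := H y x; rewrite (distrC y).
by move: (M * _) => d h1 h2; apply/andP; split; lra.
Qed.

End inf_convolution.

Section density.
Context {R : realType} {n : nat}.
Implicit Types (f g w psi : 'rV[R]_n -> R) (x y v : 'rV[R]_n).
Notation lam := (@lebesgue_rV R n).

Definition lipf f := exists2 L, 0 <= L & is_lip L f.

Definition csupp f := exists M, forall x, M < `|x| -> f x = 0.

Lemma lipf_measurable f : lipf f -> measurable_fun setT f.
Proof. by move=> [L _]; exact: is_lip_measurable. Qed.

Lemma lipf_csupp_bounded f : lipf f -> csupp f -> exists b, forall x, `|f x| <= b.
Proof.
move=> [L L0 fL] [M fM]; exists (`|f 0| + L * `|M|) => x.
have [xM|/fM ->] := leP `|x| M; last by rewrite normr0 addr_ge0// mulr_ge0.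
rewrite -[X in `|X|](subrK (f 0)) (le_trans (ler_normD _ _))// addrC lerD//.
apply: le_trans (fL _ _) _; rewrite subr0 ler_wpM2l// (le_trans xM)//.
exact: ler_norm.
Qed.

Lemma lipf_csupp_L1 f : lipf f -> csupp f -> L1 f.
Proof.
move=> lf cf; have [b fb] := lipf_csupp_bounded lf cf; have [M fM] := cf.
by apply: (L1_bounded_cube _ fb fM); exact: lipf_measurable.
Qed.

Lemma lipfD f g : lipf f -> lipf g -> lipf (fun x => f x + g x).
Proof.
by move=> [L L0 fL] [M M0 gM]; exists (L + M); [rewrite addr_ge0|exact: is_lipD].
Qed.

Lemma lipfN f : lipf f -> lipf (fun x => - f x).
Proof. by move=> [L L0 fL]; exists L => //; exact: is_lipN. Qed.

Lemma lipfB f g : lipf f -> lipf g -> lipf (fun x => f x - g x).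
Proof. by move=> lf lg; apply: lipfD => //; exact: lipfN. Qed.

Lemma lipfZ (c : R) f : lipf f -> lipf (fun x => c * f x).
Proof.
by move=> [L L0 fL]; exists (`|c| * L); [rewrite mulr_ge0|exact: is_lipZ].
Qed.

Lemma lipf_cst (c : R) : lipf (fun=> c).
Proof. by exists 0 => //; exact: is_lip_cst. Qed.

Lemma lipf_max0 f : lipf f -> lipf (fun x => Num.max 0 (f x)).
Proof. by move=> [L L0 fL]; exists L => //; exact: is_lip_max0. Qed.

Lemma lipf_translate f v : lipf f -> lipf (fun x => f (x + v)).
Proof.
move=> [L L0 fL]; exists L => // x y; rewrite (le_trans (fL _ _))//.
by rewrite opprD addrACA subrr addr0.
Qed.

Lemma csuppD f g : csupp f -> csupp g -> csupp (fun x => f x + g x).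
Proof.
move=> [M fM] [N gN]; exists (Num.max M N) => x; rewrite gt_max => /andP[xM xN].
by rewrite fM// gN// addr0.
Qed.

Lemma csuppM f g : csupp f -> csupp (fun x => f x * g x).
Proof. by move=> [M fM]; exists M => x /fM ->; rewrite mul0r. Qed.

Lemma csuppMr f g : csupp g -> csupp (fun x => f x * g x).
Proof. by move=> [M fM]; exists M => x /fM ->; rewrite mulr0. Qed.

(* [g] need not be bounded: only its values on the support of [f] matter. *)
Lemma lipfM f g : lipf f -> csupp f -> lipf g -> lipf (fun x => f x * g x).
Proof.
move=> lf cf [K K0 gK]; have [b fb] := lipf_csupp_bounded lf cf.
have [M fM] := cf; have [L L0 fL] := lf.
have b0 : 0 <= b by rewrite (le_trans _ (fb 0)).
pose a := `|g 0| + K * `|M|.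
have a0 : 0 <= a by rewrite addr_ge0// mulr_ge0.
have ga x : `|x| <= M -> `|g x| <= a.
  move=> xM; rewrite -[X in `|X|](subrK (g 0)) (le_trans (ler_normD _ _))// addrC lerD//.
  apply: le_trans (gK _ _) _; rewrite subr0 ler_wpM2l// (le_trans xM)//.
  exact: ler_norm.
have H x y : `|x| <= M -> `|f x * g x - f y * g y| <= (a * L + b * K) * `|x - y|.
  move=> xM.
  rewrite (_ : _ - _ = g x * (f x - f y) + f y * (g x - g y)); last by ring.
  rewrite (le_trans (ler_normD _ _))// mulrDl !normrM -!mulrA lerD// ler_pM//.
  exact: ga.
exists (a * L + b * K); first by rewrite addr_ge0// mulr_ge0.
move=> x y; have [xM|xM] := leP `|x| M; first exact: H.
have [yM|yM] := leP `|y| M; first by rewrite distrC (distrC x) H.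
by rewrite !fM// !mul0r subrr normr0 mulr_ge0// addr_ge0// mulr_ge0.
Qed.

Definition lip_approx w := L1 w /\ forall e : R, 0 < e ->
  exists psi, [/\ lipf psi, csupp psi & \int[lam]_x `|w x - psi x| <= e].

Lemma lip_approx_lim w : L1 w ->
  (forall e : R, 0 < e -> exists2 w', lip_approx w' & \int[lam]_x `|w x - w' x| <= e) ->
  lip_approx w.
Proof.
move=> Iw H; split => // e e0.
have e2 : 0 < e / 2 by rewrite divr_gt0.
have [w' [Iw' /(_ _ e2)[psi [lpsi cpsi wpsi]]] ww'] := H _ e2.
exists psi; split => //.
have Ip := lipf_csupp_L1 lpsi cpsi.
rewrite [leRHS]splitr (le_trans _ (lerD ww' wpsi))//.
rewrite -RintegralD//; try by apply: L1_norm; exact: L1B.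
apply: le_Rintegral => //; first by apply: L1_norm; exact: L1B.
  by apply: L1D; apply: L1_norm; exact: L1B.
by move=> x _; exact: ler_distD.
Qed.

Lemma lip_approxD w w' : lip_approx w -> lip_approx w' ->
  lip_approx (fun x => w x + w' x).
Proof.
move=> [Iw H] [Iw' H']; split; first exact: L1D.
move=> e e0; have e2 : 0 < e / 2 by rewrite divr_gt0.
have [psi [lp cp wp]] := H _ e2; have [psi' [lp' cp' wp']] := H' _ e2.
exists (fun x => psi x + psi' x); split; [exact: lipfD|exact: csuppD|].
have Ip := lipf_csupp_L1 lp cp; have Ip' := lipf_csupp_L1 lp' cp'.
rewrite [leRHS]splitr (le_trans _ (lerD wp wp'))//.
rewrite -RintegralD//; try by apply: L1_norm; exact: L1B.
apply: le_Rintegral => //.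
- by apply: L1_norm; apply: L1B; exact: L1D.
- by apply: L1D; apply: L1_norm; exact: L1B.
by move=> x _; rewrite opprD addrACA ler_normD.
Qed.

Lemma lip_approxZ (c : R) w : lip_approx w -> lip_approx (fun x => c * w x).
Proof.
move=> [Iw H]; split; first exact: L1Z.
move=> e e0; have e2 : 0 < e / (`|c| + 1) by rewrite divr_gt0// ltr_wpDl.
have [psi [lp cp wp]] := H _ e2.
exists (fun x => c * psi x); split; [exact: lipfZ|exact: csuppMr|].
have Ip := lipf_csupp_L1 lp cp.
under eq_Rintegral do rewrite -mulrBr normrM.
rewrite RintegralZl//; last by apply: L1_norm; exact: L1B.
apply: (@le_trans _ _ (`|c| * (e / (`|c| + 1)))); first by rewrite ler_wpM2l.
rewrite mulrCA ger_pMr// ler_pdivrMr ?mul1r ?ltr_wpDl//.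
by rewrite lerDl.
Qed.

Lemma lip_approx_lip psi : lipf psi -> csupp psi -> lip_approx psi.
Proof.
move=> lp cp; split; first exact: lipf_csupp_L1.
move=> e e0; exists psi; split => //.
under eq_Rintegral do rewrite subrr normr0.
by rewrite Rintegral_cst// mul0r ltW.
Qed.

(** The inf-convolution of slope [k] lies between 0 and the indicator, and equals 1 at a point of
    [U] as soon as [1/k] is below its distance to the complement. Dominated convergence then gives
    closeness in L^1. *)
Lemma lip_approx_open (U : set 'rV[R]_n) (M : R) :
  open U -> U `<=` cube M -> lip_approx (\1_U).
Proof.
move=> oU UM.
have mU := open_measurable_rV oU.
have IU : L1 (\1_U).
  apply: L1_indic => //; apply: le_lt_trans (lam_cube_lty (R := R) (n := n) M).
  by apply: le_measure; rewrite ?inE//; exact: measurable_cube.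
pose psi (k : nat) := infconv setT (\1_U : _ -> R) k%:R.
have lb k x : forall z, setT z -> 0 <= \1_U z + k%:R * `|x - z| :> R.
  by move=> z _; rewrite addr_ge0// mulr_ge0.
have ne : [set: 'rV[R]_n] !=set0 by exists 0.
have lpsi k : lipf (psi k).
  exists k%:R => //; apply: infconv_lip => // x; exists 0; exact: lb.
have psiU k x : psi k x <= \1_U x.
  by rewrite (le_trans (infconv_le (lb k x) _ (y := x)))// subrr normr0 mulr0 addr0.
have psi0 k x : 0 <= psi k x by apply: infconv_ge => //; exact: lb.
have cpsi k : csupp (psi k).
  exists M => x xM; apply/eqP; rewrite eq_le psi0 andbT (le_trans (psiU _ _))//.
  by rewrite indicE memNset// => /UM; rewrite /cube/= leNgt xM.
have cvpsi x : psi k x @[k --> \oo] --> (\1_U x : R).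
  have [Ux|nUx] := pselect (U x); last first.
    rewrite indicE memNset//; apply: cvg_near_cst; apply: nearW => k.
    apply/eqP; rewrite eq_le psi0 andbT (le_trans (psiU _ _))//.
    by rewrite indicE memNset.
  have /nbhs_ballP[e /= e0 eU] : nbhs x U by exact: open_nbhs_nbhs.
  rewrite indicE mem_set//; apply: cvg_near_cst.
  exists (Num.truncn e^-1).+1 => // k /= ke.
  apply/eqP; rewrite eq_le; apply/andP; split.
    by rewrite (le_trans (psiU _ _))// indicE mem_set.
  apply: infconv_ge => // z _; rewrite indicE.
  have [Uz|nUz] := pselect (U z); first by rewrite mem_set// lerDl mulr_ge0.
  rewrite memNset// add0r.
  have xz : e <= `|x - z|.
    by rewrite leNgt; apply/negP => xz; apply: nUz; apply: eU; rewrite -ball_normE.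
  apply: (@le_trans _ _ (e^-1 * e)); first by rewrite mulVf ?lt0r_neq0.
  rewrite ler_pM ?invr_ge0 ?(ltW e0)//.
  by rewrite (le_trans (ltW (truncnS_gt _)))// ler_nat.
split => // e e0.
have : \int[lam]_x `|\1_U x - psi k x| @[k --> \oo] --> \int[lam]_x (cst 0 x : R).
  apply: (@L1_dominated _ _ _ _ (\1_U)) => //.
  - move=> k; apply: measurableT_comp => //; apply: measurable_funB => //.
    exact: lipf_measurable.
  - apply: aeW => x /=.
    have : (\1_U x - psi k x) @[k --> \oo] --> (\1_U x - \1_U x : R).
      by apply: cvgB; [exact: cvg_cst|exact: cvpsi].
    by move/cvg_norm; rewrite subrr normr0.
  - move=> k x; rewrite normr_id ger0_norm ?subr_ge0// gerBl//.
rewrite Rintegral_cst// mul0r => /cvgrPdist_le /(_ _ e0)[N _ /(_ N)/= HN].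
exists (psi N); split => //.
by have := HN (leqnn N); rewrite sub0r normrN; apply: le_trans; exact: ler_norm.
Qed.

(** Needed for Dynkin induction: open sets are stable under intersection and their indicators are
    approximated directly. *)
Lemma measurable_rV_open :
  (measurable : set (set 'rV[R]_n)) = <<s (open : set (set 'rV[R]_n)) >>.
Proof.
apply/seteqP; split; last first.
  apply: smallest_sub; first exact: sigma_algebra_measurable.
  exact: open_measurable_rV.
rewrite {1}/measurable /= /g_sigma_preimage; apply: smallest_sub.
  exact: smallest_sigma_algebra.
rewrite -bigcup_seq => X [i _] [Y mY <-].
pose T := g_sigma_algebraType (open : set (set 'rV[R]_n)).
pose f : T -> R := fun x : 'rV[R]_n => x ord0 i.
suff : measurable_fun setT f by apply.
apply: (measurability _ (RGenOpens.measurableE R)) => //.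
move=> _ [_ [a [b ->]] <-]; rewrite setTI.
apply: sub_sigma_algebra; apply: open_comp; last exact: interval_open.
by move=> x _; exact: coord_continuous.
Qed.

Definition ocube (M : R) := [set x : 'rV[R]_n | `|x| < M].

Lemma open_ocube M : open (ocube M).
Proof.
rewrite (_ : ocube M = ball 0 M); first exact: ball_open.
by rewrite -ball_normE; apply/seteqP; split => x; rewrite /ocube/= sub0r normrN.
Qed.

(** Dynkin induction from open sets. Everything is intersected with a fixed open cube, so that
    complements keep integrable indicators. *)
Lemma lip_approx_indic (M : R) (A : set 'rV[R]_n) : measurable A ->
  lip_approx (\1_(A `&` ocube M)).
Proof.
have mC := open_measurable_rV (@open_ocube M).
have IC : L1 (\1_(ocube M)).
  apply: L1_indic => //; apply: le_lt_trans (lam_cube_lty (R := R) (n := n) M).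
  apply: le_measure; rewrite ?inE//; first exact: measurable_cube.
  by move=> x; exact: ltW.
have IAC (B : set 'rV[R]_n) : measurable B -> L1 (\1_(B `&` ocube M)).
  move=> mB; apply: L1_le IC; first by apply: measurable_indic; exact: measurableI.
  move=> x; rewrite !indicE ger0_norm// ler_nat.
  by case: (boolP (x \in _ `&` _)) => //; rewrite in_setI => /andP[_ ->].
move=> mA.
pose P (A : set 'rV[R]_n) := lip_approx (\1_(A `&` ocube M)).
rewrite -/(P A).
apply: (dynkin_induction measurable_rV_open); last by rewrite -measurable_rV_open.
- by move=> U V; exact: openI.
- by rewrite /P setTI; apply: (@lip_approx_open _ M); [exact: open_ocube|move=> x; exact: ltW].
- move=> U oU; apply: (@lip_approx_open _ M); first by apply: openI => //; exact: open_ocube.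
  by move=> x [_]; exact: ltW.
- move=> B mB PB; rewrite /P.
  rewrite (_ : \1_ _ = (fun x => \1_(ocube M) x + -1 * \1_(B `&` ocube M) x)).
    apply: lip_approxD; last exact: lip_approxZ.
    by apply: (@lip_approx_open _ M); [exact: open_ocube|move=> x; exact: ltW].
  apply/funext => x; rewrite !indicE !in_setI in_setC.
  by case: (x \in B); case: (x \in ocube M); rewrite ?mulN1r ?subrr ?subr0 ?addr0.
move=> F mF tF PF; rewrite /P.
have mU : measurable (\bigcup_k F k) by exact: bigcup_measurable.
pose s N x : R := \sum_(k < N) \1_(F k `&` ocube M) x.
have lN N : lip_approx (s N).
  elim: N => [|N IH].
    rewrite (_ : s 0 = fun=> 0); last by apply/funext => x; rewrite /s big_ord0.
    by apply: lip_approx_lip; [exact: lipf_cst|exists 0].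
  rewrite (_ : s N.+1 = fun x => s N x + \1_(F N `&` ocube M) x).
    exact: lip_approxD IH (PF N).
  by apply/funext => x; rewrite /s big_ord_recr.
(* Disjointness makes the partial sum an indicator; all remainders are then dominated by the
   indicator of the cube. *)
have sU N x : s N x = \1_((\bigcup_(k < N) F k) `&` ocube M) x.
  elim: N => [|N IH]; first by rewrite /s big_ord0 bigcup_mkord big_ord0 set0I indic0.
  rewrite /s big_ord_recr /= -/(s N x) IH !indicE !in_setI.
  case: (x \in ocube M); rewrite ?andbT ?andbF ?addr0//.
  rewrite !bigcup_mkord big_ord_recr /= in_setU.
  have [xN|xN] := boolP (x \in F N); last by rewrite orbF addr0.
  rewrite orbT memNset ?add0r// -bigcup_mkord => -[k /= kN Fkx].
  have := tF k N I I; move/(_ (ex_intro _ x (conj Fkx (set_mem xN)))) => kN'.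
  by rewrite kN' ltnn in kN.
apply: lip_approx_lim; first exact: IAC.
move=> e e0.
have : \int[lam]_x `|\1_((\bigcup_k F k) `&` ocube M) x - s N x| @[N --> \oo] -->
    \int[lam]_x (cst 0 x : R).
  apply: (@L1_dominated _ _ _ _ (\1_(ocube M))) => //.
  - move=> N; apply: measurableT_comp => //; apply: measurable_funB.
      exact: L1_measurable (IAC _ mU).
    by have [+ _] := lN N; exact: L1_measurable.
  - apply: aeW => x /=; apply: cvg_near_cst.
    have [[k _ Fkx]|nF] := pselect ((\bigcup_k F k) x); last first.
      apply: nearW => N; rewrite sU !indicE !in_setI.
      rewrite memNset// (memNset (A := \bigcup_(k < N) _)) ?subrr ?normr0//.
      by move=> [k _ ?]; apply: nF; exists k.
    exists k.+1 => // N /= kN; rewrite sU !indicE !in_setI mem_set; last by exists k.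
    by rewrite (mem_set (A := \bigcup_(k < N) _)) ?subrr ?normr0//; exists k.
  - move=> N x; rewrite sU !indicE !in_setI normr_id.
    case: (x \in ocube M); rewrite ?andbF ?subrr ?normr0// !andbT.
    case: (x \in _); case: (x \in _); rewrite ?subrr ?subr0 ?sub0r ?normrN ?normr1 ?normr0//.
rewrite Rintegral_cst// mul0r => /cvgrPdist_le /(_ _ e0)[N _ /(_ N (leqnn N))/= HN].
exists (s N) => //.
by move: HN; rewrite sub0r normrN; apply: le_trans; exact: ler_norm.
Qed.

Import HBSimple.

Lemma lip_approx_sfun (M : R) (g : {sfun 'rV[R]_n >-> R}) :
  lip_approx (fun x => g x * \1_(ocube M) x).
Proof.
rewrite (_ : (fun _ => _) = fun x => \sum_(y <- finmap.enum_fset (fset_set (range g)))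
    y * \1_(g @^-1` [set y] `&` ocube M) x); last first.
  apply/funext => x; rewrite {1}fimfunE fsbig_finite//= mulr_suml.
  by apply: eq_bigr => y _; rewrite indicI -mulrA.
elim: (finmap.enum_fset _) => [|y t IH].
  rewrite (_ : (fun _ => _) = fun=> 0); last by apply/funext => x; rewrite big_nil.
  by apply: lip_approx_lip; [exact: lipf_cst|exists 0].
rewrite (_ : (fun _ => _) = fun x => y * \1_(g @^-1` [set y] `&` ocube M) x +
  \sum_(z <- t) z * \1_(g @^-1` [set z] `&` ocube M) x); last first.
  by apply/funext => x; rewrite big_cons.
apply: lip_approxD => //; apply: lip_approxZ; apply: lip_approx_indic.
exact: measurable_sfunP.
Qed.

Theorem L1_lip_approx w : L1 w -> lip_approx w.
Proof.
move=> Iw; apply: lip_approx_lim => // e e0.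
have mC M := open_measurable_rV (@open_ocube M).
have e2 : 0 < e / 2 by rewrite divr_gt0.
have [g [Ig _ gw]] := approximation_sfun_integrable measurableT Iw.
have [k wg] : exists k, \int[lam]_x `|w x - g k x| <= e / 2.
  have : fine (\int[lam]_z `|(EFin \o w) z - (g k z)%:E|)%E @[k --> \oo] --> (0 : R).
    by apply: fine_cvg.
  move=> /cvgrPdist_le /(_ _ e2)[k _ /(_ k (leqnn k))/=].
  rewrite sub0r normrN => H; exists k; apply: le_trans H.
  by rewrite (le_trans _ (ler_norm _)).
have {}Ig : L1 (g k) := Ig k; move: (g k) Ig wg => {gw}g Ig wg.
(* The simple function may have unbounded support. Truncating it to a cube costs at most the mass of
   [w] outside that cube, which tends to 0. *)
have : \int[lam]_x (`|w x| * \1_(~` ocube M%:R) x) @[M --> \oo] -->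
    \int[lam]_x (`|w x| * (cst 0 x)).
  apply: (@L1_dominatedM _ _ _ _ _ 1); first exact: L1_norm.
  - by move=> M; apply: measurable_indic; exact: measurableC.
  - by [].
  - apply: aeW => x; apply: cvg_near_cst.
    exists (Num.truncn `|x|).+1 => // M /= xM.
    rewrite indicE memNset//; apply; rewrite /ocube/=.
    by rewrite (lt_le_trans (truncnS_gt _))// ler_nat.
  - by move=> M x; exact: indic_norm_le1.
under [X in _ --> X -> _]eq_Rintegral do rewrite mulr0.
rewrite Rintegral_cst// mul0r => /cvgrPdist_le /(_ _ e2)[M _ /(_ M (leqnn M))/=].
rewrite sub0r normrN => HM.
exists (fun x => g x * \1_(ocube M%:R) x); first exact: lip_approx_sfun.
have mCM : measurable_fun setT (\1_(~` ocube M%:R) : 'rV[R]_n -> R).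
  by apply: measurable_indic; exact: measurableC.
have IwC : L1 (fun x => `|w x| * \1_(~` ocube M%:R) x).
  apply: (@L1M _ _ _ _ 1) => //; first exact: L1_norm.
  by move=> x; exact: indic_norm_le1.
have Iwg : L1 (fun x => `|w x - g x|) by apply: L1_norm; exact: L1B.
rewrite [leRHS]splitr (le_trans _ (lerD wg (le_trans (ler_norm _) HM)))//.
rewrite -RintegralD//; apply: le_Rintegral => //.
- apply: L1_norm; apply: L1B => //; apply: (@L1M _ _ _ _ 1) => //.
  by move=> x; exact: indic_norm_le1.
- exact: L1D.
move=> x _; rewrite !indicE in_setC; case: (x \in ocube _) => /=.
  by rewrite mulr1 mulr0 addr0.
by rewrite mulr0 subr0 mulr1 lerDr.
Qed.

End density.

(** * Partial derivatives and Jacobians *)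

Section partial_derivatives.
Context {R : realType} {n : nat}.
Implicit Types (f g w phi psi : 'rV[R]_n -> R) (x y v : 'rV[R]_n) (j c : 'I_n).
Notation lam := (@lebesgue_rV R n).

Definition pd j f x : R := 'D_(delta_mx ord0 j) f x.

Definition good f x := forall j, derivable f x (delta_mx ord0 j).

Lemma good_ae f : lipf f -> {ae lam, forall x, good f x}.
Proof.
move=> [L _ fL]; apply: (@filter_forall _ _ _ _ (ae_filter_ringOfSetsType lam)).
by move=> j; exact: lip_derivable_ae fL.
Qed.

Lemma aeI (P Q : set 'rV[R]_n) : {ae lam, forall x, P x} -> {ae lam, forall x, Q x} ->
  {ae lam, forall x, P x /\ Q x}.
Proof. exact: (@filterI _ _ (ae_filter_ringOfSetsType lam)). Qed.

Lemma ae_imp (P Q : set 'rV[R]_n) : (forall x, P x -> Q x) ->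
  {ae lam, forall x, P x} -> {ae lam, forall x, Q x}.
Proof. exact: (@filterS _ _ (ae_filter_ringOfSetsType lam)). Qed.

Lemma measurable_pd j f : lipf f -> measurable_fun setT (pd j f).
Proof. by move=> [L _ /is_lip_continuous]; exact: measurable_derive. Qed.

Lemma pd_le j f (L : R) x : 0 <= L -> is_lip L f -> `|pd j f x| <= L.
Proof. by move=> L0 fL; apply: derive_lip => //; exact: norm_delta_mx. Qed.

Lemma pd_local_le j f (L : R) x : 0 <= L ->
  (\forall y \near x, `|f y - f x| <= L * `|y - x|) -> `|pd j f x| <= L.
Proof. by move=> L0 fL; apply: derive_local_lip => //; exact: norm_delta_mx. Qed.

Lemma pd_near j f g x : (\forall y \near x, f y = g y) -> pd j f x = pd j g x.
Proof. by move=> fg; exact: near_eq_derive. Qed.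

Lemma pdD j f g x : good f x -> good g x ->
  pd j (fun y => f y + g y) x = pd j f x + pd j g x.
Proof. by move=> fx gx; rewrite /pd -deriveD. Qed.

Lemma pdB j f g x : good f x -> good g x ->
  pd j (fun y => f y - g y) x = pd j f x - pd j g x.
Proof. by move=> fx gx; rewrite /pd -deriveB. Qed.

Lemma pdZ j (a : R) f x : good f x -> pd j (fun y => a * f y) x = a * pd j f x.
Proof. by move=> fx; exact: (deriveZ a (fx j)). Qed.

Lemma pdM j f g x : good f x -> good g x ->
  pd j (fun y => f y * g y) x = f x * pd j g x + g x * pd j f x.
Proof. by move=> fx gx; exact: (deriveM (fx j) (gx j)). Qed.

Lemma pd_cst j (a : R) x : pd j (fun=> a) x = 0.
Proof. by rewrite /pd derive_near_eq0//; apply: (@filterE _ _ (nbhs_filter x)). Qed.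

Lemma pd_coord j c x : pd j (fun y => y ord0 c) x = (c == j)%:R.
Proof.
rewrite /pd derive_diff_quot; apply: cvg_lim => //; apply: cvg_near_cst.
near=> t; have t0 : t != 0 by near: t; exact: nbhs_dnbhs_neq.
by rewrite /diff_quot !mxE eqxx/= addrK mulKf.
Unshelve. all: by end_near. Qed.

Lemma lipf_coord c : lipf (fun y : 'rV[R]_n => y ord0 c).
Proof.
exists 1 => // x y; rewrite mul1r; have := coord_le_norm (x - y) c.
by rewrite !mxE.
Qed.

(** At a minimum the quotients with increments [-1/(k+1)] are nonpositive and those with [1/(k+1)]
    nonnegative, and both tend to the derivative. *)
Lemma derive_ge0_seq v f x : derivable f x v ->
  (forall y, f x <= f y) -> 'D_v f x = 0.
Proof.
move=> fx fmin; have := fx; rewrite derivableE => /cvg_ex[l ql].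
rewrite derive_diff_quot (cvg_lim _ ql)//.
move/cvgr_dnbhsP in ql; apply/eqP; rewrite eq_le; apply/andP; split.
  have : diff_quot v f (- k.+1%:R^-1) x @[k --> \oo] --> l.
    apply: ql; split; first by move=> k; rewrite oppr_eq0 invr_neq0.
    by rewrite -oppr0; apply: cvgN; exact: cvg_harmonic.
  move=> qc; rewrite -(cvg_lim _ qc)//; apply: limr_le; first by apply/cvg_ex; exists l.
  apply: nearW => k; rewrite /diff_quot invrN invrK mulNr oppr_le0.
  by rewrite mulr_ge0// subr_ge0.
have : diff_quot v f (k.+1%:R^-1) x @[k --> \oo] --> l.
  by apply: ql; split; [move=> k; rewrite invr_neq0|exact: cvg_harmonic].
move=> qc; rewrite -(cvg_lim _ qc)//; apply: limr_ge; first by apply/cvg_ex; exists l.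
by apply: nearW => k; rewrite /diff_quot invrK mulr_ge0// subr_ge0.
Qed.

(** At a zero of [f] the positive part has a minimum, so its derivative vanishes there, in
    accordance with the strict inequality in the factor. Elsewhere the positive part is locally [f]
    or 0. *)
Lemma pd_max0 j f x : lipf f -> good (fun y => Num.max 0 (f y)) x ->
  pd j (fun y => Num.max 0 (f y)) x = (0 < f x)%R%:R * pd j f x.
Proof.
move=> [L L0 fL] gx; have cf : f y @[y --> x] --> f x by have /(_ x) := is_lip_continuous fL.
have [fx|fx|fx] := ltgtP 0 (f x).
- rewrite mul1r; apply: pd_near.
  have : \forall y \near x, 0 < f y by exact: (@cvgr_gt _ _ (nbhs x) (nbhs_filter x) f (f x) cf).
  by apply: (@filterS _ _ (nbhs_filter x)) => y /ltW /max_r.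
- rewrite mul0r; transitivity (pd j (fun=> 0) x); last exact: pd_cst.
  apply: pd_near.
  have : \forall y \near x, f y < 0 by exact: (@cvgr_lt _ _ (nbhs x) (nbhs_filter x) f (f x) cf).
  by apply: (@filterS _ _ (nbhs_filter x)) => y /ltW /max_l.
- rewrite mul0r; apply: derive_ge0_seq => // y.
  by rewrite -fx maxxx le_max lexx.
Qed.

Lemma pd_supp0 j phi (M : R) : (forall x, M < `|x| -> phi x = 0) ->
  forall x, M < `|x| -> pd j phi x = 0.
Proof.
move=> pM x xM; transitivity (pd j (fun=> 0) x); last exact: pd_cst.
apply: pd_near.
apply: (@filterS _ _ (nbhs_filter x)) (nbhsx_ballx x (`|x| - M) _); last by rewrite subr_gt0.
move=> y; rewrite -ball_normE /= => xy; apply: pM.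
by have := ler_distD 0 x y; rewrite !subr0 sub0r normrN; have := lerB_dist x y; lra.
Qed.

(** Difference quotients have integral 0 by translation invariance, are bounded by the Lipschitz
    constant, and converge almost everywhere to the derivative. *)
Lemma integral_pd_eq0 j phi : lipf phi -> csupp phi -> \int[lam]_x pd j phi x = 0.
Proof.
move=> lp cp; have [L L0 pL] := lp; have [M pM] := cp.
have mp := lipf_measurable lp.
have cphi := is_lip_continuous pL.
pose e := delta_mx ord0 j : 'rV[R]_n.
have e1 : `|e| = 1 := norm_delta_mx j.
(* Increments are at most 1, so all difference quotients vanish outside this cube, whose indicator
   serves as dominating function. *)
pose C : 'rV[R]_n -> R := \1_(cube (M + 1)).
have dq0 k x : C x * diff_quot e phi k.+1%:R^-1 x = diff_quot e phi k.+1%:R^-1 x.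
  rewrite /C indicE; case: (boolP (x \in _)) => [_|/negP xM]; first by rewrite mul1r.
  have {}xM : M + 1 < `|x| by rewrite ltNge; apply/negP => H; apply: xM; rewrite inE.
  rewrite mul0r /diff_quot !pM ?subrr ?mulr0//; first by rewrite (lt_trans _ xM)// ltrDl.
  have : `|k.+1%:R^-1 *: e| <= 1.
    by rewrite normrZ e1 mulr1 ger0_norm// invf_le1 ?ler1n.
  have := ler_normB (k.+1%:R^-1 *: e + x) (k.+1%:R^-1 *: e); rewrite addrAC subrr add0r.
  by move: (`|k.+1%:R^-1 *: e|) (`|_ + x|) => a b; lra.
have : \int[lam]_x (C x * diff_quot e phi k.+1%:R^-1 x) @[k --> \oo] -->
    \int[lam]_x (C x * pd j phi x).
  apply: (@L1_dominatedM _ _ _ _ _ L); first exact: L1_indic_cube.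
  - by move=> k; exact: diff_quot_measurable.
  - exact: measurable_pd.
  - apply: ae_imp (good_ae lp) => x /(_ j); exact: diff_quot_cvgn.
  - move=> k x; rewrite /diff_quot normrM invrK ger0_norm//.
    rewrite -ler_pdivlMl// mulrC (le_trans (pL _ _))// addrK normrZ e1 mulr1.
    by rewrite ger0_norm.
under eq_cvg do under eq_Rintegral do rewrite dq0.
rewrite (_ : (fun k => _) = fun=> 0); last first.
  apply/funext => k; rewrite /diff_quot.
  rewrite RintegralZl//; last first.
    apply: L1B; last exact: lipf_csupp_L1.
    under [X in L1 X]eq_fun do rewrite addrC.
    exact: L1_translate (lipf_csupp_L1 lp cp).
  rewrite RintegralB//; last 2 first.
    under eq_fun do rewrite addrC.
    exact: (L1_translate _ (lipf_csupp_L1 lp cp)).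
    exact: lipf_csupp_L1.
  under eq_Rintegral do rewrite addrC.
  by rewrite integral_translate// subrr mulr0.
move=> H; have <- : \int[lam]_x (C x * pd j phi x) = \int[lam]_x pd j phi x.
  apply: eq_Rintegral => x _; rewrite /C indicE; case: (boolP (x \in _)) => [_|/negP xM].
    by rewrite mul1r.
  rewrite mul0r (pd_supp0 j pM)//; apply: (@lt_trans _ _ (M + 1)); first by rewrite ltrDl.
  by rewrite ltNge; apply/negP => H'; apply: xM; rewrite inE.
by apply: (cvg_unique _ H); [exact: Rhausdorff|exact: cvg_cst].
Qed.

Lemma L1_pd j phi : lipf phi -> csupp phi -> L1 (pd j phi).
Proof.
move=> lp cp; have [L L0 pL] := lp; have [M pM] := cp.
apply: (@L1_bounded_cube _ _ _ M L); first exact: measurable_pd.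
  by move=> x; exact: pd_le.
by move=> x xM; exact: pd_supp0 pM _ xM.
Qed.

(** The product [phi f] is Lipschitz with compact support, so its derivative has integral 0. *)
Lemma integral_by_parts j phi f : lipf phi -> csupp phi -> lipf f ->
  \int[lam]_x (phi x * pd j f x) = - \int[lam]_x (f x * pd j phi x).
Proof.
move=> lp cp lf; have [L L0 fL] := lf.
have I1 : L1 (fun x => phi x * pd j f x).
  apply: (@L1M _ _ _ _ L); [exact: lipf_csupp_L1|exact: measurable_pd|].
  by move=> x; exact: pd_le.
have lpf := lipfM lp cp lf; have cpf := csuppM f cp.
have I3 := L1_pd j lpf cpf.
have ae3 : {ae lam, forall x, f x * pd j phi x =
    pd j (fun y => phi y * f y) x - phi x * pd j f x}.
  apply: ae_imp (aeI (good_ae lp) (good_ae lf)) => x [px fx].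
  by rewrite pdM// addrAC subrr add0r.
rewrite (eq_integral_ae _ _ ae3); last 2 first.
- by apply: measurable_funM; [exact: lipf_measurable|exact: measurable_pd].
- by apply: L1_measurable; exact: L1B.
by rewrite RintegralB// integral_pd_eq0// sub0r opprK.
Qed.

(** Weak-star convergence of derivatives bounded by [L]. Against a Lipschitz function of compact
    support it follows from integration by parts and pointwise convergence; density of these
    functions in L^1 and the uniform bound extend it to every integrable [G]. *)
Lemma pd_weak_cvg j G (f_ : nat -> 'rV[R]_n -> R) f (L : R) : L1 G -> 0 <= L ->
  (forall k, is_lip L (f_ k)) -> is_lip L f -> (forall x, f_ k x @[k --> \oo] --> f x) ->
  \int[lam]_x (G x * pd j (f_ k) x) @[k --> \oo] --> \int[lam]_x (G x * pd j f x).
Proof.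
move=> IG L0 fL_ fL f_f.
have lf_ k : lipf (f_ k) by exists L.
have lf : lipf f by exists L.
have IGf g : lipf g -> L1 (fun x => G x * pd j g x).
  move=> lg; have [K K0 gK] := lg; apply: (@L1M _ _ _ _ K) => //.
    exact: measurable_pd.
  by move=> x; exact: pd_le.
have test psi : lipf psi -> csupp psi ->
    \int[lam]_x (psi x * pd j (f_ k) x) @[k --> \oo] --> \int[lam]_x (psi x * pd j f x).
  move=> lp cp; rewrite integral_by_parts//.
  under eq_cvg do rewrite integral_by_parts//.
  apply: cvgN; have [M pM] := cp; have [K K0 pK] := lp.
  have [b fb] : exists b, forall k, `|f_ k 0| <= b.
    have /cvg_seq_bounded[b [_ /(_ (b + 1))]] : cvgn (f_ ^~ 0).
      by apply/cvg_ex; exists (f 0).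
    rewrite ltrDl ltr01 => /(_ isT) bb; exists (b + 1) => k; exact: bb.
  apply: (@L1_dominated _ _ _ _ (fun x => (b + L * M) * K * \1_(cube M) x)).
  - move=> k; apply: measurable_funM; [exact: lipf_measurable|exact: measurable_pd].
  - apply: measurable_funM; [exact: lipf_measurable|exact: measurable_pd].
  - apply: aeW => x; apply: cvgM; [exact: f_f|exact: cvg_cst].
  - by apply: L1Z; exact: L1_indic_cube.
  - move=> k x; rewrite indicE; have [xM|xM] := leP `|x| M.
      rewrite mem_set ?mulr1// normrM ler_pM//; last exact: pd_le.
      rewrite -[X in `|X|](subrK (f_ k 0)) (le_trans (ler_normD _ _))// addrC lerD//.
      by rewrite (le_trans (fL_ k _ _))// subr0 ler_wpM2l.
    rewrite (pd_supp0 j pM)// mulr0 normr0 memNset ?mulr0//.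
    by rewrite /cube/= => /(lt_le_trans xM); rewrite ltxx.
apply/cvgrPdist_le => e e0.
pose d := e / (3 * (L + 1)).
have L1_gt0 : 0 < L + 1 by rewrite ltr_wpDl.
have d0 : 0 < d by rewrite divr_gt0// mulr_gt0.
have Ld : L * d <= e / 3.
  rewrite /d mulrA ler_pdivrMr ?mulr_gt0//.
  rewrite (_ : e / 3 * _ = e * (L + 1)); last by field.
  by rewrite mulrDr mulr1 mulrC lerDl ltW.
have [_ /(_ _ d0)[psi [lp cp Gpsi]]] := L1_lip_approx IG.
have /cvgrPdist_le /(_ (e / 3)) := test _ lp cp.
rewrite divr_gt0// => /(_ isT); apply: filterS => k Hk.
have Ip := lipf_csupp_L1 lp cp.
have H g : is_lip L g ->
    `|\int[lam]_x (G x * pd j g x) - \int[lam]_x (psi x * pd j g x)| <= e / 3.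
  move=> gL; have lg : lipf g by exists L.
  rewrite -RintegralB//; last 2 first.
  - exact: IGf.
  - by apply: (@L1M _ _ _ _ L) => //; [exact: measurable_pd|move=> x; exact: pd_le].
  under eq_Rintegral do rewrite -mulrBl.
  apply: le_trans Ld; rewrite (le_trans (@L1_norm_mul_le _ _ _ _ L _ _ _))//.
  - exact: L1B.
  - exact: measurable_pd.
  - by move=> x; exact: pd_le.
  - by rewrite ler_wpM2l.
move: (H _ fL) (H _ (fL_ k)) Hk.
move: (\int[lam]_x (G x * pd j f x)) (\int[lam]_x (psi x * pd j f x)).
move: (\int[lam]_x (G x * pd j (f_ k) x)) (\int[lam]_x (psi x * pd j (f_ k) x)).
move=> a b c a'; rewrite !ler_norml.
by move=> /andP[? ?] /andP[? ?] /andP[? ?]; apply/andP; split; lra.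
Qed.

End partial_derivatives.

Section jacobian.
Context {R : realType} {n : nat}.
Implicit Types (f g w phi psi : 'rV[R]_n -> R) (x y v : 'rV[R]_n) (i j c k : 'I_n).
Implicit Types G : 'I_n -> 'rV[R]_n -> R.
Notation lam := (@lebesgue_rV R n).

Definition jac G x : R := \det (\matrix_(i < n, j < n) pd j (G i) x).

Definition upd G k f : 'I_n -> 'rV[R]_n -> R := fun i => if i == k then f else G i.

Lemma upd_eq G k f : upd G k f k = f. Proof. by rewrite /upd eqxx. Qed.

Lemma upd_neq G k f i : i != k -> upd G k f i = G i.
Proof. by rewrite /upd => /negbTE ->. Qed.

Lemma upd_id G k : upd G k (G k) = G.
Proof. by apply/funext => i; rewrite /upd; case: eqP => [->|]. Qed.

Lemma updC G k i f g : i != k -> upd (upd G k f) i g = upd (upd G i g) k f.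
Proof.
move=> ik; apply/funext => l; rewrite /upd; case: (eqVneq l i) => // ->.
by rewrite (negbTE ik).
Qed.

Lemma measurable_jac G : (forall i, lipf (G i)) -> measurable_fun setT (jac G).
Proof.
move=> lG; rewrite /jac /determinant.
apply: measurable_sum => s; apply: measurable_funM => //.
apply: measurable_prod => i _; under eq_fun do rewrite mxE.
exact: measurable_pd.
Qed.

Lemma det_le (m : nat) (A : 'M[R]_m) (a : 'I_m -> R) :
  (forall (i j : 'I_m), `|A i j| <= a i) -> `|\det A| <= m`!%:R * \prod_i a i.
Proof.
move=> Aa; rewrite /determinant (le_trans (ler_norm_sum _ _ _))//.
apply: (le_trans (ler_sum _ (G := fun=> \prod_i a i) _)).
  move=> s _; rewrite normrM normrX normrN1 expr1n mul1r normr_prod.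
  by apply: ler_prod => i _; rewrite normr_ge0 Aa.
by rewrite sumr_const perm.card_Sn mulr_natl.
Qed.

Lemma jac_le G x (a : 'I_n -> R) : (forall i j, `|pd j (G i) x| <= a i) ->
  `|jac G x| <= n`!%:R * \prod_i a i.
Proof. by move=> Ga; apply: det_le => i j; rewrite mxE. Qed.

Lemma jac_lin G k f g h x (a b : R) :
  (forall j, pd j f x = a * pd j g x + b * pd j h x) ->
  jac (upd G k f) x = a * jac (upd G k g) x + b * jac (upd G k h) x.
Proof.
move=> fgh; rewrite /jac; apply: (determinant_multilinear (i0 := k)).
- by apply/rowP => j; rewrite !mxE !upd_eq.
- by apply/matrixP => i j; rewrite !mxE !upd_neq// eq_sym neq_lift.
- by apply/matrixP => i j; rewrite !mxE !upd_neq// eq_sym neq_lift.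
Qed.

Lemma jac_scale G k f g x (a : R) : (forall j, pd j f x = a * pd j g x) ->
  jac (upd G k f) x = a * jac (upd G k g) x.
Proof.
move=> fg; rewrite (@jac_lin G k f g g x a 0) ?mul0r ?addr0// => j.
by rewrite mul0r addr0.
Qed.

Lemma jac_row0 G k x : (forall j, pd j (G k) x = 0) -> jac G x = 0.
Proof.
move=> Gk; rewrite -(upd_id G k) (@jac_scale G k (G k) (G k) x 0) ?mul0r// => j.
by rewrite mul0r.
Qed.

Lemma jac_alternate G i k : i != k -> forall x, G i = G k -> jac G x = 0.
Proof.
move=> ik x Gik; apply: (determinant_alternate ik) => j.
by rewrite !mxE Gik.
Qed.

Lemma jac_product G k phi psi x : good phi x -> good psi x ->
  jac (upd G k (fun y => phi y * psi y)) x =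
  phi x * jac (upd G k psi) x + psi x * jac (upd G k phi) x.
Proof. by move=> gp gq; apply: jac_lin => j; rewrite pdM. Qed.

Lemma jac_supp0 G k x (M : R) : (forall y, M < `|y| -> G k y = 0) -> M < `|x| ->
  jac G x = 0.
Proof. by move=> GM xM; apply: (@jac_row0 _ k) => j; exact: pd_supp0 GM _ xM. Qed.

Lemma lipf_upd G k f : (forall i, lipf (G i)) -> lipf f -> forall i, lipf (upd G k f i).
Proof. by move=> lG lf i; rewrite /upd; case: eqP. Qed.

Lemma jac_bounded G : (forall i, lipf (G i)) -> exists b, forall x, `|jac G x| <= b.
Proof.
move=> lG; have /choice[L LG] : forall i, exists L : R, 0 <= L /\ is_lip L (G i).
  by move=> i; have [L L0 GL] := lG i; exists L.
exists (n`!%:R * \prod_i L i) => x; apply: jac_le => i j.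
by have [L0 GL] := LG i; exact: pd_le.
Qed.

Lemma L1_jac G k : (forall i, lipf (G i)) -> csupp (G k) -> L1 (jac G).
Proof.
move=> lG [M GM]; have [b Gb] := jac_bounded lG.
apply: (L1_bounded_cube _ Gb (M := M)); first exact: measurable_jac.
by move=> x; exact: jac_supp0 GM.
Qed.

End jacobian.

Lemma cvg_sum_seq (R : realType) (I : Type) (s : seq I) (u : I -> nat -> R) (l : I -> R) :
  (forall i, u i k @[k --> \oo] --> l i) ->
  \sum_(i <- s) u i k @[k --> \oo] --> \sum_(i <- s) l i.
Proof.
move=> ul; elim: s => [|i s IH].
  by under eq_cvg do rewrite big_nil; rewrite big_nil; exact: cvg_cst.
by under eq_cvg do rewrite big_cons; rewrite big_cons; exact: cvgD.
Qed.

(** * Jacobians of Lipschitz maps are null Lagrangians *)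

Section null_lagrangian.
Context {R : realType} {m : nat}.
Notation n := m.+1.
Implicit Types (f g w phi psi gam : 'rV[R]_n -> R) (x y v : 'rV[R]_n) (i j c k : 'I_n).
Implicit Types G : 'I_n -> 'rV[R]_n -> R.
Notation lam := (@lebesgue_rV R n).

Lemma Rintegral_sum (I : Type) (s : seq I) (F : I -> 'rV[R]_n -> R) :
  (forall i : I, L1 (F i)) ->
  \int[lam]_x (\sum_(i <- s) F i x) = \sum_(i <- s) \int[lam]_x F i x.
Proof.
move=> IF; elim: s => [|i s IH].
  under eq_Rintegral do rewrite big_nil.
  by rewrite Rintegral_cst// mul0r big_nil.
under eq_Rintegral do rewrite big_cons.
by rewrite RintegralD//; [rewrite IH big_cons|exact: IF|exact: L1_sum].
Qed.

(** Induction hypothesis on the number of free rows: rows from [k] on, other than row 0, are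
    coordinate functions. For [k = n] no restriction remains. *)
Let null_upto (k : nat) := forall G, (forall i, lipf (G i)) -> csupp (G ord0) ->
  (forall i, (k <= i)%N -> i != ord0 -> exists c, G i = fun x => x ord0 c) ->
  \int[lam]_x jac G x = 0.

(** Coordinates have constant gradients, so in the expansion along row 0 the cofactors are constants
    and each partial derivative of [G ord0] has integral 0. *)
Let null_upto1 : null_upto 1.
Proof.
move=> G lG cG Gc.
have /choice[c cP] : forall i, exists c, i != ord0 -> G i = fun x => x ord0 c.
  move=> i; have [i0|i0] := eqVneq i ord0; first by exists ord0 => /eqP.
  have [|c Gic] := Gc i _ i0; first by rewrite lt0n.
  by exists c.
pose A : 'M[R]_n := \matrix_(i, j) (c i == j)%:R.
have jacE x : jac G x = \sum_j pd j (G ord0) x * cofactor A ord0 j.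
  rewrite /jac (expand_det_row _ ord0); apply: eq_bigr => j _; rewrite mxE.
  congr (_ * _); rewrite /cofactor; congr (_ * \det _).
  apply/matrixP => i l; rewrite !mxE cP; last by rewrite eq_sym neq_lift.
  exact: pd_coord.
under eq_Rintegral do rewrite jacE.
have I1 j : L1 (fun x => pd j (G ord0) x * cofactor A ord0 j).
  under eq_fun do rewrite mulrC; exact/L1Z/L1_pd.
rewrite Rintegral_sum// big1// => j _.
by rewrite RintegralZr//; [rewrite integral_pd_eq0// mul0r|exact: L1_pd].
Qed.

Section step.
Variables (G : 'I_n -> 'rV[R]_n -> R) (k : 'I_n).
Hypotheses (lG : forall i, lipf (G i)) (k0 : k != ord0).

(* The functions that may be put in row [k] without destroying the null
   Lagrangian property, whatever compactly supported function is in row 0. *)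
Let Z gam := lipf gam /\ forall phi, lipf phi -> csupp phi ->
  \int[lam]_x jac (upd (upd G k gam) ord0 phi) x = 0.

Let lipf_upd2 gam phi : lipf gam -> lipf phi ->
  forall i, lipf (upd (upd G k gam) ord0 phi i).
Proof. by move=> lg lp; apply: lipf_upd => //; exact: lipf_upd. Qed.

Let L1_jac2 gam phi : lipf gam -> lipf phi -> csupp phi ->
  L1 (jac (upd (upd G k gam) ord0 phi)).
Proof.
move=> lg lp cp; apply: (@L1_jac _ _ _ ord0); first exact: lipf_upd2.
by rewrite upd_eq.
Qed.

Let updk gam phi : upd (upd G k gam) ord0 phi = upd (upd G ord0 phi) k gam.
Proof. by rewrite updC// eq_sym. Qed.

Let Z_lin (a b : R) f g : Z f -> Z g -> Z (fun x => a * f x + b * g x).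
Proof.
move=> [lf Zf] [lg Zg]; have l := lipfD (lipfZ a lf) (lipfZ b lg).
split; [exact: l|move=> phi lp cp].
have E : {ae lam, forall x, jac (upd (upd G k (fun x => a * f x + b * g x)) ord0 phi) x =
    a * jac (upd (upd G k f) ord0 phi) x + b * jac (upd (upd G k g) ord0 phi) x}.
  apply: ae_imp (aeI (aeI (good_ae lf) (good_ae lg))
    (aeI (good_ae (lipfZ a lf)) (good_ae (lipfZ b lg)))) => x [[fx gx] [afx bgx]].
  by rewrite !updk; apply: jac_lin => j; rewrite pdD// !pdZ.
rewrite (eq_integral_ae _ _ E); last 2 first.
- by apply: L1_measurable; exact: L1_jac2.
- by apply: L1_measurable; apply: L1D; apply: L1Z; exact: L1_jac2.
rewrite RintegralD//; try by apply: L1Z; exact: L1_jac2.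
by rewrite !RintegralZl//; [rewrite Zf// Zg// !mulr0 addr0|exact: L1_jac2|exact: L1_jac2].
Qed.

Let Z_cst (a : R) : Z (fun=> a).
Proof.
split; first exact: lipf_cst.
move=> phi lp cp.
under eq_Rintegral => x _.
  rewrite (@jac_row0 _ _ _ k); last by move=> j; rewrite updk upd_eq pd_cst.
  over.
by rewrite Rintegral_cst// mul0r.
Qed.

Let Z_sub f g : Z f -> Z g -> Z (fun x => f x - g x).
Proof.
move=> Zf Zg; have := Z_lin 1 (-1) Zf Zg.
by under eq_fun do rewrite mul1r mulN1r.
Qed.

(* With [b_t = (gam^+ - (gam - t)^+) / t] the product rule gives
   [int b_t(gam) jac(phi, gam) = int jac(b_t(gam) phi, gam) = 0], and
   [b_t(gam)] tends to the indicator of [gam > 0]. *)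
Let Z_pos gam : Z gam -> Z (fun x => Num.max 0 (gam x)).
Proof.
move=> [lg Zg]; split; first exact: lipf_max0.
move=> phi lp cp.
pose J := jac (upd (upd G k gam) ord0 phi).
have IJ : L1 J by exact: L1_jac2.
pose pos x : R := (0 < gam x)%R%:R.
have mpos : measurable_fun setT pos.
  rewrite (_ : pos = \1_[set x | 0 < gam x]).
    apply: measurable_indic; rewrite -[X in measurable X]setTI.
    by apply: measurable_fun_ltr => //; exact: lipf_measurable.
  apply/funext => x; rewrite /pos indicE; congr (nat_of_bool _)%:R.
  by apply/idP/idP; rewrite inE.
have lgt t : lipf (fun x => gam x - t) by apply: lipfB => //; exact: lipf_cst.
transitivity (\int[lam]_x (J x * pos x)).
  apply: eq_integral_ae.
  - apply: L1_measurable; apply: L1_jac2 => //; exact: lipf_max0.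
  - by apply: measurable_funM => //; exact: L1_measurable.
  apply: ae_imp (aeI (good_ae lg) (good_ae (lipf_max0 lg))) => x [gx px].
  rewrite mulrC /J !updk; apply: jac_scale => j; exact: pd_max0.
pose b (t : R) x := t^-1 * (Num.max 0 (gam x) - Num.max 0 (gam x - t)).
have lb t : lipf (b t).
  by apply: lipfZ; apply: lipfB; [exact: lipf_max0|exact: (lipf_max0 (lgt t))].
have b01 t x : 0 < t -> 0 <= b t x <= 1.
  move=> t0; rewrite /b mulr_ge0 ?invr_ge0 ?(ltW t0)//= ?ler_pdivrMl ?mulr1//.
    rewrite /Num.max; case: ltP => ?; case: ltP => ?; lra.
  rewrite /Num.max; case: ltP => ?; case: ltP => ?; lra.
have int0 t : 0 < t -> \int[lam]_x (J x * b t x) = 0.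
  move=> t0.
  have lbp : lipf (fun x => phi x * b t x) by exact: lipfM.
  have cbp : csupp (fun x => phi x * b t x) by exact: csuppM.
  rewrite -(Zg _ lbp cbp); apply: eq_integral_ae.
  - by apply: measurable_funM; [exact: L1_measurable|exact: lipf_measurable].
  - by apply: L1_measurable; exact: L1_jac2.
  apply: ae_imp (aeI (aeI (good_ae lp) (good_ae (lb t)))
    (aeI (aeI (good_ae lg) (good_ae (lgt t)))
         (aeI (good_ae (lipf_max0 lg)) (good_ae (lipf_max0 (lgt t))))))
    => x [[px bx] [[gx gtx] [gpx gtpx]]].
  rewrite jac_product// mulrC addrC -[LHS]addr0; congr (_ + _).
  (* The gradient of [b t] is [theta] times that of [gam], which already occupies row [k]: the
     second term of the product rule is the determinant of a matrix with two proportional rows. *)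
  pose theta := t^-1 * ((0 < gam x)%R%:R - (0 < gam x - t)%R%:R).
  rewrite (@jac_scale _ _ _ ord0 (b t) gam x theta); last first.
    move=> j; rewrite /b pdZ; last first.
      by move=> i; apply: derivableB; [exact: gpx|exact: gtpx].
    rewrite (pdB j gpx gtpx) (pd_max0 j lg gpx) (pd_max0 j (lgt t) gtpx).
    have gc : good (fun=> t) x by move=> i; exact: derivable_cst.
    rewrite (pdB j gx gc).
    by rewrite pd_cst subr0 -mulrBl mulrA.
  rewrite (@jac_alternate _ _ _ k ord0)// ?mulr0//.
  by rewrite upd_eq updk upd_eq.
have : \int[lam]_x (J x * b k.+1%:R^-1 x) @[k --> \oo] --> \int[lam]_x (J x * pos x).
  apply: (@L1_dominatedM _ _ _ _ _ 1) => //.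
  - by move=> l; exact: lipf_measurable.
  - apply: aeW => x; rewrite /pos; have [gx|gx] := ltP 0 (gam x).
      apply: cvg_near_cst; exists (Num.truncn (gam x)^-1) => // l /= xl.
      have lx : l.+1%:R^-1 <= gam x.
        rewrite -[leRHS]invrK lef_pV2 ?posrE ?invr_gt0//.
        by rewrite (le_trans (ltW (truncnS_gt _)))// ler_nat.
      rewrite /b !max_r ?subr_ge0 ?(ltW gx)// opprB addrC subrK mulVf//.
    apply: cvg_near_cst; apply: nearW => l; rewrite /b !max_l ?subrr ?mulr0//.
    by rewrite subr_le0 (le_trans gx).
  - move=> l x; have l0 : 0 < l.+1%:R^-1 :> R by [].
    by have /andP[? ?] := b01 _ x l0; rewrite ger0_norm.
under eq_cvg do rewrite int0//.
by move=> H; apply: (cvg_unique _ H); [exact: Rhausdorff|exact: cvg_cst].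
Qed.

Let Z_abs f : Z f -> Z (fun x => `|f x|).
Proof.
move=> Zf; have := Z_lin 2 (-1) (Z_pos Zf) Zf; congr Z; apply/funext => x /=.
rewrite /Num.max; case: ltgtP => fx; first by rewrite gtr0_norm//; lra.
  by rewrite ltr0_norm//; lra.
by rewrite -fx normr0; lra.
Qed.

Let Z_min f g : Z f -> Z g -> Z (fun x => Num.min (f x) (g x)).
Proof.
move=> Zf Zg; have := Z_sub Zf (Z_pos (Z_sub Zf Zg)); congr Z; apply/funext => x /=.
rewrite minEle /Num.max; case: ltP => h1; case: ifP => h2; lra.
Qed.

(** Expanding along row [k] writes the integral as a sum of pairings of the partial derivatives of
    the function in that row with integrable cofactors free of it; [pd_weak_cvg] passes to the limit
    in each. *)
Let Z_lim (f_ : nat -> 'rV[R]_n -> R) f (L : R) : (forall l, Z (f_ l)) -> 0 <= L ->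
  (forall l, is_lip L (f_ l)) -> is_lip L f -> (forall x, f_ l x @[l --> \oo] --> f x) ->
  Z f.
Proof.
move=> Zf_ L0 fL_ fL f_f; have lf : lipf f by exists L.
split; [exact: lf|move=> phi lp cp]; have [M pM] := cp.
pose A x : 'M[R]_n := \matrix_(i, j) pd j (upd G ord0 phi i) x.
(* The indicator makes the bounded cofactor integrable. It changes nothing, since the Jacobian
   vanishes where [phi] does so locally. *)
pose C j x := \1_(cube M) x * cofactor (A x) k j.
have lA i : lipf (upd G ord0 phi i) by exact: lipf_upd.
have mC j : measurable_fun setT (fun x => cofactor (A x) k j).
  rewrite /cofactor; apply: measurable_funM => //; rewrite /determinant.
  apply: measurable_sum => s; apply: measurable_funM => //.
  apply: measurable_prod => i _; under eq_fun do rewrite !mxE.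
  exact: measurable_pd.
have IC j : L1 (C j).
  have /choice[K KG] : forall i, exists K : R, 0 <= K /\ is_lip K (upd G ord0 phi i).
    by move=> i; have [K K0 GK] := lA i; exists K.
  apply: (@L1M _ _ _ _ (m`!%:R * \prod_(i < m) K (lift k i))) => //.
    exact: L1_indic_cube.
  move=> x; rewrite /cofactor normrM normrX normrN1 expr1n mul1r.
  by apply: det_le => i l; rewrite !mxE; have [? ?] := KG (lift k i); exact: pd_le.
have jacE g : lipf g -> \int[lam]_x jac (upd (upd G k g) ord0 phi) x =
    \sum_j \int[lam]_x (C j x * pd j g x).
  move=> lg; have [K K0 gK] := lg.
  rewrite -(Rintegral_sum (index_enum 'I_n) (F := fun j x => C j x * pd j g x)); last first.
    move=> j; apply: (@L1M _ _ _ _ K) => //; first exact: measurable_pd.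
    by move=> x; exact: pd_le.
  apply: eq_Rintegral => x _.
  have [xM|xM] := leP `|x| M; last first.
    have uM y : M < `|y| -> upd (upd G k g) ord0 phi ord0 y = 0.
      by rewrite upd_eq; exact: pM.
    rewrite (jac_supp0 uM xM).
    rewrite big1// => j _; rewrite /C indicE memNset ?mul0r//.
    by rewrite /cube/= => /(lt_le_trans xM); rewrite ltxx.
  rewrite updk /jac (expand_det_row _ k); apply: eq_bigr => j _.
  rewrite /C indicE (mem_set (xM : cube M x)) mul1r mxE upd_eq mulrC; congr (_ * _).
  rewrite /cofactor; congr (_ * \det _); apply/matrixP => i l.
  by rewrite !mxE upd_neq// eq_sym neq_lift.
have : \sum_j \int[lam]_x (C j x * pd j (f_ l) x) @[l --> \oo] -->
    \sum_j \int[lam]_x (C j x * pd j f x).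
  apply: cvg_sum_seq => j; exact: (pd_weak_cvg (IC j) L0 fL_ fL f_f).
have int0 l : \sum_j \int[lam]_x (C j x * pd j (f_ l) x) = 0.
  have [lfl Zfl] := Zf_ l.
  by rewrite -(jacE _ lfl); exact: Zfl.
under eq_cvg do rewrite int0.
move=> H; rewrite (jacE _ lf).
by apply: (cvg_unique _ H); [exact: Rhausdorff|exact: cvg_cst].
Qed.

Hypothesis Z_coord : forall c, Z (fun x => x ord0 c).

Let Z_sum (I : Type) (s : seq I) (F : I -> 'rV[R]_n -> R) : (forall i : I, Z (F i)) ->
  Z (fun x => \sum_(i <- s) F i x).
Proof.
move=> ZF; elim: s => [|i s IH].
  by under eq_fun do rewrite big_nil; exact: Z_cst.
under eq_fun do rewrite big_cons.
have := Z_lin 1 1 (ZF i) IH; congr Z; apply/funext => x; by rewrite !mul1r.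
Qed.

(* A Lipschitz function is the decreasing limit of minima of finitely many
   cones with vertices at rational points. *)
Let Z_lipf f : lipf f -> Z f.
Proof.
move=> lf; have [L L0 fL] := lf.
(* An enumeration of the rational points; codes of no point are sent to 0, which is harmless. *)
pose z (l : nat) : 'rV[R]_n :=
  if unpickle l is Some q then \row_i ratr ((q : 'rV[rat]_n) ord0 i) else 0.
(* Cones are taken for the l^1 norm, because it is a sum of absolute values of coordinates and so is
   reached by [Z_abs] and [Z_sum]. *)
pose N1 x := \sum_i `|x ord0 i|.
have N1_le x : `|x| <= N1 x.
  apply: norm_rV_le; first exact: sumr_ge0.
  by move=> i; rewrite /N1 (bigD1 i)//= lerDl sumr_ge0.
have N1_ge x : N1 x <= n%:R * `|x|.
  rewrite /N1 (le_trans (ler_sum _ (G := fun=> `|x|) _))//.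
    by move=> i _; exact: coord_le_norm.
  by rewrite sumr_const card_ord mulr_natl.
pose cone l x := f (z l) + L * N1 (x - z l).
have Zcone l : Z (cone l).
  have : Z (fun x => \sum_i `|x ord0 i - z l ord0 i|).
    by apply: Z_sum => i; apply: Z_abs; apply: Z_sub => //; exact: Z_cst.
  move=> /(Z_lin 1 L (Z_cst (f (z l)))); congr Z; apply/funext => x.
  rewrite mul1r /cone /N1; congr (_ + _ * _); apply: eq_bigr => i _.
  by rewrite !mxE.
have cone_lip l : is_lip (L * n%:R) (cone l).
  move=> x y; rewrite /cone opprD addrACA subrr add0r -mulrBr normrM ger0_norm//.
  rewrite -mulrA ler_wpM2l// /N1 -sumrB (le_trans (ler_norm_sum _ _ _))//.
  apply: le_trans (N1_ge _); apply: ler_sum => i _.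
  by rewrite (le_trans (ler_dist_dist _ _))// !mxE opprD opprK addrACA [_ + z l _ _]addrC subrr addr0.
have cone_ge l x : f x <= cone l x.
  rewrite /cone -lerBlDl (le_trans (ler_norm _))// (le_trans (fL _ _))//.
  by rewrite ler_wpM2l.
pose F := fix F l : 'rV[R]_n -> R := if l is l'.+1
  then fun x => Num.min (F l' x) (cone l x) else cone 0.
have FZ l : Z (F l).
  elim: l => [|l IH]; first exact: (Zcone 0%N).
  exact: (Z_min IH (Zcone l.+1)).
have F_lip l : is_lip (L * n%:R) (F l).
  elim: l => [|l IH] //= x y; have := IH x y; have := cone_lip l.+1 x y.
  rewrite !ler_norml !minEle; move: (L * n%:R * _) => d.
  by move=> /andP[? ?] /andP[? ?]; case: ifP => ?; case: ifP => ?; apply/andP; split; lra.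
have F_ge l x : f x <= F l x.
  by elim: l => [|l IH] //=; rewrite le_min IH cone_ge.
have F_le l l' x : (l <= l')%N -> F l' x <= cone l x.
  elim: l' => [|l' IH]; first by rewrite leqn0 => /eqP ->.
  rewrite leq_eqVlt => /predU1P[->|]; first by rewrite /= ge_min lexx orbT.
  by rewrite ltnS => /IH H; rewrite /= ge_min H.
have L1_gt0 : 0 < L + L * n%:R + 1 by rewrite ltr_wpDl// addr_ge0// mulr_ge0.
apply: (@Z_lim F f (L * n%:R) FZ _ F_lip); first exact: mulr_ge0.
  by apply: is_lip_le fL; rewrite ler_peMr// ler1n.
move=> x; apply/cvgrPdist_le => e e0.
(* The cone with vertex [z] exceeds [f x] by at most [L |x - z|] for the value at the vertex plus
   [L n |x - z|] for the slope; the 1 avoids dividing by 0. *)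
have d0 : 0 < e / (L + L * n%:R + 1) by rewrite divr_gt0.
have /choice[q qP] i : exists q : rat, ratr q \in `](x ord0 i), (x ord0 i + e / (L + L * n%:R + 1))[.
  by apply: rat_in_itvoo; rewrite ltrDl.
pose l := pickle (\row_i q i).
have xz : `|x - z l| <= e / (L + L * n%:R + 1).
  apply: norm_rV_le => [|i]; first exact: ltW.
  rewrite /z /l pickleK !mxE; have := qP i; rewrite in_itv/= ler_norml.
  by move=> /andP[? ?]; apply/andP; split; lra.
exists l => // l' /= ll'; rewrite distrC ger0_norm ?subr_ge0//.
rewrite lerBlDr (le_trans (F_le _ _ x ll'))// /cone.
have := fL x (z l); rewrite ler_norml => /andP[fzx _].
have H1 : L * N1 (x - z l) <= L * (n%:R * `|x - z l|) by rewrite ler_wpM2l.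
have H2 : (L + L * n%:R + 1) * `|x - z l| <= e.
  by rewrite mulrC -ler_pdivlMr.
have := normr_ge0 (x - z l).
move: H1 H2 fzx; rewrite mulrA !mulrDl mul1r.
move: (L * N1 _) (L * n%:R * _) (L * `|_|) => a b d; lra.
Qed.

Lemma null_step : forall gam phi, lipf gam -> lipf phi -> csupp phi ->
  \int[lam]_x jac (upd (upd G k gam) ord0 phi) x = 0.
Proof. by move=> gam phi /Z_lipf[_]; apply. Qed.

End step.

Theorem integral_jac_eq0 G : (forall i, lipf (G i)) -> csupp (G ord0) ->
  \int[lam]_x jac G x = 0.
Proof.
suff H (l : nat) : null_upto l.+1.
  move=> lG cG; have Hm := H m; rewrite /null_upto in Hm.
  by apply: Hm; [exact: lG|exact: cG|move=> i; rewrite ltnNge -ltnS ltn_ord].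
elim: l => [|l IH]; first exact: null_upto1.
rewrite /null_upto in IH *; move=> {}G lG cG Gc.
have [ml|lm] := leqP n l.+1.
  apply: IH; [exact: lG|exact: cG|move=> i].
  by rewrite leqNgt (leq_trans (ltn_ord i) ml).
pose K := Ordinal lm.
have K0 : K != ord0 by [].
(* [K] is the row that becomes free. With a coordinate function in row [K] the induction hypothesis
   applies, and [null_step] passes from coordinates to [G K]. *)
have := @null_step G K lG K0 _ (G K) (G ord0) (lG K) (lG _) cG.
rewrite upd_id upd_id; apply => c; split; first exact: lipf_coord.
move=> phi lp cp; apply: IH.
- by apply: lipf_upd => //; apply: lipf_upd => //; exact: lipf_coord.
- by rewrite upd_eq.
move=> i ki i0; rewrite upd_neq//; have [->|iK] := eqVneq i K.
  by rewrite upd_eq; exists c.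
rewrite upd_neq//; apply: Gc => //; rewrite ltn_neqAle ki andbT.
by apply: contra iK => /eqP ki'; apply/eqP/val_inj; rewrite /= ki'.
Qed.

End null_lagrangian.

Section coordinate_jacobian.
Context {R : realType} {m : nat}.
Notation n := m.+1.
Notation lam := (@lebesgue_rV R n).
Implicit Types (x y h : 'rV[R]_n) (f psi : 'rV[R]_n -> R) (j : 'I_n).

(** Rows other than 0 are the coordinates different from [j], in order; row 0 is a placeholder for
    the function put there by [upd]. *)
Definition other_coords j (i : 'I_n) : 'rV[R]_n -> R :=
  fun y => y ord0 (if unlift ord0 i is Some i' then lift j i' else j).

(** Column [j] vanishes outside row 0, and the corresponding minor is the identity matrix. *)
Lemma jac_other_coords j f x : jac (upd (other_coords j) ord0 f) x = (-1) ^+ j * pd j f x.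
Proof.
rewrite /jac (expand_det_col _ j) (bigD1 ord0)//= big1 ?addr0; last first.
  move=> i; case: (unliftP ord0 i) => [i'|] -> // _.
  rewrite !mxE upd_neq; last by rewrite eq_sym neq_lift.
  by rewrite /other_coords liftK pd_coord eq_sym (negbTE (neq_lift _ _)) mul0r.
rewrite !mxE upd_eq /cofactor add0n mulrC; congr (_ * _).
rewrite (_ : row' _ _ = 1%:M) ?det1 ?mulr1//.
apply/matrixP => a b; rewrite !mxE upd_neq; last by rewrite eq_sym neq_lift.
by rewrite /other_coords liftK pd_coord (inj_eq lift_inj).
Qed.

End coordinate_jacobian.

Section powR_lemmas.
Context {R : realType}.
Implicit Types a b d r x y rho : R.

Lemma powR_mono r x y : 0 <= r -> 0 <= x -> x <= y -> x `^ r <= y `^ r.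
Proof.
by move=> r0 x0 xy; apply: ge0_ler_powR => //; rewrite nnegrE// (le_trans x0).
Qed.

Lemma powR_anti r x y : r <= 0 -> 0 < x -> x <= y -> y `^ r <= x `^ r.
Proof.
move=> r0 x0 xy; have y0 := lt_le_trans x0 xy.
have s0 : 0 <= - r by rewrite oppr_ge0.
rewrite -[r]opprK; move: (- r) s0 => s s0.
rewrite (powRN y) (powRN x) lef_pV2 ?posrE ?powR_gt0//.
by apply: powR_mono => //; exact: ltW.
Qed.

Lemma powRB1 r x : 0 < x -> x `^ (r - 1) = x `^ r / x.
Proof.
move=> x0; rewrite powRD; last by rewrite (gt_eqF x0) implybT.
by rewrite powR_inv1// ltW.
Qed.

Lemma powR_add r s x : 0 < x -> x `^ (r + s) = x `^ r * x `^ s.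
Proof. by move=> x0; rewrite powRD// (gt_eqF x0) implybT. Qed.

(** One of the two terms suffices, according to which of [d] and [rho] is larger. This is why the
    inf-convolution of slope [L rho^(beta-1)] stays within [L rho^beta] of a Hoelder function. *)
Lemma powR_split r d rho : 0 < r <= 1 -> 0 <= d -> 0 < rho ->
  d `^ r <= rho `^ r + rho `^ (r - 1) * d.
Proof.
move=> /andP[r0 r1] d0 rho0; have [dr|rd] := leP d rho.
  rewrite (le_trans (powR_mono (ltW r0) d0 dr))// lerDl mulr_ge0//.
  exact: powR_ge0.
have dd := lt_trans rho0 rd.
rewrite -[leLHS]add0r lerD ?powR_ge0//.
have -> : d `^ r = d `^ (r - 1) * d by rewrite powRB1// mulfVK// gt_eqF.
rewrite ler_wpM2r//.
by apply: powR_anti => //; [rewrite subr_le0|exact: ltW].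
Qed.

End powR_lemmas.

Section jac_integrals.
Context {R : realType} {m : nat}.
Notation n := m.+1.
Implicit Types (f g w phi psi F : 'rV[R]_n -> R) (x y v : 'rV[R]_n).
Implicit Types G : 'I_n -> 'rV[R]_n -> R.
Notation lam := (@lebesgue_rV R n).

Lemma L1_mul_jac G w : L1 w -> (forall i, lipf (G i)) -> L1 (fun x => w x * jac G x).
Proof.
move=> Iw lG; have [b Gb] := jac_bounded lG.
by apply: (@L1M _ _ _ _ b) => //; exact: measurable_jac.
Qed.

(** The product rule splits the Jacobian with [w F] in row 0, whose integral is 0 by
    [integral_jac_eq0]. *)
Lemma jac_integral_by_parts G w F : (forall i, lipf (G i)) -> lipf w -> csupp w ->
  lipf F ->
  \int[lam]_x (w x * jac (upd G ord0 F) x) = - \int[lam]_x (F x * jac (upd G ord0 w) x).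
Proof.
move=> lG lw cw lF.
have lGF := lipf_upd ord0 lG lF; have lGw := lipf_upd ord0 lG lw.
have lwF := lipfM lw cw lF; have cwF := csuppM F cw.
have lGwF := lipf_upd ord0 lG lwF.
have I1 := L1_mul_jac (lipf_csupp_L1 lw cw) lGF.
have I3 : L1 (jac (upd G ord0 (fun x => w x * F x))).
  by apply: (@L1_jac _ _ _ ord0) => //; rewrite upd_eq.
have ae3 : {ae lam, forall x, F x * jac (upd G ord0 w) x =
    jac (upd G ord0 (fun x => w x * F x)) x - w x * jac (upd G ord0 F) x}.
  apply: ae_imp (aeI (good_ae lw) (good_ae lF)) => x [wx Fx].
  by rewrite jac_product// addrAC subrr add0r.
rewrite (eq_integral_ae _ _ ae3); last 2 first.
- by apply: measurable_funM; [exact: lipf_measurable|exact: measurable_jac].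
- by apply: L1_measurable; exact: L1B.
by rewrite RintegralB// (@integral_jac_eq0 _ _ (upd G ord0 _)) ?sub0r ?opprK.
Qed.

Section bounds.
Variables (G : 'I_n -> 'rV[R]_n -> R) (l : 'I_m -> R).
Hypotheses (lG : forall i, lipf (G i)) (l0 : forall i, 0 <= l i)
  (Gl : forall i, is_lip (l i) (G (lift ord0 i))).

Let Lam := \prod_i l i.

Let Lam0 : 0 <= Lam. Proof. exact: prodr_ge0. Qed.

Definition pairing w F : R := \int[lam]_x (w x * jac (upd G ord0 F) x).

Lemma jac_le0 F x (a : R) : (forall j, `|pd j F x| <= a) ->
  `|jac (upd G ord0 F) x| <= n`!%:R * a * Lam.
Proof.
move=> Fa; rewrite -mulrA /Lam.
rewrite (_ : a * _ = \prod_i (if unlift ord0 i is Some i' then l i' else a)); last first.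
  rewrite big_ord_recl unlift_none; congr (_ * _); apply: eq_bigr => i _.
  by rewrite liftK.
apply: jac_le => i j; case: unliftP => [i' ->|->]; last by rewrite upd_eq.
have ne : lift ord0 i' != ord0 :> 'I_n by [].
by rewrite (upd_neq G F ne); exact: (pd_le j x (l0 i') (Gl i')).
Qed.

Lemma pairing_le_lip w F (M : R) : L1 w -> 0 <= M -> is_lip M F ->
  `|pairing w F| <= n`!%:R * M * Lam * \int[lam]_x `|w x|.
Proof.
move=> Iw M0 FM; have lF : lipf F by exists M.
apply: L1_norm_mul_le => //; first by apply: measurable_jac; exact: lipf_upd.
by move=> x; apply: jac_le0 => j; exact: pd_le.
Qed.

(** After exchanging [w] and [F], only the supremum of [F] counts; the derivative falls on [w]. This
    is the counterpart of [pairing_le_lip]. *)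
Lemma pairing_le_sup w F D (b : R) : lipf w -> csupp w -> lipf F ->
  (forall x, `|F x| <= b) -> L1 D -> (forall x j, `|pd j w x| <= D x) ->
  `|pairing w F| <= n`!%:R * b * Lam * \int[lam]_x D x.
Proof.
move=> lw cw lF Fb ID wD.
have b0 : 0 <= b by rewrite (le_trans _ (Fb 0)).
have lGw := lipf_upd ord0 lG lw.
rewrite /pairing jac_integral_by_parts// normrN -RintegralZl//.
apply: le_norm_integral; last exact: L1Z.
- by apply: measurable_funM; [exact: lipf_measurable|exact: measurable_jac].
move=> x; rewrite normrM.
rewrite (_ : n`!%:R * b * Lam * D x = b * (n`!%:R * D x * Lam)); last by ring.
by rewrite ler_pM//; apply: jac_le0 => j; exact: wD.
Qed.

Lemma pairingBl w w' F : L1 w -> L1 w' -> lipf F ->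
  pairing (fun x => w x - w' x) F = pairing w F - pairing w' F.
Proof.
move=> Iw Iw' lF; have lGF := lipf_upd ord0 lG lF.
rewrite /pairing -RintegralB//; try exact: L1_mul_jac.
by apply: eq_Rintegral => x _; rewrite mulrBl.
Qed.

Lemma pairingBr w F F' : L1 w -> lipf F -> lipf F' ->
  pairing w (fun x => F x - F' x) = pairing w F - pairing w F'.
Proof.
move=> Iw lF lF'; have lGF := lipf_upd ord0 lG lF; have lGF' := lipf_upd ord0 lG lF'.
have lFF := lipfB lF lF'; have lGFF := lipf_upd ord0 lG lFF.
rewrite /pairing -RintegralB//; try exact: L1_mul_jac.
apply: eq_integral_ae.
- by apply: L1_measurable; exact: L1_mul_jac.
- by apply: L1_measurable; apply: L1B; exact: L1_mul_jac.
apply: ae_imp (aeI (good_ae lF) (good_ae lF')) => x [Fx F'x].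
rewrite (@jac_lin _ _ _ _ _ F F' x 1 (-1)); first by ring.
by move=> j; rewrite pdB// mul1r mulN1r.
Qed.

End bounds.

Lemma pairingE G w F : pairing G w F = \int[lam]_x (w x * jac (upd G ord0 F) x).
Proof. by []. Qed.

End jac_integrals.

Local Opaque jac pairing.

(** * Dyadic telescoping *)

Section telescoping.
Context {R : realType} {m : nat}.
Notation n := m.+1.
Implicit Types (f g w F : 'rV[R]_n -> R) (x y : 'rV[R]_n).
Notation lam := (@lebesgue_rV R n).

Definition hoelder_fun (beta L : R) f := forall x y, `|f x - f y| <= L * `|x - y| `^ beta.

Section regularization.
Variables (beta L : R) (f : 'rV[R]_n -> R).
Hypotheses (beta01 : 0 < beta <= 1) (L0 : 0 <= L) (fL : hoelder_fun beta L f).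

Definition regul (rho : R) := infconv setT f (L * rho `^ (beta - 1)).

Let lb rho x z : 0 < rho -> f x - L * rho `^ beta <= f z + L * rho `^ (beta - 1) * `|x - z|.
Proof.
move=> rho0; have := fL x z; rewrite ler_norml => /andP[_ H].
have := ler_wpM2l L0 (powR_split beta01 (normr_ge0 (x - z)) rho0).
by rewrite mulrDr mulrA; move: H; lra.
Qed.

Let ne : [set: 'rV[R]_n] !=set0. Proof. by exists 0. Qed.

Lemma regul_le rho x : 0 < rho -> regul rho x <= f x.
Proof.
move=> rho0; have := @infconv_le _ _ setT f (L * rho `^ (beta - 1)) _ x x
  (fun z _ => lb x z rho0) I.
by rewrite subrr normr0 mulr0 addr0.
Qed.

Lemma regul_ge rho x : 0 < rho -> f x - L * rho `^ beta <= regul rho x.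
Proof. by move=> rho0; apply: infconv_ge => // z _; exact: lb. Qed.

Lemma regul_lip rho : 0 < rho -> is_lip (L * rho `^ (beta - 1)) (regul rho).
Proof.
move=> rho0; apply: infconv_lip => //; first by rewrite mulr_ge0// powR_ge0.
by move=> x; exists (f x - L * rho `^ beta) => z _; exact: lb.
Qed.

Lemma regul_id rho (K : R) : 0 < rho -> is_lip K f -> K <= L * rho `^ (beta - 1) ->
  regul rho = f.
Proof.
move=> rho0 fK KL; apply/funext => x; apply/eqP; rewrite eq_le regul_le//=.
apply: infconv_ge => // z _; rewrite -lerBlDl.
apply: le_trans (ler_norm _) (le_trans (fK x z) _).
by rewrite ler_wpM2r.
Qed.

End regularization.

Definition dyad (rho0 : R) (k : nat) : R := rho0 / 2 ^+ k.

Lemma dyad_gt0 rho0 k : 0 < rho0 -> 0 < dyad rho0 k.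
Proof. by move=> r0; rewrite divr_gt0// exprn_gt0. Qed.

Lemma dyadS rho0 k : dyad rho0 k.+1 = dyad rho0 k / 2.
Proof. by rewrite /dyad exprS invfM [2^-1 * _]mulrC mulrA. Qed.

Lemma dyad_le rho0 k : 0 < rho0 -> dyad rho0 k <= rho0.
Proof.
move=> r0; rewrite /dyad ler_pdivrMr ?exprn_gt0// ler_peMr ?(ltW r0)//.
by rewrite exprn_ege1// ler1n.
Qed.

Lemma dyad_powR rho0 k (g : R) : 0 < rho0 ->
  dyad rho0 k `^ g = rho0 `^ g * (2 `^ (- g)) ^+ k.
Proof.
move=> r0; elim: k => [|k IH]; first by rewrite /dyad expr0 divr1 expr0 mulr1.
rewrite dyadS powRM ?invr_ge0 ?(ltW (dyad_gt0 _ _))// IH exprS.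
rewrite (_ : 2^-1 `^ g = 2 `^ (- g)); last first.
  by rewrite -[2^-1]powR_inv1// -powRrM mulN1r.
by ring.
Qed.

Lemma half_powR_lt1 (g : R) : 0 < g -> 0 <= (2 : R) `^ (- g) < 1.
Proof.
move=> g0; rewrite powR_ge0/=.
have -> : (2 : R) `^ (- g) = 2^-1 `^ g.
  by rewrite -[2^-1]powR_inv1// -powRrM mulN1r.
have {2}<- : 1 `^ g = 1 :> R by rewrite powR1.
by apply: gt0_ltr_powR; rewrite ?nnegrE//; lra.
Qed.

Lemma dyad_small (rho0 d : R) : 0 < rho0 -> 0 < d ->
  exists N, forall k, (N <= k)%N -> dyad rho0 k <= d.
Proof.
move=> r0 d0; exists (Num.truncn (rho0 / d)).+1 => k Nk.
rewrite /dyad ler_pdivrMr ?exprn_gt0// mulrC -ler_pdivrMr//.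
rewrite (le_trans (ltW (truncnS_gt _)))// -natrX ler_nat (leq_trans Nk)// ltnW//.
exact: ltn_expl.
Qed.

(** The slope [L rho^(beta-1)] exceeds the Lipschitz constant of [f] at small scales, and [regul_id]
    applies. If [beta = 1] or [L = 0] the slope does not grow, but then [f] already has Lipschitz
    constant [L]. *)
Lemma regul_eventually (beta L K rho0 : R) f : 0 < beta <= 1 -> 0 <= L ->
  hoelder_fun beta L f -> is_lip K f -> 0 < rho0 ->
  exists N, forall k, (N <= k)%N -> regul beta L f (dyad rho0 k) = f.
Proof.
move=> b01 L0 fL fK r0; have /andP[b0] := b01; rewrite le_eqVlt => /predU1P[b1|b1].
  exists 0%N => k _; apply: (regul_id b01 L0 fL (K := L)); first exact: dyad_gt0.
    by move=> x y; have := fL x y; rewrite b1 powRr1.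
  by rewrite b1 subrr powRr0 mulr1.
move: L0; rewrite le_eqVlt => /predU1P[L0|L0].
  exists 0%N => k _; have L0' : 0 <= L by rewrite -L0.
  apply: (regul_id b01 L0' fL (K := 0)); first exact: dyad_gt0.
    by move=> x y; have := fL x y; rewrite -L0 !mul0r.
  by rewrite -L0 mul0r.
pose K' := `|K| + 1.
have K'0 : 0 < K' by rewrite ltr_wpDl.
have KL0 : 0 < K' / L by rewrite divr_gt0.
(* The scale at which the slope [L d^(beta-1)] is exactly [K']. *)
pose d := (K' / L) `^ ((beta - 1)^-1).
have d0 : 0 < d by exact: powR_gt0.
have [N HN] := dyad_small r0 d0; exists N => k /HN kd.
apply: (regul_id b01 (ltW L0) fL (K := K')); first exact: dyad_gt0.
  by apply: is_lip_le fK; rewrite (le_trans (ler_norm _))// lerDl.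
rewrite mulrC -ler_pdivrMr//.
have -> : K' / L = d `^ (beta - 1).
  by rewrite /d -powRrM mulVf ?powRr1 ?(ltW KL0)// lt_eqF// subr_lt0.
by apply: powR_anti => //; [rewrite subr_le0 ltW|exact: dyad_gt0].
Qed.

Section telescope.
Variables (G : 'I_n -> 'rV[R]_n -> R) (l : 'I_m -> R).
Hypotheses (lG : forall i, lipf (G i)) (l0 : forall i, 0 <= l i)
  (Gl : forall i, is_lip (l i) (G (lift ord0 i))).
Variables (beta L rho0 : R) (f w : 'rV[R]_n -> R) (w_ : nat -> 'rV[R]_n -> R).
Variables (N0 X : R) (a_ b_ : nat -> R).
Hypotheses (beta01 : 0 < beta <= 1) (L0 : 0 <= L) (fL : hoelder_fun beta L f)
  (lf : lipf f) (rho0_gt0 : 0 < rho0).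
Hypotheses (Iw : L1 w) (Iw_ : forall k, L1 (w_ k))
  (w_w : \int[lam]_x `|w x - w_ k x| @[k --> \oo] --> (0 : R)).
Hypotheses (wN0 : \int[lam]_x `|w_ 0%N x| <= N0)
  (wa : forall k, \int[lam]_x `|w_ k.+1 x - w_ k x| <= a_ k)
  (b0 : forall k, 0 <= b_ k).
Let Lam := \prod_i l i.
Notation T := (pairing G).
Notation rho := (dyad rho0).
(** A common form for two situations: for Lipschitz [w_ k] the bound on [F] suffices, through
    [pairing_le_sup]; for [u] times a cutoff, the Lipschitz constant [b / rho k] is also used, to
    control a Hoelder constant. *)
Hypothesis wb : forall k F b, 0 <= b -> (forall x, `|F x| <= b) ->
  is_lip (b / rho k) F -> `|T (w_ k) F| <= b * b_ k * Lam.
Hypothesis sumX : forall K, N0 * rho0 `^ (beta - 1) +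
  \sum_(k < K) (a_ k * rho k `^ (beta - 1) + b_ k * rho k `^ beta) <= X.

Let Lam0 : 0 <= Lam. Proof. exact: prodr_ge0. Qed.

Let f_ k := regul beta L f (rho k).

Let rho_gt0 k : 0 < rho k. Proof. exact: dyad_gt0. Qed.

Let M k := L * rho k `^ (beta - 1).

Let M0 k : 0 <= M k. Proof. by rewrite mulr_ge0// powR_ge0. Qed.

Let fM k : is_lip (M k) (f_ k). Proof. exact: regul_lip. Qed.

Let lf_ k : lipf (f_ k). Proof. by exists (M k). Qed.

Let MS k : M k.+1 <= 2 * M k.
Proof.
rewrite /M mulrCA ler_wpM2l// dyadS powRM ?(ltW (rho_gt0 k))// ?invr_ge0//.
rewrite mulrC ler_wpM2r ?powR_ge0//.
rewrite -[2^-1]powR_inv1// -powRrM mulN1r opprB.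
rewrite -[leRHS]powRr1//; apply: ler_powR; first by rewrite ler1n.
by case/andP: beta01 => ? ?; lra.
Qed.

Let diff_sup k x : `|f_ k.+1 x - f_ k x| <= 3 * (L * rho k `^ beta).
Proof.
have A := regul_le beta01 L0 fL x (rho_gt0 k).
have A' := regul_le beta01 L0 fL x (rho_gt0 k.+1).
have B := regul_ge beta01 L0 fL x (rho_gt0 k).
have B' := regul_ge beta01 L0 fL x (rho_gt0 k.+1).
have C : L * rho k.+1 `^ beta <= L * rho k `^ beta.
  rewrite ler_wpM2l//; apply: powR_mono; [by case/andP: beta01 => /ltW| |].
    exact: ltW.
  by rewrite dyadS ler_pdivrMr// ler_peMr ?(ltW (rho_gt0 k))// ler1n.
have D : 0 <= L * rho k `^ beta by rewrite mulr_ge0// powR_ge0.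
rewrite ler_norml /f_; move: (L * _) (L * _) (regul _ _ _ _ _) (regul _ _ _ _ _) A A' B B' C D.
by move=> a b c d A A' B B' C D; apply/andP; split; lra.
Qed.

(** Slopes at most double from one scale to the next, so their sum is at most [3 M k]. The same 3
    appears in [diff_sup] because [wb] needs one [b] for both bounds. *)
Let diff_lip k : is_lip (3 * (L * rho k `^ beta) / rho k) (fun x => f_ k.+1 x - f_ k x).
Proof.
apply: is_lip_le (is_lipB (fM k.+1) (fM k)).
have -> : 3 * (L * rho k `^ beta) / rho k = 3 * M k.
  by rewrite /M powRB1// !mulrA.
by have := MS k; lra.
Qed.

(** Each increment is the pairing of [w_ K.+1 - w_ K] with [f_ K.+1] plus that of [w_ K] with
    [f_ K.+1 - f_ K]. The first costs [2 n!], from the doubled slope and the determinant, the second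
    costs 3. *)
Let partial_bound K : `|T (w_ K) (f_ K)| <= (2 * n`!%:R + 3) * L * Lam *
  (N0 * rho0 `^ (beta - 1) +
   \sum_(k < K) (a_ k * rho k `^ (beta - 1) + b_ k * rho k `^ beta)).
Proof.
set C := 2 * n`!%:R + 3 : R.
have n0 : 0 <= n`!%:R :> R by [].
have C2 : 2 * n`!%:R <= C by rewrite /C lerDl.
have C3 : 3 <= C by rewrite /C lerDr mulr_ge0.
elim: K => [|K IH].
  rewrite big_ord0 addr0; have := pairing_le_lip lG l0 Gl (Iw_ 0%N) (M0 0%N) (fM 0%N).
  move/le_trans; apply.
  have -> : M 0%N = L * rho0 `^ (beta - 1) by rewrite /M /dyad expr0 divr1.
  have p0 : 0 <= rho0 `^ (beta - 1) := powR_ge0 _ _.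
  have I0 : 0 <= \int[lam]_x `|w_ 0%N x| by exact: Rintegral_ge0.
  have -> : n`!%:R * (L * rho0 `^ (beta - 1)) * \prod_i l i * \int[lam]_x `|w_ 0%N x| =
    n`!%:R * (L * Lam * (\int[lam]_x `|w_ 0%N x| * rho0 `^ (beta - 1))).
    by rewrite /Lam; move: (\int[lam]_x _) (\prod_i _) => a b; ring.
  have -> : C * L * Lam * (N0 * rho0 `^ (beta - 1)) =
    C * (L * Lam * (N0 * rho0 `^ (beta - 1))) by ring.
  apply: ler_pM => //; first by rewrite !mulr_ge0.
    by rewrite /C; lra.
  by rewrite ler_wpM2l ?mulr_ge0// ler_wpM2r.
rewrite big_ord_recr /= addrA mulrDr.
have IwB : L1 (fun x => w_ K.+1 x - w_ K x) by exact: L1B.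
have alg (A B D : R) : A = D + ((A - B) + (B - D)) by ring.
have -> : T (w_ K.+1) (f_ K.+1) = T (w_ K) (f_ K) +
    (T (fun x => w_ K.+1 x - w_ K x) (f_ K.+1) +
     T (w_ K) (fun x => f_ K.+1 x - f_ K x)).
  rewrite (pairingBl lG (Iw_ _) (Iw_ _) (lf_ _)) (pairingBr lG (Iw_ _) (lf_ _) (lf_ _)).
  exact: alg.
apply: le_trans (ler_normD _ _) (lerD IH _).
have H1 := pairing_le_lip lG l0 Gl IwB (M0 K.+1) (fM K.+1).
have b30 : 0 <= 3 * (L * rho K `^ beta) by rewrite !mulr_ge0// powR_ge0.
have H2 := wb b30 (diff_sup K) (@diff_lip K).
apply: le_trans (ler_normD _ _) (le_trans (lerD H1 H2) _).
have aK := wa K.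
have a0 : 0 <= a_ K by apply: le_trans aK; exact: Rintegral_ge0.
have p0 : 0 <= rho K `^ (beta - 1) := powR_ge0 _ _.
have q0 : 0 <= rho K `^ beta := powR_ge0 _ _.
have H3 : n`!%:R * M K.+1 * Lam * \int[lam]_x `|w_ K.+1 x - w_ K x| <=
    n`!%:R * (2 * M K) * Lam * a_ K.
  apply: ler_pM; [|exact: Rintegral_ge0| |exact: aK].
    by rewrite mulr_ge0// mulr_ge0.
  by rewrite ler_wpM2r// ler_wpM2l.
apply: le_trans (lerD H3 (lexx _)) _.
have A0 : 0 <= L * Lam * (a_ K * rho K `^ (beta - 1)) by rewrite !mulr_ge0.
have B0 : 0 <= L * Lam * (b_ K * rho K `^ beta) by rewrite !mulr_ge0.
have -> : n`!%:R * (2 * M K) * Lam * a_ K + 3 * (L * rho K `^ beta) * b_ K * Lam =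
  2 * n`!%:R * (L * Lam * (a_ K * rho K `^ (beta - 1))) +
  3 * (L * Lam * (b_ K * rho K `^ beta)) by rewrite /M; ring.
have -> : C * L * Lam * (a_ K * rho K `^ (beta - 1) + b_ K * rho K `^ beta) =
  C * (L * Lam * (a_ K * rho K `^ (beta - 1))) +
  C * (L * Lam * (b_ K * rho K `^ beta)) by ring.
by apply: lerD; [exact: (ler_wpM2r A0 C2)|exact: (ler_wpM2r B0 C3)].
Qed.

(** For large [k] the regularized function is [f] itself, so only [w_ k] still has to converge,
    paired with a fixed Lipschitz function. The Lipschitz constant of [f] only decides how large [k]
    must be. *)
Lemma telescoping_bound : `|T w f| <= (2 * n`!%:R + 3) * L * X * Lam.
Proof.
have [K K0 fK] := lf.
have [N HN] := regul_eventually beta01 L0 fL fK rho0_gt0.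
have C0 : 0 <= 2 * n`!%:R + 3 :> R by have : 0 <= n`!%:R :> R by []; lra.
apply/ler_addgt0Pl => e e0.
pose D := n`!%:R * K * Lam.
have D0 : 0 <= D by rewrite !mulr_ge0.
have D1 : 0 < D + 1 by rewrite ltr_wpDl.
move/cvgrPdist_le : w_w => /(_ (e / (D + 1))).
rewrite divr_gt0// => /(_ isT)[N' _ HN'].
pose k := maxn N N'.
have {HN'} := HN' k (leq_maxr _ _); rewrite /= sub0r normrN.
rewrite ger0_norm; last exact: Rintegral_ge0.
move=> wk.
have IwB : L1 (fun x => w x - w_ k x) by exact: L1B.
have -> : T w f = T (fun x => w x - w_ k x) f + T (w_ k) f by rewrite (pairingBl lG Iw (Iw_ _) lf) subrK.
apply: le_trans (ler_normD _ _) (lerD _ _).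
  apply: le_trans (pairing_le_lip lG l0 Gl IwB K0 fK) _.
  rewrite -/Lam -/D; apply: le_trans (ler_wpM2l D0 wk) _.
  rewrite mulrCA ger_pMr// ler_pdivrMr// mul1r; lra.
have := partial_bound k; rewrite /f_ HN ?leq_maxl// => /le_trans; apply.
rewrite -!mulrA [X * _]mulrC !mulrA ler_wpM2l//.
by rewrite !mulr_ge0.
Qed.

End telescope.
End telescoping.

(** * The Euclidean norm compared with the maximum norm *)

Section enorm_facts.
Context {R : realType} {n : nat}.
Implicit Types (x y z : 'rV[R]_n).

Lemma sum_sqr_ge0 x : 0 <= \sum_(i < n) x ord0 i ^+ 2.
Proof. by apply: sumr_ge0 => i _; exact: sqr_ge0. Qed.

Lemma enorm_ge0 x : 0 <= enorm x.
Proof. exact: sqrtr_ge0. Qed.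

Lemma enorm_sqr x : enorm x ^+ 2 = \sum_(i < n) x ord0 i ^+ 2.
Proof. by rewrite sqr_sqrtr// sum_sqr_ge0. Qed.

Lemma norm_le_enorm x : `|x| <= enorm x.
Proof.
apply: norm_rV_le => [|i]; first exact: enorm_ge0.
rewrite -(@ler_pXn2r _ 2) ?nnegrE ?enorm_ge0// enorm_sqr real_normK ?num_real//.
by rewrite (bigD1 i)//= lerDl sumr_ge0// => j _; exact: sqr_ge0.
Qed.

Lemma enorm_le_norm x : enorm x <= n%:R * `|x|.
Proof.
rewrite -(@ler_pXn2r _ 2) ?nnegrE ?enorm_ge0 ?mulr_ge0// enorm_sqr.
apply: (@le_trans _ _ (\sum_(i < n) `|x| ^+ 2)).
  apply: ler_sum => i _; rewrite -[leLHS]real_normK ?num_real//.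
  by rewrite ler_pXn2r ?nnegrE// coord_le_norm.
rewrite sumr_const card_ord -[leLHS]mulr_natl exprMn ler_wpM2r ?sqr_ge0//.
by rewrite -natrX ler_nat; case: (n) => // k; rewrite expnS expn1 leq_pmulr.
Qed.

Lemma enormN x : enorm (- x) = enorm x.
Proof. by rewrite /enorm; under eq_bigr do rewrite mxE sqrrN. Qed.

Lemma enormZ (t : R) x : 0 <= t -> enorm (t *: x) = t * enorm x.
Proof.
move=> t0; rewrite /enorm; under eq_bigr do rewrite mxE exprMn.
by rewrite -mulr_sumr sqrtrM ?sqr_ge0// sqrtr_sqr ger0_norm.
Qed.

Lemma enorm_gt0 x : x != 0 -> 0 < enorm x.
Proof. by move=> x0; apply: lt_le_trans (norm_le_enorm x); rewrite normr_gt0. Qed.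

(* Cauchy-Schwarz, from [0 <= sum (s x_i - t y_i)^2] with [s = |y|], [t = |x|]. *)
Lemma enorm_triangle x y : enorm (x + y) <= enorm x + enorm y.
Proof.
set a := enorm x; set b := enorm y.
have a0 : 0 <= a := enorm_ge0 x; have b0 : 0 <= b := enorm_ge0 y.
have Ea : a ^+ 2 = _ := enorm_sqr x; have Eb : b ^+ 2 = _ := enorm_sqr y.
pose s := \sum_(i < n) x ord0 i * y ord0 i.
have E (p q : R) : \sum_(i < n) (p * x ord0 i + q * y ord0 i) ^+ 2 =
    p ^+ 2 * a ^+ 2 + 2 * (p * q) * s + q ^+ 2 * b ^+ 2.
  rewrite Ea Eb /s !mulr_sumr -!big_split/=; apply: eq_bigr => i _; ring.
have CS : s <= a * b.
  have : 0 <= \sum_(i < n) (b * x ord0 i + (- a) * y ord0 i) ^+ 2.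
    by apply: sumr_ge0 => i _; exact: sqr_ge0.
  (* The sum of squares equals [2ab(ab - s)], which gives the sign of [ab - s] only when [ab] is
     nonzero; otherwise one of the vectors is 0. *)
  rewrite E; have [ab0|ab0] := eqVneq (a * b) 0.
    move=> _; have [] : a = 0 \/ b = 0.
      by move/eqP: ab0; rewrite mulf_eq0 => /orP[/eqP|/eqP]; [left|right].
    - move=> a0'; rewrite a0' mul0r /s big1// => i _.
      have : `|x ord0 i| <= 0 by rewrite -a0' (le_trans (coord_le_norm _ _))// norm_le_enorm.
      by rewrite normr_le0 => /eqP ->; rewrite mul0r.
    - move=> b0'; rewrite b0' mulr0 /s big1// => i _.
      have : `|y ord0 i| <= 0 by rewrite -b0' (le_trans (coord_le_norm _ _))// norm_le_enorm.
      by rewrite normr_le0 => /eqP ->; rewrite mulr0.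
  have abp : 0 < a * b by rewrite lt_neqAle eq_sym ab0 mulr_ge0.
  have -> : b ^+ 2 * a ^+ 2 + 2 * (b * - a) * s + (- a) ^+ 2 * b ^+ 2 =
    (a * b) * (2 * (a * b - s)) by ring.
  by rewrite pmulr_rge0// pmulr_rge0// subr_ge0.
rewrite -(@ler_pXn2r _ 2) ?nnegrE ?enorm_ge0 ?addr_ge0// enorm_sqr.
have -> : \sum_(i < n) (x + y) ord0 i ^+ 2 = a ^+ 2 + 2 * s + b ^+ 2.
  under eq_bigr do rewrite mxE -[X in X + _]mul1r -[X in _ + X]mul1r.
  by rewrite E; ring.
rewrite sqrrD lerD2r lerD2l -[leRHS]mulr_natl ler_wpM2l//.
Qed.

Lemma enorm_lip z : is_lip n%:R (fun y => enorm (y - z)).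
Proof.
move=> x y; apply: le_trans (enorm_le_norm (x - y)).
have H a b : enorm (a - z) - enorm (b - z) <= enorm (a - b).
  by rewrite lerBlDr -[X in enorm X <= _](subrKA b) (le_trans (enorm_triangle _ _)).
rewrite ler_norml H andbT lerNl opprB (le_trans (H _ _))//.
by rewrite -enormN opprB.
Qed.

End enorm_facts.


(** * Fractional variation in terms of pairings and the maximum norm *)

Section fractional_variation.
Context {R : realType} {m : nat}.
Notation n := m.+1.
Implicit Types (f g w u F : 'rV[R]_n -> R) (x y : 'rV[R]_n) (A : set 'rV[R]_n).
Implicit Types G : 'I_n -> 'rV[R]_n -> R.
Notation lam := (@lebesgue_rV R n).

Lemma Lip_on_ge0 A a f x y : A x -> A y -> x != y -> (0 <= Lip_on A a f)%E.
Proof.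
move=> Ax Ay xy; apply: (@le_trans _ _ (`|f x - f y| / enorm (x - y) `^ a)%:E).
  by rewrite lee_fin divr_ge0// powR_ge0.
by apply: ereal_sup_ubound; exists x, y.
Qed.

Lemma rV_two_points : (0 : 'rV[R]_n) != delta_mx ord0 ord0.
Proof. by rewrite eq_sym -normr_gt0 norm_delta_mx. Qed.

Lemma Lip_ge0 a f : (0 <= Lip a f)%E.
Proof. exact: Lip_on_ge0 I I rV_two_points. Qed.

Lemma Lip_on_leP A (a L : R) f : 0 <= L ->
  (forall x y, A x -> A y -> `|f x - f y| <= L * enorm (x - y) `^ a) <->
  (Lip_on A a f <= L%:E)%E.
Proof.
move=> L0; split => [H|H x y Ax Ay].
  apply: ge_ereal_sup => _ [x [y [Ax Ay xy ->]]].
  rewrite lee_fin ler_pdivrMr; first exact: H.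
  by apply: powR_gt0; apply: enorm_gt0; rewrite subr_eq0.
have [->|xy] := eqVneq x y; first by rewrite subrr normr0 mulr_ge0// powR_ge0.
have := le_trans (ereal_sup_ubound _) H => /(_ (`|f x - f y| / enorm (x - y) `^ a)%:E).
rewrite lee_fin ler_pdivrMr; first by apply; exists x, y.
by apply: powR_gt0; apply: enorm_gt0; rewrite subr_eq0.
Qed.

Lemma is_Lip_real a f : is_Lip a f -> exists2 L, 0 <= L & Lip a f = L%:E.
Proof.
move=> fL; exists (fine (Lip a f)); first by apply: fine_ge0; exact: Lip_ge0.
by rewrite fineK// ge0_fin_numE// Lip_ge0.
Qed.

Lemma Lip1_lip f (L : R) : 0 <= L -> (Lip 1 f <= L%:E)%E -> is_lip (n%:R * L) f.
Proof.
move=> L0 /(Lip_on_leP _ _ _ L0) fL x y; apply: le_trans (fL x y I I) _.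
rewrite powRr1 ?enorm_ge0// [n%:R * L]mulrC -mulrA ler_wpM2l//.
exact: enorm_le_norm.
Qed.

Lemma lip_Lip1 f (L : R) : 0 <= L -> is_lip L f -> (Lip 1 f <= L%:E)%E.
Proof.
move=> L0 fL; apply/Lip_on_leP => // x y _ _; apply: le_trans (fL x y) _.
by rewrite powRr1 ?enorm_ge0// ler_wpM2l// norm_le_enorm.
Qed.

Lemma hoelder_Lip f (a L : R) : 0 <= a -> 0 <= L -> hoelder_fun a L f -> (Lip a f <= L%:E)%E.
Proof.
move=> a0 L0 fL; apply/Lip_on_leP => // x y _ _; apply: le_trans (fL x y) _.
by rewrite ler_wpM2l// powR_mono// norm_le_enorm.
Qed.

Lemma powR_le_nat (a : R) (k : nat) : 0 <= a <= 1 -> k.+1%:R `^ a <= k.+1%:R :> R.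
Proof.
by move=> /andP[a0 a1]; rewrite -[leRHS]powRr1//; apply: ler_powR; rewrite ?ler1n.
Qed.

(** The Euclidean norm is at most [n] times the maximum norm, and [n^a <= n] because [n >= 1]. *)
Lemma Lip_hoelder f (a L : R) : 0 <= a <= 1 -> 0 <= L -> (Lip a f <= L%:E)%E ->
  hoelder_fun a (n%:R * L) f.
Proof.
move=> a01 L0 /(Lip_on_leP _ _ _ L0) fL x y; apply: le_trans (fL x y I I) _.
have /andP[a0 _] := a01.
rewrite [n%:R * L]mulrC -mulrA ler_wpM2l//.
apply: le_trans (powR_mono a0 (enorm_ge0 _) (enorm_le_norm (x - y))) _.
by rewrite powRM// ler_wpM2r ?powR_ge0// powR_le_nat.
Qed.

Lemma det_DE f (g : m.-tuple ('rV[R]_n -> R)) :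
  det_D f g = jac (fun i => nth f (f :: g) i).
Proof. by []. Qed.

(** Each of the [n] functions in the Jacobian loses a factor [n] in passing from Euclidean seminorms
    to the maximum norm, whence [n^n]. *)
Lemma frac_var_le (w : 'rV[R]_n -> R) (beta X : R) : 0 <= beta <= 1 -> L1 w -> 0 <= X ->
  (forall G (l : 'I_m -> R) f (L : R), (forall i, lipf (G i)) -> (forall i, 0 <= l i) ->
    (forall i, is_lip (l i) (G (lift ord0 i))) -> lipf f -> 0 <= L -> hoelder_fun beta L f ->
    `|pairing G w f| <= X * L * \prod_i l i) ->
  (frac_var beta w <= (X * n%:R ^+ n)%:E)%E.
Proof.
(* The extra [e] makes the candidate constant positive. With the convention that 0 times [+oo] is 0,
   the constant 0 would give no room when [Lip beta f] is infinite. *)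
move=> b01 Iw X0 H; apply/lee_addgt0Pr => e e0; rewrite -EFinD.
set Y := X * n%:R ^+ n + e.
have XY : X * n%:R ^+ n <= Y by rewrite lerDl ltW.
have Xn0 : 0 <= X * n%:R ^+ n by rewrite mulr_ge0.
have Y0 : 0 < Y by rewrite ltr_wpDl.
apply: ereal_inf_lbound; split; first by rewrite lee_fin ltW.
move=> f g lipf_f lipf_g.
pose G (i : 'I_n) := nth f (f :: g) i.
have Glift i : G (lift ord0 i) = tnth g i.
  by rewrite /G /= (tnth_nth f).
have [K K0 fK] := is_Lip_real lipf_f.
have /choice[l lP] : forall i, exists l, 0 <= l /\ Lip 1 (tnth g i) = l%:E.
  by move=> i; have [l l0 gl] := is_Lip_real (lipf_g i); exists l.
have l0 i : 0 <= l i by have [] := lP i.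
have gl i : Lip 1 (tnth g i) = (l i)%:E by have [] := lP i.
have lf : lipf f.
  by exists (n%:R * K); [rewrite mulr_ge0|apply: Lip1_lip => //; rewrite fK].
have Gl i : is_lip (n%:R * l i) (G (lift ord0 i)).
  by rewrite Glift; apply: Lip1_lip => //; rewrite gl.
have lG i : lipf (G i).
  case: (unliftP ord0 i) => [j ->|->] //.
  by exists (n%:R * l j) => //; rewrite mulr_ge0.
have updG : upd G ord0 f = G.
  by rewrite -[X in upd G ord0 X](_ : G ord0 = f)// upd_id.
have intE : (\int[lam]_x (w x * det_D f g x)%:E = (pairing G w f)%:E)%E.
  rewrite det_DE -/G integral_EFin; last exact: (L1_mul_jac Iw lG).
  by rewrite pairingE updG.
rewrite intE abse_EFin.
under eq_bigr do rewrite gl.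
rewrite prodEFin.
have prod0 : 0 <= \prod_i l i by apply: prodr_ge0.
have [Lf|] := boolP (Lip beta f < +oo)%E; last first.
  rewrite -leNgt leye_eq => /eqP ->; rewrite gt0_muley ?lte_fin//.
  (* If the product of the Lipschitz constants is 0, the right-hand side is 0 even for infinite
     [Lip beta f]; but then some row of the Jacobian vanishes and so does the integral. *)
  have [P0|P0] := eqVneq (\prod_i l i) 0; last first.
    by rewrite gt0_mulye ?leey// lte_fin lt_neqAle eq_sym P0 prod0.
  rewrite P0 mule0 lee_fin.
  have /prodf_eq0[i _ /eqP li0] : \prod_i l i == 0 by apply/eqP.
  rewrite pairingE normr_le0; apply/eqP.
  transitivity (\int[lam]_x (cst 0 x : R)); last by rewrite Rintegral_cst// mul0r.
  apply: eq_Rintegral => x _; rewrite updG (jac_row0 (k := lift ord0 i)) ?mulr0// => j.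
  have := pd_le j x _ (Gl i); rewrite li0 mulr0 => /(_ (lexx _)).
  by rewrite normr_le0 => /eqP.
have [L L0 fL] := is_Lip_real Lf; rewrite fL -!EFinM lee_fin.
have n0 : 0 <= n%:R :> R by [].
have nl0 i : 0 <= n%:R * l i by rewrite mulr_ge0.
have fLh : hoelder_fun beta (n%:R * L) f by apply: Lip_hoelder => //; rewrite fL.
apply: le_trans (H G _ f _ lG nl0 Gl lf (mulr_ge0 n0 L0) fLh) _.
rewrite big_split/= prodr_const card_ord.
rewrite (_ : X * _ * _ = X * n%:R ^+ n * (L * \prod_i l i)); last by rewrite exprS; ring.
by rewrite -[leRHS]mulrA ler_wpM2r// mulr_ge0.
Qed.

(** A finite infimum has an admissible finite constant above it. Seminorms taken with the Euclidean
    norm are at most those taken with the maximum norm, so no dimensional factor is lost. *)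
Lemma frac_var_finite u (alpha : R) : 0 <= alpha -> L1 u -> (frac_var alpha u < +oo)%E ->
  exists2 V : R, 0 <= V &
  forall G (l : 'I_m -> R) f (L : R), (forall i, lipf (G i)) -> (forall i, 0 <= l i) ->
    (forall i, is_lip (l i) (G (lift ord0 i))) -> lipf f -> 0 <= L -> hoelder_fun alpha L f ->
    `|pairing G u f| <= V * L * \prod_i l i.
Proof.
move=> a0 Iu /ereal_inf_lt[C [C0 HC] Coo].
have Cfin : C \is a fin_num by rewrite ge0_fin_numE.
exists (fine C); first exact: fine_ge0.
move=> G l f L lG l0 Gl lf L0 fL.
pose g : n.-1.-tuple ('rV[R]_n -> R) := [tuple G (lift ord0 i) | i < m].
have gE i : tnth g i = G (lift ord0 i) by rewrite tnth_mktuple.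
have Lg i : (Lip 1 (tnth g i) <= (l i)%:E)%E by rewrite gE; exact: lip_Lip1.
have Lf1 : is_Lip 1 f.
  by have [K K0 fK] := lf; apply: le_lt_trans (lip_Lip1 K0 fK) (ltry _).
have Lg1 i : is_Lip 1 (tnth g i) by apply: le_lt_trans (Lg i) (ltry _).
have := HC f g Lf1 Lg1.
have GE : (fun i : 'I_n => nth f (f :: g) i) = upd G ord0 f.
  apply/funext => i; case: (unliftP ord0 i) => [j ->|->]; last by rewrite upd_eq.
  by rewrite upd_neq//= -(tnth_nth f g j) gE.
rewrite det_DE GE integral_EFin; last exact: (L1_mul_jac Iu (lipf_upd ord0 lG lf)).
rewrite abse_EFin -/(pairing G u f) => H.
rewrite -lee_fin; apply: le_trans H _.
rewrite !EFinM fineK// -prodEFin.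
have P (s : seq 'I_m) : (0 <= \prod_(i <- s) Lip 1 (tnth g i) <= \prod_(i <- s) (l i)%:E)%E.
  elim: s => [|i s /andP[IH0 IH]]; first by rewrite !big_nil lexx lee_fin ler01.
  rewrite !big_cons mule_ge0 ?Lip_ge0//= lee_pmul// ?Lip_ge0//; exact: Lg.
have /andP[P0 P1] := P (index_enum _).
apply: lee_pmul => //; first by rewrite mule_ge0// Lip_ge0.
by rewrite lee_wpmul2l//; exact: hoelder_Lip.
Qed.

Lemma BVc_intro w (beta X : R) K : 0 <= beta <= 1 -> L1 w -> 0 <= X ->
  compact K -> (forall x, ~ K x -> w x = 0) ->
  (forall G (l : 'I_m -> R) f (L : R), (forall i, lipf (G i)) -> (forall i, 0 <= l i) ->
    (forall i, is_lip (l i) (G (lift ord0 i))) -> lipf f -> 0 <= L -> hoelder_fun beta L f ->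
    `|pairing G w f| <= X * L * \prod_i l i) ->
  BVc beta w.
Proof.
move=> b01 Iw X0 cK Kw H; split.
  by split => //; exists K => //; apply: aeW => x; exact: Kw.
exact: le_lt_trans (frac_var_le b01 Iw X0 H) (ltry _).
Qed.

End fractional_variation.

Section interpolation.
Context {R : realType} {m : nat}.
Notation n := m.+1.
Implicit Types (f g w F : 'rV[R]_n -> R) (x y : 'rV[R]_n).
Implicit Types G : 'I_n -> 'rV[R]_n -> R.
Notation lam := (@lebesgue_rV R n).

Lemma geometric_sum_le (q : R) K : 0 <= q < 1 -> \sum_(k < K) q ^+ k <= (1 - q)^-1.
Proof.
move=> /andP[q0 q1]; have q1' : 0 < 1 - q by rewrite subr_gt0.
rewrite -[leRHS]mul1r ler_pdivlMr// mulrC.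
have -> : (1 - q) * \sum_(k < K) q ^+ k = 1 - q ^+ K.
  elim: K => [|K IH]; first by rewrite big_ord0 mulr0 expr0 subrr.
  by rewrite big_ord_recr /= mulrDr IH exprS; ring.
by rewrite gerBl exprn_ge0.
Qed.

(** The first factor is that of [telescoping_bound]. In the second, 1 is the contribution of scale 0
    and the rest a geometric series of ratio [2^(-g)], with 2 from the increments of [w_] and [n!]
    from their gradients. *)
Definition interp_const (g : R) : R :=
  (2 * n`!%:R + 3) * (1 + (2 + n`!%:R) / (1 - (2 : R) `^ (- g))).

Lemma interp_const_ge0 (g : R) : 0 < g -> 0 <= interp_const g.
Proof.
move=> g0; have /andP[q0 q1] := half_powR_lt1 g0.
have n0 : 0 <= n`!%:R :> R by [].
by rewrite mulr_ge0 ?addr_ge0 ?mulr_ge0// invr_ge0 subr_ge0 ltW.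
Qed.

Section bound.
Variables (gam beta A rho0 : R) (w : 'rV[R]_n -> R) (w_ D_ : nat -> 'rV[R]_n -> R).
Notation rho := (dyad rho0).
Hypotheses (gam0 : 0 < gam) (beta01 : 0 < beta <= 1) (gb : 0 < gam + beta - 1)
  (A0 : 0 <= A) (rho0_gt0 : 0 < rho0) (Iw : L1 w).
Hypotheses (lw_ : forall k, lipf (w_ k)) (cw_ : forall k, csupp (w_ k))
  (w0 : \int[lam]_x `|w_ 0%N x| <= A * rho0 `^ gam)
  (ww_ : forall k, \int[lam]_x `|w x - w_ k x| <= A * rho k `^ gam)
  (ID : forall k, L1 (D_ k)) (wD : forall k x j, `|pd j (w_ k) x| <= D_ k x)
  (Dle : forall k, \int[lam]_x D_ k x <= A * rho k `^ (gam - 1)).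

Let rho_gt0 k : 0 < rho k. Proof. exact: dyad_gt0. Qed.

Let Iw_ k : L1 (w_ k). Proof. exact: lipf_csupp_L1. Qed.

Let sum_bound K : A * rho0 `^ gam * rho0 `^ (beta - 1) +
  \sum_(k < K) (2 * A * rho k `^ gam * rho k `^ (beta - 1) +
     n`!%:R * A * rho k `^ (gam - 1) * rho k `^ beta) <=
  A * rho0 `^ (gam + beta - 1) *
    (1 + (2 + n`!%:R) / (1 - (2 : R) `^ (- (gam + beta - 1)))).
Proof.
set g := gam + beta - 1; set q := (2 : R) `^ (- g).
have q01 : 0 <= q < 1 by exact: half_powR_lt1.
have E1 r : 0 < r -> r `^ gam * r `^ (beta - 1) = r `^ g.
  by move=> r0; rewrite -powR_add// addrA.
have E2 r : 0 < r -> r `^ (gam - 1) * r `^ beta = r `^ g.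
  by move=> r0; rewrite -powR_add// addrAC.
rewrite mulrDr mulr1 -mulrA E1// lerD2l.
rewrite (eq_bigr (fun k : 'I_K => A * rho0 `^ g * (2 + n`!%:R) * q ^+ k)); last first.
  move=> k _; rewrite -!mulrA E1// E2// dyad_powR//.
  by rewrite /q; ring.
rewrite -mulr_sumr mulrA ler_wpM2l//; last exact: geometric_sum_le.
rewrite mulr_ge0 ?mulr_ge0 ?powR_ge0// addr_ge0//.
Qed.

(** Approximation to order [rho^gam] in L^1 with gradients of order [rho^(gam-1)] makes both
    telescoping terms of order [rho^(gam+beta-1)], a convergent geometric series exactly because the
    exponent is positive. *)
Lemma interpolation_bound G (l : 'I_m -> R) f (L : R) :
  (forall i, lipf (G i)) -> (forall i, 0 <= l i) ->
  (forall i, is_lip (l i) (G (lift ord0 i))) -> lipf f -> 0 <= L ->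
  hoelder_fun beta L f ->
  `|pairing G w f| <= interp_const (gam + beta - 1) * A * rho0 `^ (gam + beta - 1) * L *
    \prod_i l i.
Proof.
move=> lG l0 Gl lf L0 fL.
have w_w : \int[lam]_x `|w x - w_ k x| @[k --> \oo] --> (0 : R).
  apply/cvgrPdist_le => e e0.
  have [N HN] : exists N, forall k, (N <= k)%N -> A * rho k `^ gam <= e.
    have A1 : 0 < A + 1 by rewrite ltr_wpDl.
    have d0 : 0 < (e / (A + 1)) `^ gam^-1 by rewrite powR_gt0// divr_gt0.
    have [N HN] := dyad_small rho0_gt0 d0; exists N => k /HN kd.
    have : rho k `^ gam <= e / (A + 1).
      have -> : e / (A + 1) = ((e / (A + 1)) `^ gam^-1) `^ gam.
        by rewrite -powRrM mulVf ?gt_eqF// powRr1// divr_ge0 ?ltW.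
      by apply: powR_mono => //; [exact: ltW|exact: ltW].
    rewrite ler_pdivlMr// mulrC => H; apply: le_trans H.
    by rewrite ler_wpM2r ?powR_ge0// lerDl.
  exists N => // k /= /HN; rewrite sub0r normrN ger0_norm; last exact: Rintegral_ge0.
  exact: le_trans (ww_ k).
have wa k : \int[lam]_x `|w_ k.+1 x - w_ k x| <= 2 * A * rho k `^ gam.
  have I1 : L1 (fun x => `|w x - w_ k.+1 x|) by apply: L1_norm; exact: L1B.
  have I2 : L1 (fun x => `|w x - w_ k x|) by apply: L1_norm; exact: L1B.
  apply: (@le_trans _ _ (\int[lam]_x (`|w x - w_ k.+1 x| + `|w x - w_ k x|))).
    apply: le_Rintegral => //; first by apply: L1_norm; exact: L1B.
      exact: L1D.
    by move=> x _; rewrite (distrC (w x) (w_ k.+1 x)) ler_distD.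
  rewrite RintegralD//; apply: le_trans (lerD (ww_ k.+1) (ww_ k)) _.
  have : A * rho k.+1 `^ gam <= A * rho k `^ gam.
    rewrite ler_wpM2l//; apply: powR_mono; [exact: ltW|exact: ltW|].
    by rewrite dyadS ler_pdivrMr// ler_peMr ?(ltW (rho_gt0 k))// ler1n.
  by rewrite -[2 * A * _]mulrA; lra.
have b0 k : 0 <= n`!%:R * A * rho k `^ (gam - 1) by rewrite !mulr_ge0// powR_ge0.
have wb k F b : 0 <= b -> (forall x, `|F x| <= b) -> is_lip (b / rho k) F ->
    `|pairing G (w_ k) F| <= b * (n`!%:R * A * rho k `^ (gam - 1)) * \prod_i l i.
  move=> bge0 Fb Fl.
  have lF : lipf F by exists (b / rho k) => //; rewrite divr_ge0// ltW.
  apply: le_trans (pairing_le_sup lG l0 Gl (lw_ k) (cw_ k) lF Fb (ID k) (@wD k)) _.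
  rewrite (_ : b * _ * _ = n`!%:R * b * (\prod_i l i) * (A * rho k `^ (gam - 1))); last by ring.
  by rewrite ler_wpM2l// !mulr_ge0// prodr_ge0.
have := telescoping_bound lG l0 Gl beta01 L0 fL lf rho0_gt0 Iw Iw_ w_w w0 wa b0 wb sum_bound.
move/le_trans; apply; rewrite /interp_const.
rewrite [leRHS](_ : _ = (2 * n`!%:R + 3) * L * (A * rho0 `^ (gam + beta - 1) *
  (1 + (2 + n`!%:R) / (1 - 2 `^ (- (gam + beta - 1))))) * \prod_i l i)//.
by ring.
Qed.

End bound.
End interpolation.

(** * Open sets with small boundary *)

Section boundary_covers.
Context {R : realType} {n : nat}.
Implicit Types (U A : set 'rV[R]_n) (x y z : 'rV[R]_n).
Notation lam := (@lebesgue_rV R n).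

Lemma near_rV_ball x (r : R) (P : set 'rV[R]_n) : 0 < r ->
  (forall y, `|x - y| < r -> P y) -> \forall y \near x, P y.
Proof.
move=> r0 H; apply: (@filterS _ _ (nbhs_filter x)) (nbhsx_ballx x r r0) => y.
by rewrite -ball_normE /=; exact: H.
Qed.

Lemma compact_cube (M : R) : compact (cube M : set 'rV[R]_n).
Proof.
have [M0|M0] := leP 0 M; last by rewrite cube_lt0//; exact: compact0.
rewrite cubeE//; apply: rV_compact => i; exact: segment_compact.
Qed.

(** [s] is the supremum of the parameters for which the segment is in [U]. The point there is a
    limit of points of [U]; it is not in [U], since otherwise [s < 1] and openness would give a
    larger parameter. *)
Lemma boundary_crossing U x z : open U -> U x -> ~ U z ->
  exists2 s : R, 0 <= s <= 1 & boundary U (x + s *: (z - x)).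
Proof.
move=> oU Ux nUz; pose p (t : R) := x + t *: (z - x).
have pc t : p t' @[t' --> t] --> p t.
  by apply: cvgD; [exact: cvg_cst|apply: cvgZr_tmp; exact: cvg_id].
pose S := [set t : R | 0 <= t <= 1 /\ U (p t)].
have S0 : S 0 by split; rewrite ?lexx ?ler01// /p scale0r addr0.
have Sub : has_ubound S by exists 1 => t [/andP[]].
have Ssup : has_sup S by split => //; exists 0.
pose s := sup S.
have s0 : 0 <= s by exact: ub_le_sup.
have s1 : s <= 1 by apply: ge_sup; [exists 0|move=> t [/andP[]]].
exists s; first by rewrite s0.
split.
  move=> B /(pc s) /nbhs_ballP[e /= e0 eB].
  have [t St ts] := sup_adherent e0 Ssup.
  exists (p t); split; first by case: St.
  apply: eB; rewrite /ball /= ger0_norm ?subr_ge0.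
    by rewrite ltrBlDr -ltrBlDl.
  exact: ub_le_sup.
move=> /(interior_subset (A := U)) Us.
have s1' : s < 1.
  rewrite lt_neqAle s1 andbT; apply/eqP => s1'; apply: nUz.
  by move: Us; rewrite -/(p s) s1' /p scale1r addrC subrK.
have /(pc s) /nbhs_ballP[e /= e0 eU] : nbhs (p s) U by exact: open_nbhs_nbhs.
pose t := s + Num.min (e / 2) (1 - s).
have d0 : 0 < Num.min (e / 2) (1 - s) by rewrite lt_min divr_gt0// subr_gt0.
have : S t.
  split.
    rewrite /t addr_ge0 ?(ltW d0)//=.
    by rewrite -lerBrDl ge_min lexx orbT.
  apply: eU; rewrite /ball /= /t opprD addrA subrr sub0r normrN gtr0_norm//.
  by rewrite gt_min ltr_pdivrMr// ltr_pMr// ltr1n.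
move=> /(ub_le_sup Sub); rewrite -/s /t gerDl; by rewrite leNgt d0.
Qed.

Lemma cube_covered (M e : R) : 0 < e -> exists k, covers (cube M : set 'rV[R]_n) e k.
Proof.
(* A grid point at maximum distance [h] is at Euclidean distance at most [n h <= e]; the successor
   in the denominator also covers [n = 0]. *)
move=> e0; pose h := e / n.+1%:R.
have h0 : 0 < h by rewrite divr_gt0.
pose K := (Num.truncn (2 * M / h)).+1.
pose T := {ffun 'I_n -> 'I_K}.
pose c (i : 'I_#|{: T}|) : 'rV[R]_n := \row_j (- M + h * (enum_val i j)%:R).
exists #|{: T}|, c => x; rewrite /cube /= => xM.
have xM' j : - M <= x ord0 j <= M by rewrite -ler_norml (le_trans (coord_le_norm _ _)).
have tr0 j : 0 <= (x ord0 j + M) / h.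
  by rewrite divr_ge0 ?(ltW h0)//; have /andP[] := xM' j; lra.
have kK j : (Num.truncn ((x ord0 j + M) / h) < K)%N.
  rewrite ltnS; apply: le_truncn; rewrite ler_pM2r ?invr_gt0//.
  by have /andP[] := xM' j; lra.
pose k : T := [ffun j => Ordinal (kK j)].
exists (enum_rank k) => //=; rewrite /cball /=.
apply: le_trans (enorm_le_norm _) _.
have : `|x - c (enum_rank k)| <= h.
  apply: norm_rV_le => [|j]; first exact: ltW.
  rewrite !mxE enum_rankK ffunE /=.
  have /andP[] := truncn_itv (tr0 j).
  rewrite ltr_pdivrMr// ler_pdivlMr// -natr1.
  move: ((Num.truncn _)%:R) => a; rewrite mulrDl mul1r mulrC => H1 H2.
  rewrite ler_norml; apply/andP; split; lra.
move=> H; apply: (@le_trans _ _ (n%:R * h)); first by rewrite ler_wpM2l.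
rewrite /h mulrCA ger_pMr// ler_pdivrMr// mul1r ler_nat//.
Qed.

Lemma covering_numberP A (M e : R) : A `<=` cube M -> 0 < e ->
  covers A e (covering_number A e).
Proof.
move=> AM e0; have [k [c ck]] := cube_covered M e0.
have ex : exists k, `[< covers A e k >].
  by exists k; apply/asboolP; exists c => x /AM; exact: ck.
rewrite /covering_number.
have : exists k, [set k | covers A e k /\ forall j, covers A e j -> (k <= j)%N] k.
  exists (ex_minn ex); case: ex_minnP => k' /asboolP ck' kmin; split => // j cj.
  by apply: kmin; exact/asboolP.
by move=> /(xgetPex 0%N) [].
Qed.

(** For small [e] the logarithm of the covering number is below [d' ln(1/e)]; restricting to [e < 1]
    makes [ln(1/e)] positive, so that the inequality can be exponentiated. *)
Lemma covering_number_powR A (d d' : R) : box_dim A d -> d < d' ->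
  exists2 e0 : R, 0 < e0 & forall e, 0 < e < e0 ->
    (covering_number A e)%:R <= e `^ (- d').
Proof.
move=> Ad dd'; have : \forall e \near (0 : R)^'+, ln (covering_number A e)%:R / ln e^-1 < d'.
  by apply: (cvgr_lt d Ad).
rewrite near_withinE => /nbhs_ballP[e1 /= e10 He]; exists (Num.min e1 1).
  by rewrite lt_min e10 ltr01.
move=> e /andP[e0]; rewrite lt_min => /andP[ee1 e1'].
have := He e; rewrite /ball /= sub0r normrN gtr0_norm// => /(_ ee1 e0).
have l0 : 0 < ln e^-1 by rewrite ln_gt0// invf_gt1.
rewrite ltr_pdivrMr// => lnN.
(* The number is 0 when [A] is empty, and the logarithm of 0 is a default value. *)
have [->|N0] := eqVneq (covering_number A e) 0%N; first exact: powR_ge0.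
have Npos : 0 < (covering_number A e)%:R :> R by rewrite ltr0n lt0n.
rewrite -[leLHS]lnK ?posrE// /powR gt_eqF//.
by rewrite ler_expR (le_trans (ltW lnN))// lnV ?posrE// mulrN mulNr.
Qed.

Definition supball (c : 'rV[R]_n) (r : R) := [set x : 'rV[R]_n | `|x - c| <= r].

Lemma supballE c (r : R) : 0 <= r ->
  supball c r = rV_box (fun i => `[c ord0 i - r, c ord0 i + r]%classic).
Proof.
move=> r0; apply/seteqP; split => x /=.
  move=> xc i /=; rewrite in_itv/= -ler_distlC distrC.
  by apply: le_trans xc; have := coord_le_norm (x - c) i; rewrite !mxE.
move=> H; apply: norm_rV_le => // i; have := H i; rewrite /= in_itv/= -ler_distlC distrC.
by rewrite !mxE.
Qed.

Lemma measurable_supball c (r : R) : 0 <= r -> measurable (supball c r).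
Proof. by move=> r0; rewrite supballE//; exact: measurable_rV_box. Qed.

Lemma lam_supball c (r : R) : 0 <= r -> lam (supball c r) = ((2 * r) ^+ n)%:E.
Proof.
move=> r0; rewrite supballE// lebesgue_rV_rV_box//.
rewrite (eq_bigr (fun=> (2 * r)%:E)) ?prodEFin ?prodr_const ?card_ord// => i _.
rewrite lebesgue_measure_itv/= lte_fin.
have [->|rn] := eqVneq r 0; first by rewrite subr0 addr0 ltxx mulr0.
have rp : 0 < r by rewrite lt_neqAle eq_sym rn.
rewrite (_ : _ < _); last by lra.
by rewrite -EFinB; congr EFin; ring.
Qed.

Lemma measure_bigsetU_le (I : Type) (s : seq I) (A : I -> set 'rV[R]_n) :
  (forall i, measurable (A i)) ->
  (lam (\big[setU/set0]_(i <- s) A i) <= \sum_(i <- s) lam (A i))%E.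
Proof.
move=> mA; elim: s => [|i s IH]; first by rewrite !big_nil measure0.
rewrite !big_cons; apply: le_trans (measureU2 _ _ _) _ => //.
  by apply: bigsetU_measurable => j _.
by rewrite leeD2l.
Qed.

End boundary_covers.

Section open_sets.
Context {R : realType} {m : nat}.
Notation n := m.+1.
Implicit Types (U A : set 'rV[R]_n) (x y z : 'rV[R]_n).
Notation lam := (@lebesgue_rV R n).

Section cutoff.
Variables (U : set 'rV[R]_n) (rho : R) (V : set 'rV[R]_n).
Hypotheses (oU : open U) (rho0 : 0 < rho)
  (UV : forall x y, boundary U y -> `|x - y| <= 2 * rho -> V x).

(** The minimum of 1 and [1/rho] times the distance to the complement of [U], the constant 1 if the
    complement is empty. *)
Definition cutoff := infconv setT (\1_U : 'rV[R]_n -> R) rho^-1.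

Let lb x z : 0 <= \1_U z + rho^-1 * `|x - z| :> R.
Proof. by rewrite addr_ge0// mulr_ge0// invr_ge0 ltW. Qed.

Let ne : [set: 'rV[R]_n] !=set0. Proof. by exists 0. Qed.

Lemma cutoff_lip : is_lip rho^-1 cutoff.
Proof.
apply: infconv_lip => //; first by rewrite invr_ge0 ltW.
by move=> x; exists 0 => z _; exact: lb.
Qed.

Lemma cutoff_ge0 x : 0 <= cutoff x.
Proof. by apply: infconv_ge => // z _; exact: lb. Qed.

Lemma cutoff_le x : cutoff x <= \1_U x.
Proof.
have := @infconv_le _ _ setT (\1_U : 'rV[R]_n -> R) rho^-1 0 x x (fun z _ => lb x z) I.
by rewrite subrr normr0 mulr0 addr0.
Qed.

(** If exactly one of the two points were in [U], the segment between them would meet the boundary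
    within [2 rho] of [x], so that [x] would lie in [V]. *)
Let constant_near x z : ~ V x -> `|x - z| <= 2 * rho -> U z <-> U x.
Proof.
have seg (a b : 'rV[R]_n) (s : R) : 0 <= s <= 1 -> `|a - (a + s *: (b - a))| <= `|a - b|.
  move=> /andP[s0 s1]; rewrite opprD addrA subrr sub0r normrN normrZ ger0_norm//.
  by rewrite distrC ler_piMl.
move=> nVx xz; split=> H; apply: contrapT => nH.
  have [s /andP[s0 s1] ys] := boundary_crossing oU H nH; apply: nVx; apply: UV ys _.
  have -> : z + s *: (x - z) = x + (1 - s) *: (z - x).
    apply/rowP => i; rewrite !mxE; ring.
  apply: (le_trans (seg x z (1 - s) _) xz); apply/andP; split; lra.
have [s s01 ys] := boundary_crossing oU H nH; apply: nVx; apply: UV ys _.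
exact: (le_trans (seg x z s s01) xz).
Qed.

(** Competitors [z] within [rho] of [y] are within [2 rho] of [x], on the same side of the boundary;
    farther ones cost at least 1. Constancy on a whole ball makes the gradient of the cutoff vanish
    off [V]. *)
Lemma cutoff_far x y : ~ V x -> `|x - y| <= rho -> cutoff y = \1_U x.
Proof.
move=> nVx xy; apply/eqP; rewrite eq_le.
have r2 : rho <= 2 * rho by rewrite ler_peMl ?(ltW rho0)// ler1n.
have Uy : \1_U y = \1_U x :> R.
  have H := constant_near nVx (le_trans xy r2).
  rewrite !indicE; congr (nat_of_bool _)%:R.
  by apply/idP/idP; rewrite !inE => /H.
rewrite -{1}Uy cutoff_le/=; apply: infconv_ge => // z _.
have [yz|yz] := leP `|y - z| rho.
  have H : U z <-> U x.
    apply: constant_near => //; rewrite (le_trans (ler_distD y _ _))//; lra.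
  have -> : \1_U z = \1_U x :> R.
    rewrite !indicE; congr (nat_of_bool _)%:R.
    by apply/idP/idP; rewrite !inE => /H.
  by rewrite lerDl mulr_ge0// invr_ge0 ltW.
apply: (@le_trans _ _ 1); first by have := indic_norm_le1 U x; rewrite ger0_norm.
rewrite -[leLHS]add0r lerD// mulrC ler_pdivlMr// mul1r ltW//.
Qed.

Lemma cutoff_dist x : `|\1_U x - cutoff x| <= \1_V x.
Proof.
rewrite [leRHS]indicE; have [Vx|nVx] := pselect (V x).
  rewrite mem_set// ger0_norm ?subr_ge0 ?cutoff_le//.
  have := cutoff_ge0 x; have := indic_norm_le1 U x; rewrite ger0_norm//=; lra.
by rewrite memNset// (cutoff_far nVx) ?subrr ?normr0// ltW.
Qed.

Lemma cutoff_pd x j : `|pd j cutoff x| <= rho^-1 * \1_V x.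
Proof.
rewrite indicE; have [Vx|nVx] := pselect (V x).
  rewrite mem_set// mulr1; apply: pd_le; last exact: cutoff_lip.
  by rewrite invr_ge0 ltW.
rewrite memNset// mulr0 normr_le0; apply/eqP.
transitivity (pd j (fun=> \1_U x : R) x); last exact: pd_cst.
apply: pd_near; apply: (near_rV_ball rho0) => y /ltW; exact: cutoff_far.
Qed.

End cutoff.

(** For [d'] midway between [d] and [delta], the [2 rho]-neighbourhood of the boundary has volume of
    order [rho^(n-d')]. This is the approximation order [gam], and
    [gam + beta - 1 = delta - d' > 0]. *)
Lemma BVc_indic_open U (d delta : R) : bounded_set U -> open U ->
  box_dim (boundary U) d -> n%:R - 1 <= d < n%:R -> d < delta <= n%:R ->
  BVc (delta - (n%:R - 1)) (\1_U : 'rV[R]_n -> R).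
Proof.
move=> bU oU dU /andP[nd dn] /andP[ddelta deltan].
set beta := delta - (n%:R - 1).
have beta01 : 0 < beta <= 1 by rewrite /beta; apply/andP; split; lra.
pose d' := (d + delta) / 2.
have dd' : d < d' by rewrite /d'; lra.
have d'delta : d' < delta by rewrite /d'; lra.
pose gam := n%:R - d'.
have gam0 : 0 < gam by rewrite /gam; lra.
have gb : 0 < gam + beta - 1 by rewrite /gam /beta; lra.
have [M UM] : exists M : R, U `<=` cube M.
  have [M [_ HM]] := bU; exists (M + 1) => x Ux.
  by apply: (HM _ _ x Ux); rewrite ltrDl.
have bUM : boundary U `<=` cube M.
  move=> x [clx _]; rewrite /cube /= leNgt; apply/negP => Mx.
  have Mx0 : 0 < `|x| - M by rewrite subr_gt0.
  have [y [Uy]] := clx _ (nbhsx_ballx x _ Mx0).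
  rewrite -ball_normE /= => xy; have := UM _ Uy; rewrite /cube /=.
  have := lerB_dist x y; lra.
have [rho0 rho00 HN] := covering_number_powR dU dd'.
pose r0 := rho0 / 2.
have r00 : 0 < r0 by rewrite divr_gt0.
pose rho := dyad r0.
have rhogt0 k : 0 < rho k by exact: dyad_gt0.
have rhole k : rho k < rho0.
  apply: le_lt_trans (dyad_le k r00) _.
  by rewrite /r0 ltr_pdivrMr// ltr_pMr// ltr1n.
have mU := open_measurable_rV oU.
have Uoo : (lam U < +oo)%E.
  apply: le_lt_trans (lam_cube_lty (R := R) (n := n) M).
  by apply: le_measure; rewrite ?inE//; exact: measurable_cube.
have IU : L1 (\1_U) by exact: L1_indic.
(* At most [rho^(-d')] balls of radius [rho] cover the boundary; concentric cubes of half-side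
   [3 rho] cover its [2 rho]-neighbourhood, each of volume [(6 rho)^n]. *)
have /choice[V VP] k : exists V : set 'rV[R]_n, [/\ measurable V,
    (lam V <= (6 ^+ n * rho k `^ gam)%:E)%E &
    forall x y, boundary U y -> `|x - y| <= 2 * rho k -> V x].
  have [c cU] := covering_numberP bUM (rhogt0 k).
  set N := covering_number _ _ in c cU.
  have r3 : 0 <= 3 * rho k by rewrite mulr_ge0// ltW.
  exists (\big[setU/set0]_(i < N) supball (c i) (3 * rho k)); split.
  - by apply: bigsetU_measurable => i _; exact: measurable_supball.
  - apply: le_trans (@measure_bigsetU_le _ _ _ _ _ _) _.
      by move=> i; exact: measurable_supball.
    rewrite (eq_bigr (fun=> ((2 * (3 * rho k)) ^+ n)%:E)); last first.
      by move=> i _; exact: lam_supball.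
    rewrite sumEFin lee_fin sumr_const card_ord -[leLHS]mulr_natl.
    have -> : (2 * (3 * rho k)) ^+ n = 6 ^+ n * rho k `^ n%:R.
      rewrite powR_mulrn ?(ltW (rhogt0 k))// -exprMn; congr (_ ^+ _); ring.
    have -> : rho k `^ gam = rho k `^ (- d') * rho k `^ n%:R.
      by rewrite -powR_add//; congr (_ `^ _); rewrite /gam addrC.
    rewrite mulrCA ler_wpM2l ?exprn_ge0// ler_wpM2r ?powR_ge0//.
    by apply: HN; rewrite rhogt0 rhole.
  - move=> x y /cU[i _]; rewrite /cball /= => yc xy.
    rewrite -bigcup_seq; exists i; rewrite /= ?mem_index_enum// /supball /=.
    rewrite (le_trans (ler_distD y _ _))//.
    have := norm_le_enorm (y - c i); lra.
have mV k : measurable (V k) by have [] := VP k.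
have Vle k : (lam (V k) <= (6 ^+ n * rho k `^ gam)%:E)%E by have [] := VP k.
have UV k : forall x y, boundary U y -> `|x - y| <= 2 * rho k -> V k x by have [] := VP k.
have IV k : L1 (\1_(V k)) by apply: L1_indic => //; apply: le_lt_trans (Vle k) (ltry _).
have intV k : \int[lam]_x \1_(V k) x <= 6 ^+ n * rho k `^ gam.
  rewrite integral_indicR// -lee_fin fineK// ge0_fin_numE//.
  exact: le_lt_trans (Vle k) (ltry _).
(* The second summand accounts for scale 0, where the mass of the cutoff is bounded by the volume of
   [U]. *)
pose A := 6 ^+ n + fine (lam U) / r0 `^ gam.
have p0 : 0 < r0 `^ gam by exact: powR_gt0.
have A6 : 6 ^+ n <= A by rewrite lerDl divr_ge0 ?fine_ge0// ltW.
have A0 : 0 <= A by apply: le_trans A6; rewrite exprn_ge0.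
pose w k := cutoff U (rho k).
have lw k : lipf (w k).
  by exists (rho k)^-1; [rewrite invr_ge0 ltW|exact: cutoff_lip].
have cw k : csupp (w k).
  exists M => x xM; apply/eqP; rewrite eq_le cutoff_ge0// andbT.
  apply: le_trans (cutoff_le _ _ _) _ => //.
  by rewrite indicE memNset// => /UM; rewrite /cube /= leNgt xM.
have C0 := interp_const_ge0 (R := R) (m := m) gb.
have K0 : compact (cube M : set (matrix R 1 n)) by exact: compact_cube.
have KU x : ~ cube M x -> \1_U x = 0 :> R.
  by move=> nx; rewrite indicE memNset// => /UM.
have X0 : 0 <= interp_const (R := R) (m := m) (gam + beta - 1) * A * r0 `^ (gam + beta - 1).
by rewrite mulr_ge0 ?powR_ge0// mulr_ge0.
have beta01' : 0 <= beta <= 1 by case/andP: beta01 => /ltW -> ->.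
apply: (BVc_intro beta01' IU X0 K0 KU).
move=> G l f L lG l0 Gl lf L0 fL.
apply: (@interpolation_bound _ _ gam beta A r0 (\1_U) w
  (fun k x => (rho k)^-1 * \1_(V k) x)) => //.
- apply: (@le_trans _ _ (\int[lam]_x \1_U x)).
    apply: le_Rintegral => //; first by apply: L1_norm; exact: lipf_csupp_L1.
    by move=> x _; rewrite ger0_norm ?cutoff_ge0// cutoff_le.
  rewrite integral_indicR// /A mulrDl mulfVK ?gt_eqF// lerDr.
  by rewrite mulr_ge0 ?exprn_ge0// ltW.
- move=> k; apply: (@le_trans _ _ (\int[lam]_x \1_(V k) x)).
    apply: le_Rintegral; first exact: measurableT.
    - apply: L1_norm; apply: L1B; first exact: IU.
      exact: lipf_csupp_L1 (lw k) (cw k).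
    - exact: IV k.
    - by move=> x _; exact: (cutoff_dist oU (rhogt0 k) (UV k) x).
  by rewrite (le_trans (intV k))// ler_wpM2r// powR_ge0.
- by move=> k; exact: L1Z.
- by move=> k x j; apply: cutoff_pd => //; exact: UV.
- move=> k; rewrite RintegralZl//; last exact: IV k.
  rewrite powRB1// mulrA mulrC ler_wpM2r ?invr_ge0 ?(ltW (rhogt0 k))//.
  by rewrite (le_trans (intV k))// ler_wpM2r// powR_ge0.
Qed.

End open_sets.

(** * Hoelder functions on balls *)

Section balls.
Context {R : realType} {m : nat}.
Notation n := m.+1.
Implicit Types (x y z : 'rV[R]_n) (r rho : R).
Notation lam := (@lebesgue_rV R n).

Lemma measurable_enorm x : measurable_fun setT (fun y => enorm (y - x)).
Proof. by apply: (@is_lip_measurable _ _ n%:R) => //; exact: enorm_lip. Qed.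

Lemma measurable_cball x r : measurable (cball x r).
Proof.
have := measurable_enorm x measurableT (measurable_itv `]-oo, r]).
by rewrite setTI; congr measurable; apply/seteqP; split => y; rewrite /= in_itv.
Qed.

(* The factor [2] keeps the complement of the shell a neighbourhood of every
   point where [ramp] is constant, while the shell is a difference of closed
   balls. *)
Definition shell x r rho := [set y | r - 2 * rho < enorm (y - x) <= r].

Lemma shellE x r rho : shell x r rho = cball x r `\` cball x (r - 2 * rho).
Proof.
apply/seteqP; split => y /=; rewrite /cball /shell /=.
  by move=> /andP[H1 H2]; split => //; apply/negP; rewrite -ltNge.
by move=> [-> /negP]; rewrite -ltNge => ->.
Qed.

Lemma measurable_shell x r rho : measurable (shell x r rho).
Proof. by rewrite shellE; apply: measurableD; exact: measurable_cball. Qed.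

Lemma cball_cube r : cball (0 : 'rV[R]_n) r `<=` cube r.
Proof.
by move=> y; rewrite /cball /cube /= subr0; apply: le_trans; exact: norm_le_enorm.
Qed.

Lemma lam_cball_lty r : (lam (cball 0 r) < +oo)%E.
Proof.
apply: le_lt_trans (lam_cube_lty (R := R) (n := n) r).
by apply: le_measure; rewrite ?inE; [exact: measurable_cball|exact: measurable_cube|exact: cball_cube].
Qed.

Definition ball_vol := fine (lam (cball 0 1)).

Lemma ball_vol_ge0 : 0 <= ball_vol. Proof. exact: fine_ge0. Qed.

Lemma lam_cball r : 0 < r -> lam (cball 0 r) = (r ^+ n * ball_vol)%:E.
Proof.
move=> r0; have <- := lebesgue_rV_affine 0 r0 (measurable_cball 0 r).
rewrite EFinM /ball_vol fineK; last by rewrite ge0_fin_numE// lam_cball_lty.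
congr (_ * lam _)%E; apply/seteqP; split => y; rewrite /cball /rV_affine /= add0r !subr0;
  by rewrite (enormZ _ (ltW r0)) ger_pMr.
Qed.

Lemma L1_cball r : L1 (\1_(cball 0 r) : 'rV[R]_n -> R).
Proof. by apply: L1_indic; [exact: measurable_cball|exact: lam_cball_lty]. Qed.

Lemma integral_cball r : 0 < r -> \int[lam]_y \1_(cball 0 r) y = r ^+ n * ball_vol.
Proof. by move=> r0; rewrite integral_indicR ?lam_cball//; exact: measurable_cball. Qed.

Lemma L1_shell r rho : L1 (\1_(shell 0 r rho) : 'rV[R]_n -> R).
Proof.
apply: L1_indic; first exact: measurable_shell.
apply: le_lt_trans (lam_cball_lty r).
apply: le_measure; rewrite ?inE; [exact: measurable_shell|exact: measurable_cball|].
by rewrite shellE; exact: subDsetl.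
Qed.

Lemma expr_diff_le (k : nat) r (s : R) : 0 <= s <= r ->
  r ^+ k.+1 - s ^+ k.+1 <= k.+1%:R * (r - s) * r ^+ k.
Proof.
move=> /andP[s0 sr]; elim: k => [|k IH]; first by rewrite !expr1 expr0; lra.
have -> : r ^+ k.+2 - s ^+ k.+2 = (r - s) * r ^+ k.+1 + s * (r ^+ k.+1 - s ^+ k.+1).
  by rewrite !exprS; ring.
have -> : k.+2%:R * (r - s) * r ^+ k.+1 =
    (r - s) * r ^+ k.+1 + k.+1%:R * (r - s) * r ^+ k.+1.
  by rewrite -[k.+2%:R]natr1; ring.
rewrite lerD2l.
have r0 := le_trans s0 sr.
apply: (@le_trans _ _ (r * (r ^+ k.+1 - s ^+ k.+1))).
  by rewrite ler_wpM2r// subr_ge0 lerXn2r ?nnegrE.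
by rewrite [r ^+ k.+1 in leRHS]exprS [leRHS]mulrCA ler_wpM2l.
Qed.

Lemma integral_shell r rho : 0 < rho <= r ->
  \int[lam]_y \1_(shell 0 r rho) y <= 2 * n%:R * rho * r ^+ m * ball_vol.
Proof.
move=> /andP[rho0 rr]; have r0 := lt_le_trans rho0 rr.
have b0 := ball_vol_ge0.
have n1 : 1 <= n%:R :> R by rewrite ler1n.
have rm : 0 <= r ^+ m by rewrite exprn_ge0// ltW.
have -> : \int[lam]_y \1_(shell 0 r rho) y =
    \int[lam]_y (\1_(cball 0 r) y - \1_(cball 0 (r - 2 * rho)) y).
  apply: eq_Rintegral => y _; rewrite shellE setDE indicI indicC /= !indicE.
  have [|] := pselect (cball 0 (r - 2 * rho) y) => H; last first.
    by rewrite (memNset H) /= mulr1 subr0.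
  rewrite (mem_set H) mem_set /= ?subrr ?mulr0//.
  by move: H; rewrite /cball /= => /le_trans; apply; lra.
rewrite RintegralB//; [|exact: L1_cball|exact: L1_cball].
rewrite integral_cball//.
(* For a thick shell the inner ball degenerates; the whole ball has volume [r^n] times [ball_vol],
   and [r <= 2 rho]. *)
have [s0|s0] := leP (r - 2 * rho) 0.
  apply: (@le_trans _ _ (r ^+ n * ball_vol)).
    rewrite gerBl; apply: Rintegral_ge0 => y _; rewrite indicE//.
  rewrite ler_wpM2r// exprS ler_wpM2r//.
  apply: (@le_trans _ _ (2 * rho)); first by lra.
  by rewrite -mulrA ler_wpM2l// ler_peMl// ltW.
rewrite integral_cball// -mulrBl ler_wpM2r//.
have sr : 0 <= r - 2 * rho <= r by apply/andP; split; lra.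
have := expr_diff_le m sr; congr (_ <= _); ring.
Qed.

End balls.

Section ramp.
Context {R : realType} {m : nat}.
Notation n := m.+1.
Notation lam := (@lebesgue_rV R n).
Variables (x : 'rV[R]_n) (r rho : R).
Hypothesis rho0 : 0 < rho.
Implicit Types (y z : 'rV[R]_n).

(** The truncation of [(r - |y - x|) / rho] to [[0, 1]], written with positive parts only so that
    [is_lip_max0] applies. *)
Definition ramp y := Num.max 0 (1 - Num.max 0 (1 - rho^-1 * (r - enorm (y - x)))).

Lemma ramp_ge0 y : 0 <= ramp y. Proof. by rewrite le_max lexx. Qed.

Lemma ramp_le1 y : ramp y <= 1.
Proof. by rewrite ge_max ler01/= lerBlDr lerDl le_max lexx. Qed.

Lemma ramp_lip : is_lip (n%:R / rho) ramp.
Proof.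
rewrite /ramp; apply: is_lip_max0; rewrite -[n%:R / rho]add0r.
apply: is_lipB; first exact: is_lip_cst.
apply: is_lip_max0; rewrite -[n%:R / rho]add0r.
apply: is_lipB; first exact: is_lip_cst.
rewrite (_ : n%:R / rho = `|rho^-1| * (0 + n%:R)); last first.
  by rewrite add0r ger0_norm ?invr_ge0 ?ltW// mulrC.
apply: is_lipZ; apply: is_lipB; first exact: is_lip_cst.
exact: enorm_lip.
Qed.

Lemma lipf_ramp : lipf ramp.
Proof. by exists (n%:R / rho); [rewrite divr_ge0// ltW|exact: ramp_lip]. Qed.

Lemma ramp0 y : r <= enorm (y - x) -> ramp y = 0.
Proof.
move=> ry; have : rho^-1 * (r - enorm (y - x)) <= 0.
  by rewrite pmulr_rle0 ?invr_gt0// subr_le0.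
rewrite /ramp; move: (rho^-1 * _) => t t0.
have t1 : 0 <= 1 - t by lra.
by rewrite (max_r t1) max_l//; lra.
Qed.

Lemma ramp1 y : enorm (y - x) <= r - rho -> ramp y = 1.
Proof.
move=> ry; have : 1 <= rho^-1 * (r - enorm (y - x)).
  by rewrite mulrC ler_pdivlMr// mul1r; lra.
rewrite /ramp; move: (rho^-1 * _) => t t0.
have t1 : 1 - t <= 0 by lra.
by rewrite (max_l t1) subr0 max_r.
Qed.

Lemma csupp_ramp : csupp ramp.
Proof.
exists (`|x| + r) => y yr; apply: ramp0; apply: le_trans (norm_le_enorm _).
by have := lerB_dist y x; lra.
Qed.

Lemma ramp_cases y : [\/ shell x r rho y,
  ~ cball x r y /\ \forall z \near y, ramp z = 0 |
  cball x r y /\ \forall z \near y, ramp z = 1].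
Proof.
have n0 : 0 < n%:R :> R by [].
have [ry|ry] := ltP r (enorm (y - x)).
  constructor 2; split; first by apply/negP; rewrite -ltNge.
  have d0 : 0 < (enorm (y - x) - r) / n%:R by rewrite divr_gt0// subr_gt0.
  apply: (near_rV_ball d0) => z; rewrite ltr_pdivlMr// => yz; apply: ramp0.
  by have := enorm_lip x y z; rewrite mulrC ler_norml => /andP[_]; lra.
have [sy|sy] := ltP (r - 2 * rho) (enorm (y - x)); first by constructor 1; apply/andP.
constructor 3; split => //; apply: (near_rV_ball (divr_gt0 rho0 n0)) => z.
rewrite ltr_pdivlMr// => yz; apply: ramp1.
by have := enorm_lip x y z; rewrite mulrC ler_norml => /andP[]; lra.
Qed.

Lemma ramp_indic y : `|\1_(cball x r) y - ramp y| <= \1_(shell x r rho) y.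
Proof.
rewrite !indicE; have [sy|[By /(@nbhs_singleton _ _ _) ->]|[By /(@nbhs_singleton _ _ _) ->]] := ramp_cases y.
- have By : cball x r y by move: sy => /andP[].
  rewrite (mem_set sy) (mem_set By) ger0_norm ?subr_ge0 ?ramp_le1//.
  by rewrite gerBl ramp_ge0.
- by rewrite (memNset By) subrr normr0.
- by rewrite (mem_set By) subrr normr0.
Qed.

Lemma ramp_pd y j : `|pd j ramp y| <= n%:R / rho * \1_(shell x r rho) y.
Proof.
have c0 : 0 <= n%:R / rho by rewrite divr_ge0// ltW.
rewrite indicE; have [sy|[By ny]|[By ny]] := ramp_cases y.
- by rewrite (mem_set sy) mulr1; apply: pd_le => //; exact: ramp_lip.
- by rewrite (pd_near j ny) pd_cst normr0 mulr_ge0.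
- by rewrite (pd_near j ny) pd_cst normr0 mulr_ge0.
Qed.

Lemma ramp_out y : ~ cball x r y -> ramp y = 0.
Proof. by move=> /negP; rewrite -ltNge => /ltW; exact: ramp0. Qed.

End ramp.

Section hoelder_ball.
Context {R : realType} {m : nat}.
Notation n := m.+1.
Notation lam := (@lebesgue_rV R n).
Variables (r alpha beta L M c : R) (u : 'rV[R]_n -> R).
Hypotheses (r0 : 0 < r) (alpha01 : 0 < alpha <= 1) (L0 : 0 <= L) (M0 : 0 <= M)
  (mu : measurable_fun setT u)
  (uL : forall x y, cball 0 r x -> cball 0 r y -> `|u x - u y| <= L * `|x - y| `^ alpha)
  (uM : forall x, cball 0 r x -> `|u x - c| <= M).
Implicit Types (x y z : 'rV[R]_n).

Notation B := (cball (0 : 'rV[R]_n) r).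
Notation w := (fun y => (u y - c) * \1_B y).

Let B0 : B 0.
Proof.
rewrite /cball /= subrr /enorm big1 ?sqrtr0 ?ltW// => i _.
by rewrite mxE expr0n.
Qed.

Section scale.
Variable rho : R.
Hypothesis rho0 : 0 < rho.

Let v := infconv B u (L * rho `^ (alpha - 1)).

Let lb x z : B z -> c - M <= u z + L * rho `^ (alpha - 1) * `|x - z|.
Proof.
move=> Bz; have := uM Bz; rewrite ler_norml => /andP[H _].
have : 0 <= L * rho `^ (alpha - 1) * `|x - z| by rewrite !mulr_ge0// powR_ge0.
by move: H; lra.
Qed.

Let v_lip : is_lip (L * rho `^ (alpha - 1)) v.
Proof.
apply: infconv_lip; [by rewrite mulr_ge0// powR_ge0|by exists 0|].
by move=> x; exists (c - M) => z; exact: lb.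
Qed.

Let v_near x : B x -> `|u x - v x| <= L * rho `^ alpha.
Proof.
move=> Bx; have := infconv_le (fun z => @lb x z) Bx.
rewrite subrr normr0 mulr0 addr0 -/v => vu.
rewrite ger0_norm ?subr_ge0//.
suff : u x - L * rho `^ alpha <= v x by lra.
apply: infconv_ge; first by exists 0.
move=> z Bz; have := uL Bx Bz; rewrite ler_norml => /andP[_ H].
have := ler_wpM2l L0 (powR_split alpha01 (normr_ge0 (x - z)) rho0).
by rewrite mulrDr mulrA; move: H; lra.
Qed.

(** [v] is an inf-convolution over the ball alone, so only the restriction of [u] counts. The
    constant [c] is 0 when [u] itself is restricted and [u x] when its oscillation is estimated. *)
Definition ball_approx y := ramp 0 r rho y * (v y - c).

Definition ball_grad y := L * rho `^ (alpha - 1) * \1_B y +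
  n%:R / rho * (M + L * rho `^ alpha) * \1_(shell 0 r rho) y.

Lemma lipf_ball_approx : lipf ball_approx.
Proof.
apply: lipfM; [exact: lipf_ramp|exact: csupp_ramp|].
exists (L * rho `^ (alpha - 1) + 0); first by rewrite addr0 mulr_ge0// powR_ge0.
by apply: is_lipB => //; exact: is_lip_cst.
Qed.

Lemma csupp_ball_approx : csupp ball_approx.
Proof. by apply: csuppM; exact: csupp_ramp. Qed.

Lemma ball_approx_dist y : `|w y - ball_approx y| <=
  L * rho `^ alpha * \1_B y + M * \1_(shell 0 r rho) y.
Proof.
have s0 : 0 <= \1_(shell 0 r rho) y :> R by rewrite indicE.
rewrite /ball_approx; have [By|nBy] := pselect (B y); last first.
  by rewrite (ramp_out rho0 nBy) indicE (memNset nBy) !mulr0 mul0r subrr normr0 add0r mulr_ge0.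
have H1 := ramp_indic 0 r rho0 y.
have t0 := ramp_ge0 0 r rho y; have t1 := ramp_le1 0 r rho y.
rewrite indicE (mem_set By) in H1; rewrite [\1_B y]indicE (mem_set By).
have H2 := v_near By; have H3 := uM By.
move: (ramp 0 r rho y) (\1_(shell 0 r rho) y) (L * _) t0 t1 H1 H2 s0 => t s b t0 t1 H1 H2 s0.
have -> : (u y - c) * 1 - t * (v y - c) = (u y - v y) * t + (u y - c) * (1 - t) by ring.
apply: le_trans (ler_normD _ _) _; rewrite !normrM mulr1; apply: lerD.
  by rewrite (ger0_norm t0) (le_trans _ H2)// ler_piMr.
by apply: ler_pM.
Qed.

Lemma ball_approx_le y : rho <= r -> `|ball_approx y| <= (M + L * r `^ alpha) * \1_B y.
Proof.
move=> rr; rewrite /ball_approx; have [By|nBy] := pselect (B y); last first.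
  by rewrite (ramp_out rho0 nBy) indicE (memNset nBy) !mulr0 mul0r normr0.
have t0 := ramp_ge0 0 r rho y; have t1 := ramp_le1 0 r rho y.
rewrite indicE (mem_set By) mulr1 normrM (ger0_norm t0).
have H2 := v_near By; have H3 := uM By.
have /andP[a0 _] := alpha01.
have H4 : L * rho `^ alpha <= L * r `^ alpha.
  by rewrite ler_wpM2l// powR_mono// ltW.
apply: le_trans (_ : `|v y - c| <= _); first by rewrite ler_piMl.
have -> : v y - c = (u y - c) - (u y - v y) by ring.
by rewrite (le_trans (ler_normB _ _))// lerD// (le_trans H2).
Qed.

Lemma ball_approx_pd y j : `|pd j ball_approx y| <= ball_grad y.
Proof.
have a0 : 0 <= L * rho `^ (alpha - 1) by rewrite mulr_ge0// powR_ge0.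
have b0 : 0 <= n%:R / rho * (M + L * rho `^ alpha).
  by rewrite mulr_ge0 ?divr_ge0 ?addr_ge0 ?mulr_ge0 ?powR_ge0// ltW.
have g0 : 0 <= ball_grad y by rewrite addr_ge0// mulr_ge0// indicE.
have K0 : 0 <= n%:R / rho by rewrite divr_ge0// ltW.
(* A discrete product rule: differentiability of the factors at [y] is not known, so the product is
   estimated as a function that is Lipschitz relative to [y], and [pd_local_le] concludes. *)
have main : B y -> (\forall z \near y,
    `|ramp 0 r rho z - ramp 0 r rho y| <= n%:R / rho * \1_(shell 0 r rho) y * `|z - y|) ->
  `|pd j ball_approx y| <= ball_grad y.
  move=> By ny; apply: pd_local_le => //.
  apply: (@filterS _ _ (nbhs_filter y)) ny => z zy; rewrite /ball_grad /ball_approx.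
  rewrite [\1_B y]indicE (mem_set By) mulr1.
  have t0 := ramp_ge0 0 r rho z; have t1 := ramp_le1 0 r rho z.
  have H2 := v_near By; have H3 := uM By; have H4 := v_lip z y.
  have H5 : `|v y - c| <= M + L * rho `^ alpha.
    have -> : v y - c = (u y - c) - (u y - v y) by ring.
    by rewrite (le_trans (ler_normB _ _))// lerD.
  have -> : ramp 0 r rho z * (v z - c) - ramp 0 r rho y * (v y - c) =
    ramp 0 r rho z * (v z - v y) + (ramp 0 r rho z - ramp 0 r rho y) * (v y - c) by ring.
  rewrite [leRHS]mulrDl (le_trans (ler_normD _ _))// lerD//.
    by rewrite normrM (ger0_norm t0) (le_trans _ H4)// ler_piMl.
  rewrite normrM; apply: le_trans (ler_pM (normr_ge0 _) (normr_ge0 _) zy H5) _.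
  by rewrite le_eqVlt; apply/orP; left; apply/eqP; ring.
have [sy|[By ny]|[By ny]] := ramp_cases 0 r rho0 y.
- apply: main; first by move: sy => /andP[].
  apply: (@filterE _ _ (nbhs_filter y)) => z; rewrite indicE (mem_set sy) mulr1.
  exact: ramp_lip.
- have -> : pd j ball_approx y = 0; last by rewrite normr0.
  rewrite -(pd_cst j 0 y); apply: pd_near.
  by apply: (@filterS _ _ (nbhs_filter y)) ny => z zy; rewrite /ball_approx zy mul0r.
- apply: main => //; apply: (@filterS _ _ (nbhs_filter y)) (ny) => z ->.
  rewrite (@nbhs_singleton _ _ _ ny) subrr normr0; apply: mulr_ge0 => //.
  by apply: mulr_ge0 => //; rewrite indicE.
Qed.

End scale.

(** The 1 stands for the bulk of the ball, and [2 n^2] for the slope [n / rho] of the ramp times the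
    factor [2 n rho] in the volume of the shell. *)
Definition ball_const : R := (1 + n%:R ^+ 2 * 2) * ball_vol (R := R) (m := m).

Let A := ball_const * (M + L * r `^ alpha) * r `^ (n%:R - alpha).

Lemma ball_const_ge0 : 0 <= ball_const.
Proof. by rewrite mulr_ge0 ?ball_vol_ge0// addr_ge0// mulr_ge0// exprn_ge0. Qed.

Let mw : measurable_fun setT w.
Proof.
apply: measurable_funM; first exact: measurable_funB.
by apply: measurable_indic; exact: measurable_cball.
Qed.

Lemma L1_hoelder_ball : L1 w.
Proof.
apply: (@L1_le _ _ _ (fun y => M * \1_B y)) => //; last by apply: L1Z; exact: L1_cball.
move=> y; rewrite normrM indicE; have [By|nBy] := pselect (B y).
  by rewrite (mem_set By) normr1 !mulr1; exact: uM.
by rewrite (memNset nBy) normr0 !mulr0.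
Qed.

(** Real algebra isolated from powers: [N] is the dimension, [P = rho^alpha], [rm = r^(n-1)],
    [T = r^alpha], [E = r^(n-alpha)] and [v] the volume of the unit ball. In [alg_grad],
    [Q = rho^(alpha-1)]. *)
Let alg_dist (N rho P rm T E v : R) : 1 <= N -> 0 <= P -> 0 <= T -> 0 <= E -> 0 <= v ->
  rho * rm <= P * E ->
  L * P * (T * E * v) + M * (2 * N * rho * rm * v) <=
  (1 + N ^+ 2 * 2) * v * (M + L * T) * E * P.
Proof.
move=> N1 P0 T0 E0 v0 H.
have N0 : 0 <= N by lra.
have H1 := ler_wpM2l (mulr_ge0 M0 (mulr_ge0 (mulr_ge0 (ler0n R 2) N0) v0)) H.
have NN : N <= N ^+ 2 by rewrite expr2 ler_peMl.
have B1 : 0 <= M * v * E * P by rewrite !mulr_ge0.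
have B2 : 0 <= L * T * v * E * P by rewrite !mulr_ge0.
have H2 := ler_wpM2r B1 NN.
have H3 : 0 <= N ^+ 2 * (L * T * v * E * P) by rewrite mulr_ge0// exprn_ge0.
apply: (@le_trans _ _ (L * T * v * E * P + 2 * (N ^+ 2 * (M * v * E * P)))).
  have -> : L * P * (T * E * v) = L * T * v * E * P by ring.
  rewrite lerD2l.
  have -> : M * (2 * N * rho * rm * v) = M * (2 * N * v) * (rho * rm) by ring.
  apply: (le_trans H1).
  have -> : M * (2 * N * v) * (P * E) = 2 * (N * (M * v * E * P)) by ring.
  by rewrite ler_wpM2l.
have -> : (1 + N ^+ 2 * 2) * v * (M + L * T) * E * P = M * v * E * P + L * T * v * E * P +
   2 * (N ^+ 2 * (M * v * E * P)) + 2 * (N ^+ 2 * (L * T * v * E * P)) by ring.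
lra.
Qed.

Let alg_grad (N rho P Q rm T E v : R) : 1 <= N -> 0 < rho -> 0 <= P -> 0 <= Q -> 0 <= T ->
  0 <= E -> 0 <= v -> rm <= Q * E -> P <= T ->
  L * Q * (T * E * v) + N / rho * (M + L * P) * (2 * N * rho * rm * v) <=
  (1 + N ^+ 2 * 2) * v * (M + L * T) * E * Q.
Proof.
move=> N1 rho0 P0 Q0 T0 E0 v0 H PT.
have N0 : 0 <= N by lra.
have -> : N / rho * (M + L * P) * (2 * N * rho * rm * v) =
  N ^+ 2 * 2 * v * (M + L * P) * rm by field; rewrite gt_eqF.
have H1 : (M + L * P) * rm <= (M + L * T) * (Q * E).
  apply: (@le_trans _ _ ((M + L * P) * (Q * E))).
    by rewrite ler_wpM2l// addr_ge0// mulr_ge0.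
  by rewrite ler_wpM2r ?mulr_ge0// lerD2l ler_wpM2l.
have H2 := ler_wpM2l (mulr_ge0 (mulr_ge0 (exprn_ge0 2 N0) (ler0n R 2)) v0) H1.
have H3 : 0 <= M * v * E * Q by rewrite !mulr_ge0.
rewrite -[X in _ + X <= _]mulrA; apply: le_trans (lerD (lexx _) H2) _.
have -> : (1 + N ^+ 2 * 2) * v * (M + L * T) * E * Q = M * v * E * Q +
  (L * Q * (T * E * v) + N ^+ 2 * 2 * v * ((M + L * T) * (Q * E))) by ring.
lra.
Qed.

(** [interpolation_bound] with [gam = alpha] and initial scale [r]: both the inf-convolution in the
    bulk and the ramp in the shell are within order [rho^alpha] in L^1. *)
Lemma pairing_hoelder_ball G (l : 'I_m -> R) f (Lf : R) : 0 < beta <= 1 ->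
  0 < alpha + beta - 1 ->
  (forall i, lipf (G i)) -> (forall i, 0 <= l i) ->
  (forall i, is_lip (l i) (G (lift ord0 i))) -> lipf f -> 0 <= Lf ->
  hoelder_fun beta Lf f ->
  `|pairing G w f| <= interp_const (R := R) (m := m) (alpha + beta - 1) *
    (ball_const * (M + L * r `^ alpha) * r `^ (n%:R + beta - 1)) * Lf * \prod_i l i.
Proof.
move=> beta01 ab lG l0 Gl lf Lf0 fL.
have /andP[a0 a1] := alpha01.
have rk k := dyad_gt0 k r0; have rr k := dyad_le k r0.
have Y0 : 0 <= M + L * r `^ alpha by rewrite addr_ge0// mulr_ge0// powR_ge0.
have A0 : 0 <= A by apply: mulr_ge0; [apply: mulr_ge0 => //; exact: ball_const_ge0|exact: powR_ge0].
have IB := @L1_cball R m r; have IS rho := @L1_shell R m r rho.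
have n1 : 1 <= n%:R :> R by rewrite ler1n.
have v0 := @ball_vol_ge0 R m.
have rn : r ^+ n = r `^ alpha * r `^ (n%:R - alpha).
  by rewrite -powR_mulrn ?ltW// -powR_add// addrC subrK.
(* Shell terms scale like [rho], not [rho^alpha]. Since [rho <= r] and [alpha <= 1], powers of [rho]
   are traded for powers of [r]. *)
have scale_facts rho : 0 < rho -> rho <= r -> [/\ rho * r ^+ m <= rho `^ alpha * r `^ (n%:R - alpha),
    r ^+ m <= rho `^ (alpha - 1) * r `^ (n%:R - alpha) & rho `^ alpha <= r `^ alpha].
  move=> p0 pr.
  have F3 : r ^+ m <= rho `^ (alpha - 1) * r `^ (n%:R - alpha).
    have -> : r ^+ m = r `^ (alpha - 1) * r `^ (n%:R - alpha).
      rewrite -powR_add// -(powR_mulrn m (ltW r0)); congr (powR _ _).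
      by rewrite -[n%:R]natr1; ring.
    by rewrite ler_wpM2r ?powR_ge0// powR_anti//; lra.
  split => //; last by rewrite powR_mono// ltW.
  have -> : rho `^ alpha = rho * rho `^ (alpha - 1).
    by rewrite powRB1// mulrC divfK// gt_eqF.
  by rewrite -mulrA ler_wpM2l// ltW.
have K1 : ball_vol (R := R) (m := m) <= ball_const.
  by rewrite ler_peMl// lerDl mulr_ge0// exprn_ge0.
have := @interpolation_bound R m alpha beta A r w
  (fun k => ball_approx (dyad r k)) (fun k => ball_grad (dyad r k)) a0 beta01 ab A0 r0
  L1_hoelder_ball (fun k => lipf_ball_approx (rk k)) (fun k => csupp_ball_approx (rk k))
  _ _ _ (fun k x j => ball_approx_pd (rk k) x j) _ G l f Lf lG l0 Gl lf Lf0 fL.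
have -> : interp_const (R := R) (m := m) (alpha + beta - 1) *
    (ball_const * (M + L * r `^ alpha) * r `^ (n%:R + beta - 1)) =
  interp_const (R := R) (m := m) (alpha + beta - 1) * A * r `^ (alpha + beta - 1).
  have -> : r `^ (n%:R + beta - 1) = r `^ (n%:R - alpha) * r `^ (alpha + beta - 1).
    by rewrite -powR_add//; congr (powR _ _); ring.
  by rewrite /A; ring.
apply.
- apply: (@le_trans _ _ (\int[lam]_y ((M + L * r `^ alpha) * \1_B y))).
    apply: le_Rintegral; first exact: measurableT.
    - by apply: L1_norm; apply: lipf_csupp_L1; [exact: lipf_ball_approx|exact: csupp_ball_approx].
    - exact: L1Z.
    - by move=> y _; apply: ball_approx_le.
  rewrite RintegralZl// integral_cball// rn.
  have -> : A * r `^ alpha = ball_const * (M + L * r `^ alpha) *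
    (r `^ alpha * r `^ (n%:R - alpha)) by rewrite /A; ring.
  rewrite [X in _ * X <= _]mulrC [leLHS]mulrCA -[leRHS]mulrA; apply: ler_wpM2r.
    by rewrite !mulr_ge0 ?powR_ge0.
  exact: K1.
- move=> k; have [F2 F3 PT] := scale_facts _ (rk k) (rr k).
  apply: (@le_trans _ _ (\int[lam]_y
      (L * dyad r k `^ alpha * \1_B y + M * \1_(shell 0 r (dyad r k)) y))).
    apply: le_Rintegral; first exact: measurableT.
    - apply: L1_norm; apply: L1B; first exact: L1_hoelder_ball.
      by apply: lipf_csupp_L1; [exact: lipf_ball_approx|exact: csupp_ball_approx].
    - by apply: L1D; exact: L1Z.
    - by move=> y _; apply: ball_approx_dist.
  rewrite RintegralD//; [|exact: L1Z|exact: L1Z].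
  rewrite !RintegralZl//; last exact: IS.
  rewrite integral_cball// rn.
  have rkr : 0 < dyad r k <= r by rewrite rk rr.
  apply: le_trans (lerD (lexx _) (ler_wpM2l M0 (integral_shell rkr))) _.
  rewrite /A /ball_const; apply: alg_dist => //; exact: powR_ge0.
- by move=> k; apply: L1D; exact: L1Z.
- move=> k; have [F2 F3 PT] := scale_facts _ (rk k) (rr k).
  rewrite RintegralD//; [|exact: L1Z|exact: L1Z].
  rewrite !RintegralZl//; last exact: IS.
  rewrite integral_cball// rn.
  have rkr : 0 < dyad r k <= r by rewrite rk rr.
  have N0 : 0 <= n%:R / dyad r k * (M + L * dyad r k `^ alpha).
    rewrite mulr_ge0 ?divr_ge0// ?addr_ge0// ?mulr_ge0 ?powR_ge0//; exact: ltW.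
  apply: le_trans (lerD (lexx _) (ler_wpM2l N0 (integral_shell rkr))) _.
  rewrite /A /ball_const; apply: alg_grad => //; exact: powR_ge0.
Qed.

End hoelder_ball.

Section hoelder_functions.
Context {R : realType} {m : nat}.
Notation n := m.+1.
Implicit Types (u : 'rV[R]_n -> R).

Lemma hoelder_measurable u (alpha L : R) : 0 < alpha -> 0 <= L -> hoelder_fun alpha L u ->
  measurable_fun setT u.
Proof.
move=> a0 L0 uL; apply: continuous_measurable_rV => x.
apply/(@cvgrPdist_le _ _ _ _ (nbhs_filter x)) => e e0.
have d0 : 0 < e / (L + 1) by rewrite divr_gt0// ltr_wpDl.
apply: (@near_rV_ball _ _ x ((e / (L + 1)) `^ alpha^-1)); first exact: powR_gt0.
move=> y /ltW xy /=; apply: le_trans (uL x y) _.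
have H := powR_mono (ltW a0) (normr_ge0 (x - y)) xy.
rewrite -powRrM mulVf ?gt_eqF// (powRr1 (ltW d0)) in H.
apply: le_trans (ler_wpM2l L0 H) _.
by rewrite mulrCA ger_pMr// ler_pdivrMr ?mul1r ?lerDl// ltr_wpDl.
Qed.

Lemma Lip_on_ball_hoelder u (alpha L r : R) : 0 <= alpha <= 1 -> 0 <= L ->
  (Lip_on (cball 0 r) alpha u <= L%:E)%E -> forall x y, cball 0 r x -> cball 0 r y ->
  `|u x - u y| <= n%:R * L * `|x - y| `^ alpha.
Proof.
move=> a01 L0 /(Lip_on_leP _ _ _ L0) H x y Bx By.
have /andP[a0 _] := a01.
apply: le_trans (H x y Bx By) _; rewrite [n%:R * L]mulrC -mulrA ler_wpM2l//.
apply: le_trans (powR_mono a0 (enorm_ge0 _) (enorm_le_norm (x - y))) _.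
by rewrite powRM// ler_wpM2r ?powR_ge0// powR_le_nat.
Qed.

Lemma cball0 (r : R) : 0 <= r -> cball (0 : 'rV[R]_n) r 0.
Proof.
move=> r0; rewrite /cball /= subrr /enorm big1 ?sqrtr0// => i _.
by rewrite mxE expr0n.
Qed.

Lemma Lip_on_ball u (alpha r : R) : is_Lip alpha u -> 0 < r ->
  exists2 L, 0 <= L & Lip_on (cball 0 r) alpha u = L%:E.
Proof.
(* A second point of the ball besides 0, so that the supremum defining [Lip_on] is not [-oo]. *)
move=> ul r0; pose a : 'rV[R]_n := (r / n%:R) *: delta_mx ord0 ord0.
have rn : 0 < r / n%:R by rewrite divr_gt0.
have na : `|a| = r / n%:R by rewrite normrZ norm_delta_mx mulr1 gtr0_norm.
have Ba : cball 0 r a.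
  by rewrite /cball /= subr0 (le_trans (enorm_le_norm _))// na mulrC divfK.
have a0 : (0 : 'rV[R]_n) != a by rewrite eq_sym -normr_gt0 na.
have L0 := Lip_on_ge0 alpha u (cball0 (ltW r0)) Ba a0.
exists (fine (Lip_on (cball 0 r) alpha u)); first exact: fine_ge0.
rewrite fineK// ge0_fin_numE//; apply: le_lt_trans ul.
by apply: ereal_sup_le => _ [x [y [_ _ xy ->]]]; exists x, y.
Qed.

Lemma BVc_hoelder_ball (alpha beta : R) : 0 < alpha <= 1 -> 1 - alpha < beta <= 1 ->
  exists C : R, forall u, is_Lip alpha u -> forall r : R, 0 < r ->
    BVc beta (fun y => u y * \1_(cball 0 r) y) /\
    forall x : 'rV[R]_n, cball 0 r x ->
      (frac_var beta (fun y => ((u y - u x) * \1_(cball 0 r) y)%R) <=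
       (C * r `^ (alpha + beta + n%:R - 1))%:E * Lip_on (cball 0 r) alpha u)%E.
Proof.
move=> alpha01 /andP[ab b1]; have /andP[a0 a1] := alpha01.
have beta01 : 0 < beta <= 1 by apply/andP; split; lra.
have beta01' : 0 <= beta <= 1 by apply/andP; split; lra.
have alpha01' : 0 <= alpha <= 1 by apply/andP; split; lra.
have ab' : 0 < alpha + beta - 1 by lra.
have I0 := interp_const_ge0 (R := R) (m := m) ab'.
have b0 := ball_const_ge0 (R := R) (m := m).
set I := interp_const _ in I0; set b := ball_const in b0.
(* [u] oscillates by at most [2 n L r^alpha] on the ball, of diameter at most [2 r]; adding
   [n L r^alpha] for the regularization gives the factor [3 n], and [n^n] comes from
   [frac_var_le]. *)
exists (I * b * 3 * n%:R * n%:R ^+ n) => u ul r r0.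
have [Lu Lu0 LuE] := is_Lip_real ul.
have mu : measurable_fun setT u.
  apply: (@hoelder_measurable u alpha (n%:R * Lu)) => //; first by rewrite mulr_ge0.
  by apply: Lip_hoelder => //; rewrite LuE.
have [L L0 LE] := Lip_on_ball ul r0.
have nL0 : 0 <= n%:R * L by rewrite mulr_ge0.
have uL : forall x y, cball 0 r x -> cball 0 r y -> `|u x - u y| <= n%:R * L * `|x - y| `^ alpha.
  by apply: Lip_on_ball_hoelder => //; rewrite LE.
have dist2 (x y : 'rV[R]_n) : cball 0 r x -> cball 0 r y -> `|x - y| <= 2 * r.
  rewrite /cball /= !subr0 => Bx By; apply: le_trans (ler_normB _ _) _.
  have := norm_le_enorm x; have := norm_le_enorm y; lra.
have osc x y : cball 0 r x -> cball 0 r y -> `|u x - u y| <= 2 * (n%:R * L * r `^ alpha).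
  move=> Bx By; apply: le_trans (uL _ _ Bx By) _.
  rewrite [leRHS]mulrCA ler_wpM2l//.
  apply: le_trans (powR_mono (ltW a0) (normr_ge0 (x - y)) (dist2 _ _ Bx By)) _.
  by rewrite (powRM _ _ (ltW r0))// ler_wpM2r ?powR_ge0//; exact: (@powR_le_nat _ alpha 1).
have o0 : 0 <= 2 * (n%:R * L * r `^ alpha) by rewrite !mulr_ge0// powR_ge0.
have B0 := cball0 (ltW r0).
split.
  pose M := `|u 0| + 2 * (n%:R * L * r `^ alpha).
  have M0 : 0 <= M by rewrite addr_ge0.
  have uM x : cball 0 r x -> `|u x - 0| <= M.
    move=> Bx; rewrite -(subrK (u 0) (u x)) -addrA addrC.
    apply: le_trans (ler_normD _ _) _; rewrite subr0 lerD//; exact: osc.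
  have -> : (fun y => u y * \1_(cball 0 r) y) = (fun y => (u y - 0) * \1_(cball 0 r) y).
    by apply/funext => y; rewrite subr0.
  have X0 : 0 <= I * (b * (M + n%:R * L * r `^ alpha) * r `^ (n%:R + beta - 1)).
    apply: mulr_ge0 => //; apply: mulr_ge0; last exact: powR_ge0.
  by apply: mulr_ge0 => //; apply: addr_ge0 => //; apply: mulr_ge0 => //; exact: powR_ge0.
  have Iw := L1_hoelder_ball mu uM.
  apply: (BVc_intro beta01' Iw X0 (@compact_cube R n r)).
    move=> x nx; rewrite indicE memNset ?mulr0// => /cball_cube; exact: nx.
  move=> G l f Lf lG l0 Gl lf Lf0 fL.
  exact: (pairing_hoelder_ball r0 alpha01 nL0 M0 mu uL uM beta01 ab' lG l0 Gl lf Lf0 fL).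
move=> x Bx; pose M := 2 * (n%:R * L * r `^ alpha).
have uM y : cball 0 r y -> `|u y - u x| <= M by move=> By; exact: osc.
have X0 : 0 <= I * (b * (M + n%:R * L * r `^ alpha) * r `^ (n%:R + beta - 1)).
  apply: mulr_ge0 => //; apply: mulr_ge0; last exact: powR_ge0.
  by apply: mulr_ge0 => //; apply: addr_ge0 => //; apply: mulr_ge0 => //; exact: powR_ge0.
have := frac_var_le beta01' (L1_hoelder_ball mu uM) X0 _.
have E : I * (b * (M + n%:R * L * r `^ alpha) * r `^ (n%:R + beta - 1)) * n%:R ^+ n =
  I * b * 3 * n%:R * n%:R ^+ n * r `^ (alpha + beta + n%:R - 1) * L.
  have -> : r `^ (alpha + beta + n%:R - 1) = r `^ alpha * r `^ (n%:R + beta - 1).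
    by rewrite -powR_add//; congr (powR _ _); ring.
  by rewrite /M; ring.
rewrite E LE -EFinM; apply.
move=> G l f Lf lG l0 Gl lf Lf0 fL.
exact: (pairing_hoelder_ball r0 alpha01 nL0 o0 mu uL uM beta01 ab' lG l0 Gl lf Lf0 fL).
Qed.

End hoelder_functions.

(** * Restriction to almost every ball *)

(** With [t = |y - z| / rho], the increment is at most [c b] times the minimum of [t] and 1, hence
    at most [c b t^alpha]. The condition [c >= 2] absorbs the trivial bound [2 b]. *)
Lemma bounded_lip_hoelder {R : realType} {m : nat} (f : 'rV[R]_m.+1 -> R) (alpha b c rho : R) :
  0 <= alpha <= 1 -> 0 <= b -> 2 <= c -> 0 < rho -> (forall y, `|f y| <= b) ->
  is_lip (c * b / rho) f -> hoelder_fun alpha (c * b * rho `^ (- alpha)) f.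
Proof.
move=> /andP[a0 a1] b0 c2 rho0 fb fL y z.
have H1 : `|f y - f z| <= c * b * (`|y - z| / rho).
  by rewrite (le_trans (fL y z))// [in leRHS]mulrA mulrAC.
have H2 : `|f y - f z| <= c * b.
  apply: (@le_trans _ _ (2 * b)); last by rewrite ler_wpM2r.
  by apply: le_trans (ler_normB _ _) _; have := fb y; have := fb z; lra.
rewrite powRN -mulrA [_^-1 * _]mulrC.
have -> : `|y - z| `^ alpha / rho `^ alpha = (`|y - z| / rho) `^ alpha.
  rewrite powRM// ?invr_ge0 ?ltW//; congr (_ * _).
  by rewrite -[rho^-1]powR_inv1 ?ltW// -powRrM mulN1r powRN.
have c0 : 0 <= c * b by rewrite mulr_ge0//; lra.
have t0 : 0 <= `|y - z| / rho by rewrite divr_ge0// ltW.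
move: (`|y - z| / rho) t0 H1 => t t0 H1; have [t1|t1] := leP t 1.
  apply: le_trans H1 _; rewrite ler_wpM2l//.
  have [->|tn] := eqVneq t 0; first exact: powR_ge0.
  have tp : 0 < t by rewrite lt_neqAle eq_sym tn.
  by apply: ger1_powR => //; rewrite tp.
apply: le_trans H2 _; rewrite ler_peMr//.
by rewrite -(powRr0 t) ler_powR// ltW.
Qed.

Section cut_ball.
Context {R : realType} {m : nat}.
Notation n := m.+1.
Notation lam := (@lebesgue_rV R n).
Variables (alpha V : R) (u : 'rV[R]_n -> R) (x : 'rV[R]_n) (r : R).
Hypotheses (alpha01 : 0 <= alpha < 1) (Iu : L1 u) (V0 : 0 <= V).
Hypothesis uV : forall G (l : 'I_m -> R) f (L : R), (forall i, lipf (G i)) ->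
  (forall i, 0 <= l i) -> (forall i, is_lip (l i) (G (lift ord0 i))) -> lipf f -> 0 <= L ->
  hoelder_fun alpha L f -> `|pairing G u f| <= V * L * \prod_i l i.
Implicit Types (y z : 'rV[R]_n).

Notation B := (cball x r).

Definition shell_mass rho := \int[lam]_y (`|u y| * \1_(shell x r rho) y).

Let Ish rho : L1 (fun y => `|u y| * \1_(shell x r rho) y).
Proof.
apply: (@L1M _ _ _ _ 1); [exact: L1_norm| |by move=> y; exact: indic_norm_le1].
by apply: measurable_indic; exact: measurable_shell.
Qed.

Lemma shell_mass_ge0 rho : 0 <= shell_mass rho.
Proof. by apply: Rintegral_ge0 => y _; rewrite mulr_ge0// indicE. Qed.

Let Iw : L1 (fun y => u y * \1_B y).
Proof.
apply: (@L1M _ _ _ _ 1) => //; last by move=> y; exact: indic_norm_le1.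
by apply: measurable_indic; exact: measurable_cball.
Qed.

Section scale.
Variable rho : R.
Hypothesis rho0 : 0 < rho.
Notation phi := (ramp x r rho).

Lemma L1_cut : L1 (fun y => u y * phi y).
Proof.
apply: (@L1M _ _ _ _ 1) => //; first exact: lipf_measurable (lipf_ramp _ _ rho0).
by move=> y; rewrite ger0_norm ?ramp_ge0// ramp_le1.
Qed.

Lemma cut_dist : \int[lam]_y `|u y * \1_B y - u y * phi y| <= shell_mass rho.
Proof.
apply: le_Rintegral; first exact: measurableT.
- by apply: L1_norm; apply: L1B; [exact: Iw|exact: L1_cut].
- exact: Ish.
- by move=> y _; rewrite -mulrBr normrM ler_wpM2l// ramp_indic.
Qed.

(** The product has Lipschitz constant [(n + 1) b / rho], with [n] from the ramp and 1 from [F]. *)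
Lemma cut_hoelder F (b : R) : 0 <= b -> (forall y, `|F y| <= b) -> is_lip (b / rho) F ->
  hoelder_fun alpha (n.+1%:R * b * rho `^ (- alpha)) (fun y => phi y * F y).
Proof.
move=> b0 Fb FL; have phi1 w : `|phi w| <= 1 by rewrite ger0_norm ?ramp_ge0// ramp_le1.
apply: bounded_lip_hoelder => //.
- by have /andP[a0 a1] := alpha01; rewrite a0 ltW.
- by rewrite ler_nat.
- by move=> y; rewrite normrM -[leRHS]mul1r; apply: ler_pM.
- apply: is_lip_le (is_lipM (ramp_lip x r rho0) FL phi1 Fb).
  rewrite le_eqVlt; apply/orP; left; apply/eqP; rewrite -[n.+1%:R]natr1; field.
  by rewrite gt_eqF.
Qed.

(** By the product rule, [phi] times the Jacobian of [F] is the Jacobian of [phi F] minus [F] times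
    that of [phi]. The variation of [u] controls the first; the second lives on the shell, where the
    ramp has slope [n / rho]. *)
Lemma pairing_cut G (l : 'I_m -> R) F (b : R) : (forall i, lipf (G i)) ->
  (forall i, 0 <= l i) -> (forall i, is_lip (l i) (G (lift ord0 i))) ->
  0 <= b -> (forall y, `|F y| <= b) -> is_lip (b / rho) F ->
  `|pairing G (fun y => u y * phi y) F| <=
    b * (V * n.+1%:R * rho `^ (- alpha) + n`!%:R * n%:R * (shell_mass rho / rho)) *
    \prod_i l i.
Proof.
move=> lG l0 Gl b0 Fb FL; have bp : 0 <= b / rho by rewrite divr_ge0// ltW.
have lF : lipf F by exists (b / rho).
have lp : lipf phi by exact: lipf_ramp.
have lpF : lipf (fun y => phi y * F y) by apply: lipfM => //; exact: csupp_ramp.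
have mF := lipf_measurable lF.
have Lam0 : 0 <= \prod_i l i by exact: prodr_ge0.
have IuF : L1 (fun y => u y * F y) by exact: (@L1M _ _ _ _ b).
have lGp := lipf_upd ord0 lG lp; have lGF := lipf_upd ord0 lG lF.
have lGpF := lipf_upd ord0 lG lpF.
have E : pairing G (fun y => u y * phi y) F =
    pairing G u (fun y => phi y * F y) - \int[lam]_y (u y * F y * jac (upd G ord0 phi) y).
  rewrite !pairingE -RintegralB//; [|exact: (L1_mul_jac Iu lGpF)|exact: (L1_mul_jac IuF lGp)].
  apply: eq_integral_ae.
  - exact: L1_measurable (L1_mul_jac L1_cut lGF).
  - exact: L1_measurable (L1B (L1_mul_jac Iu lGpF) (L1_mul_jac IuF lGp)).
  - apply: ae_imp (aeI (good_ae lp) (good_ae lF)) => y [gp gF].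
    rewrite (jac_product G ord0 gp gF).
    move: (jac _ y) (jac _ y) => J1 J2; ring.
have H1 := uV lG l0 Gl lpF _ (cut_hoelder b0 Fb FL).
have H2 : `|\int[lam]_y (u y * F y * jac (upd G ord0 phi) y)| <=
    n`!%:R * (b * (n%:R / rho)) * (\prod_i l i) * shell_mass rho.
  rewrite -RintegralZl//; last exact: Ish.
  apply: le_norm_integral.
  - exact: L1_measurable (L1_mul_jac IuF lGp).
  - move=> y; have := jac_le0 l0 Gl (fun j => ramp_pd x r rho0 y j).
    move: (jac _ y) (Fb y) => J Fy HJ; rewrite !normrM.
    apply: le_trans (ler_pM _ _ (ler_pM _ _ (lexx _) Fy) HJ) _; rewrite ?mulr_ge0//.
    by rewrite le_eqVlt; apply/orP; left; apply/eqP; ring.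
  - by apply: L1Z; exact: Ish.
rewrite E; apply: le_trans (ler_normB _ _) _.
apply: le_trans (lerD (H1 _) H2) _; first by rewrite !mulr_ge0// powR_ge0.
rewrite le_eqVlt; apply/orP; left; apply/eqP; ring.
Qed.

End scale.

Notation rho := (dyad (1 : R)).

(** The variation part sums like [rho^(beta-alpha)], the shell part by the hypothesis on [S], as
    [rho^(beta-1) <= rho^(g-1)] for scales at most 1. Keeping [g] apart from [beta] lets countably
    many exponents serve all [beta]. *)
Lemma pairing_cut_ball (beta g S : R) : alpha < beta <= 1 -> 0 < g < 1 -> g <= beta ->
  (forall K, \sum_(k < K) shell_mass (rho k) * rho k `^ (g - 1) <= S) ->
  exists2 X, 0 <= X & forall G (l : 'I_m -> R) f (L : R), (forall i, lipf (G i)) ->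
    (forall i, 0 <= l i) -> (forall i, is_lip (l i) (G (lift ord0 i))) -> lipf f -> 0 <= L ->
    hoelder_fun beta L f -> `|pairing G (fun y => u y * \1_B y) f| <= X * L * \prod_i l i.
Proof.
move=> /andP[ab b1] /andP[g0 g1] gb HS; have /andP[a0 a1] := alpha01.
have beta01 : 0 < beta <= 1 by apply/andP; split; lra.
have ba : 0 < beta - alpha by rewrite subr_gt0.
have rk k : 0 < rho k by exact: dyad_gt0.
have rk1 k : rho k <= 1 by exact: dyad_le.
have m0 k : 0 <= shell_mass (rho k) by exact: shell_mass_ge0.
have S0 : 0 <= S by have := HS 0%N; rewrite big_ord0.
(* A single term of the bounded sum already forces the shell masses to 0, hence the L^1 convergence
   of the cut functions. *)
have mle k : shell_mass (rho k) <= S * rho k `^ (1 - g).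
  have p0 : 0 < rho k `^ (g - 1) by exact: powR_gt0.
  have -> : rho k `^ (1 - g) = (rho k `^ (g - 1))^-1 by rewrite -powRN opprB.
  rewrite ler_pdivlMr//; apply: le_trans (HS k.+1); rewrite big_ord_recr /= lerDr.
  by apply: sumr_ge0 => i _; rewrite mulr_ge0// powR_ge0.
have m_beta k : shell_mass (rho k) * rho k `^ (beta - 1) <= shell_mass (rho k) * rho k `^ (g - 1).
  by rewrite ler_wpM2l//; apply: ger_powR; [rewrite rk rk1|lra].
pose N0 := \int[lam]_y `|u y * ramp x r (rho 0%N) y|.
have N00 : 0 <= N0 by exact: Rintegral_ge0.
pose q := (2 : R) `^ (- (beta - alpha)).
have q01 : 0 <= q < 1 by exact: half_powR_lt1.
pose C1 := V * n.+1%:R; have C10 : 0 <= C1 by rewrite mulr_ge0.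
pose C2 := n`!%:R * n%:R : R; have C20 : 0 <= C2 by rewrite mulr_ge0.
pose X := N0 + (2 + C2) * S + C1 / (1 - q).
have X0 : 0 <= X.
  have i0 : 0 <= (1 - q)^-1 by rewrite invr_ge0 subr_ge0; case/andP: q01 => _ /ltW.
  apply: addr_ge0; last exact: mulr_ge0.
  by apply: addr_ge0 => //; apply: mulr_ge0 => //; exact: addr_ge0.
exists ((2 * n`!%:R + 3) * X); first by rewrite mulr_ge0// addr_ge0// mulr_ge0.
move=> G l f L lG l0 Gl lf L0 fL.
rewrite -[_ * X * L]mulrA [X * L]mulrC [_ * (L * X)]mulrA.
pose w_ k := fun y => u y * ramp x r (rho k) y.
pose b_ k := C1 * rho k `^ (- alpha) + C2 * (shell_mass (rho k) / rho k).
have dist k := cut_dist (rk k).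
have Iw_ k : L1 (w_ k) by exact: L1_cut.
apply: (@telescoping_bound R m G l lG l0 Gl beta L 1 f _ w_ N0 X
  (fun k => 2 * shell_mass (rho k)) b_ beta01 L0 fL lf ltr01 Iw Iw_).
- apply/cvgrPdist_le => e e0.
  have Se : 0 < S + 1 by rewrite ltr_wpDl.
  have d0 : 0 < (e / (S + 1)) `^ (1 - g)^-1 by rewrite powR_gt0// divr_gt0.
  have [N HN] := dyad_small ltr01 d0.
  exists N => // k /= Nk; rewrite sub0r normrN ger0_norm; last exact: Rintegral_ge0.
  apply: le_trans (dist k) (le_trans (mle k) _).
  have g1' : 0 <= 1 - g by lra.
  have := powR_mono g1' (ltW (rk k)) (HN k Nk).
  rewrite -powRrM mulVf ?powRr1; [|by rewrite divr_ge0// ltW|by rewrite gt_eqF// subr_gt0].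
  move=> /(ler_wpM2l S0) H; apply: le_trans H _.
  by rewrite mulrCA ger_pMr// ler_pdivrMr// mul1r lerDl.
- exact: lexx.
(* Both ramps differ from the indicator of the ball only on their shells, and the shells decrease
   with the scale. *)
- move=> k; apply: (@le_trans _ _ (\int[lam]_y (2 * (`|u y| * \1_(shell x r (rho k)) y)))).
    apply: le_Rintegral; first exact: measurableT.
    - by apply: L1_norm; exact: L1B.
    - by apply: L1Z; exact: Ish.
    - move=> y _; rewrite -mulrBr normrM mulrCA ler_wpM2l//.
      apply: le_trans (ler_distD (\1_B y) _ _) _.
      rewrite mulr2n mulrDl mul1r addrC; apply: lerD; first exact: ramp_indic.
      rewrite distrC; apply: le_trans (ramp_indic _ _ (rk k.+1) y) _.
      rewrite !indicE ler_nat; case: (boolP (y \in shell x r (rho k.+1))) => //= sy.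
      suff -> : y \in shell x r (rho k) by [].
      apply/mem_set; move: sy => /set_mem /andP[sy1 sy2]; rewrite /shell /= sy2 andbT.
      by apply: le_lt_trans sy1; rewrite dyadS; have := rk k; lra.
  by rewrite RintegralZl//; exact: Ish.
- move=> k; rewrite addr_ge0// mulr_ge0 ?powR_ge0// divr_ge0// ltW//.
- move=> k F b bb0 Fb FL; exact: (pairing_cut (rk k) lG l0 Gl bb0 Fb FL).
- move=> K; rewrite powR1 mulr1 /X -addrA lerD2l.
  apply: (@le_trans _ _ (\sum_(k < K) ((2 + C2) * (shell_mass (rho k) * rho k `^ (g - 1)) +
      C1 * q ^+ k))).
    apply: ler_sum => k _.
    have E1 : rho k `^ (- alpha) * rho k `^ beta = q ^+ k.
      by rewrite -powR_add// dyad_powR// powR1 mul1r addrC.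
    have E2 : (shell_mass (rho k) / rho k) * rho k `^ beta = shell_mass (rho k) * rho k `^ (beta - 1).
      by rewrite powRB1// mulrAC mulrA.
    have alg (M p a b d : R) : 2 * M * p + (C1 * a + C2 * d) * b =
      2 * (M * p) + C1 * (a * b) + C2 * (d * b) by ring.
    rewrite /b_ alg E1 E2; move: (ler_wpM2l C20 (m_beta k)) (m_beta k).
    move: (shell_mass _ * rho k `^ (g - 1)) => t.
    move: (shell_mass _ * rho k `^ (beta - 1)) (C1 * q ^+ k) => s z H1 H2.
    rewrite mulrDl; lra.
  rewrite big_split /= -!mulr_sumr; apply: lerD.
    by apply: ler_wpM2l (HS K); exact: addr_ge0.
  by apply: ler_wpM2l => //; exact: geometric_sum_le.
Qed.

End cut_ball.

(** * Markov's inequality for series of nonnegative functions *)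

Section series_markov.
Context d (T : measurableType d) {R : realType} (mu : {measure set T -> \bar R}).
Variables (a_ : nat -> T -> R) (C : R).
Hypotheses (a0 : forall k x, 0 <= a_ k x) (ma : forall k, measurable_fun setT (a_ k))
  (aC : forall K, (\sum_(k < K) \int[mu]_x (a_ k x)%:E <= C%:E)%E).

(** Phrased with partial sums to stay among real numbers. It serves both the choice of radii and the
    sets of the exhaustion. *)
Definition series_le (t : R) : set T := [set x | forall K, \sum_(k < K) a_ k x <= t].

Lemma measurable_series_le t : measurable (series_le t).
Proof.
have -> : series_le t = \bigcap_K [set x | \sum_(k < K) a_ k x <= t].
  by apply/seteqP; split => [x H K _|x H K]; exact: H.
apply: bigcapT_measurable => K.
have mS : measurable_fun setT (fun x => \sum_(k < K) a_ k x).
  by apply: measurable_sum.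
have := mS measurableT _ (@measurable_itv R `]-oo, t]); rewrite setTI.
by congr measurable; apply/seteqP; split => y; rewrite /= in_itv.
Qed.

Let G x := (\sum_(k <oo) (a_ k x)%:E)%E.

Let mG : measurable_fun setT G.
Proof.
apply: ge0_emeasurable_sum => [k x _ _|k _]; first by rewrite lee_fin.
exact/measurable_EFinP.
Qed.

Let G0 x : (0 <= G x)%E. Proof. by apply: nneseries_ge0 => k _ _; rewrite lee_fin. Qed.

Let intG : (\int[mu]_x G x <= C%:E)%E.
Proof.
rewrite integral_nneseries//; last by move=> k x _; rewrite lee_fin.
  apply: lime_le; first by apply: is_cvg_nneseries => k _ _; apply: integral_ge0 => x _; rewrite lee_fin.
  by apply: nearW => K; rewrite big_mkord.
by move=> k; exact/measurable_EFinP.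
Qed.

Lemma series_markov t : 0 < t -> (mu (~` series_le t) <= (C / t)%:E)%E.
Proof.
move=> t0; have := @le_integral_abse _ _ _ mu setT measurableT G t mG t0.
rewrite setTI (eq_integral G) => [H|x _]; last by rewrite gee0_abs.
have H1 := le_trans H intG.
rewrite EFinM lee_pdivlMr// muleC; apply: le_trans H1.
rewrite lee_pmul2l// ; apply: le_measure; rewrite ?inE.
- by apply: measurableC; exact: measurable_series_le.
- rewrite -[X in measurable X]setTI; apply: emeasurable_fun_c_infty => //.
  exact: measurableT_comp.
move=> x /existsNP[K /negP]; rewrite -ltNge => tK; rewrite /= gee0_abs//.
apply: le_trans (nneseries_lim_ge K _) => [|k _ _]; last by rewrite lee_fin.
by rewrite big_mkord sumEFin lee_fin ltW.
Qed.

(** The exceptional set lies in every complement of [series_le m], whose measure is at most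
    [C / m]. *)
Lemma ae_series_bounded : {ae mu, forall x, exists S, forall K, \sum_(k < K) a_ k x <= S}.
Proof.
exists (\bigcap_m ~` series_le m.+1%:R); split.
- by apply: bigcapT_measurable => m; apply: measurableC; exact: measurable_series_le.
- apply/eqP; rewrite eq_le measure_ge0 andbT; apply/lee_addgt0Pr => e e0; rewrite add0e.
  pose m := (Num.truncn (`|C| / e)).+1.
  apply: (@le_trans _ _ (mu (~` series_le m%:R))).
    apply: le_measure; rewrite ?inE.
    - by apply: bigcapT_measurable => k; apply: measurableC; exact: measurable_series_le.
    - by apply: measurableC; exact: measurable_series_le.
    - by move=> x H; exact: (H m.-1 I).
  apply: le_trans (series_markov _) _; first by rewrite ltr0n.
  rewrite lee_fin ler_pdivrMr ?ltr0n// mulrC -ler_pdivrMr//.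
  apply: le_trans (ltW (truncnS_gt _)).
  by rewrite ler_pM2r ?invr_gt0// ler_norm.
- move=> x /= H m _ xm; apply: H; exists m.+1%:R; exact: xm.
Qed.

End series_markov.

Section almost_every_radius.
Context {R : realType} {m : nat}.
Notation n := m.+1.
Notation lam := (@lebesgue_rV R n).
Notation leb := (@lebesgue_measure R).
Implicit Types (u : 'rV[R]_n -> R) (x y : 'rV[R]_n).

(** For a fixed point [y], the radii whose shell contains [y] form an interval of length [2 rho]. *)
Lemma shell_mass_Tonelli u x (rho : R) : L1 u -> 0 < rho ->
  measurable_fun [set: measurableTypeR R] (fun r => shell_mass u x r rho) /\
  (\int[leb]_r (shell_mass u x r rho)%:E = (2 * rho * \int[lam]_y `|u y|)%:E)%E.
Proof.
move=> Iu rho0; have mu := L1_measurable Iu.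
pose A := [set p : measurableTypeR R * 'rV[R]_n | shell x p.1 rho p.2].
have me : measurable_fun [set: measurableTypeR R * 'rV[R]_n]
    (fun p => p.1 - enorm (p.2 - x)).
  apply: measurable_funB => //.
  by apply: (measurableT_comp (measurable_enorm x)).
have mA : measurable A.
  have := me measurableT _ (@measurable_itv R `[0, 2 * rho[); rewrite setTI.
  congr measurable; apply/seteqP; split => -[r y]; rewrite /A /shell /= in_itv /= => /andP[H1 H2];
    apply/andP; split; lra.
pose F (p : measurableTypeR R * 'rV[R]_n) := (`|u p.2| * \1_A p)%:E.
have AE r y : \1_A (r, y) = \1_(shell x r rho) y :> R.
  by rewrite !indicE; congr (nat_of_bool _)%:R; apply/idP/idP; rewrite !inE.
have mF : measurable_fun setT F.
  apply/measurable_EFinP; apply: measurable_funM; last exact: measurable_indic.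
  by apply: measurableT_comp => //; apply: (measurableT_comp mu).
have F0 p : (0 <= F p)%E by rewrite lee_fin mulr_ge0// indicE.
have Ish r : L1 (fun y => `|u y| * \1_(shell x r rho) y).
  apply: (@L1M _ _ _ _ 1); [exact: L1_norm| |by move=> y; exact: indic_norm_le1].
  by apply: measurable_indic; exact: measurable_shell.
have SE r : (\int[lam]_y F (r, y) = (shell_mass u x r rho)%:E)%E.
  by rewrite /shell_mass -integral_EFin//; apply: eq_integral => y _; rewrite /F AE.
have mFr := @measurable_fun_fubini_tonelli_F _ _ _ _ _ lam F mF F0.
have H := @fubini_tonelli _ _ _ _ _ leb lam F mF F0.
split.
  apply/measurable_EFinP; apply: eq_measurable_fun mFr => r _.
  by rewrite /fubini_F SE.
transitivity (\int[leb]_r \int[lam]_y F (r, y))%E; first by apply: eq_integral => r _; rewrite SE.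
rewrite H.
have -> : (2 * rho * \int[lam]_y `|u y|)%:E = ((2 * rho)%:E * \int[lam]_y `|u y|%:E)%E.
  by rewrite EFinM integral_EFin//; exact: L1_norm.
rewrite -ge0_integralZl//.
- apply: eq_integral => y _.
  have -> : (fun r => F (r, y)) = fun r => (`|u y|%:E *
      (\1_(`[enorm (y - x), (enorm (y - x) + 2 * rho)%R[%classic : set (measurableTypeR R)) r)%:E)%E.
    apply/funext => r; rewrite /F AE -EFinM; congr (_ * _)%:E; rewrite !indicE.
    congr (nat_of_bool _)%:R; apply/idP/idP; rewrite !inE /shell /= in_itv /= => /andP[H1 H2];
      apply/andP; split; lra.
  rewrite ge0_integralZl//; last first.
    by apply/measurable_EFinP; exact: measurable_indic.
  rewrite integral_indic// setIT /= lebesgue_measure_itv /= lte_fin.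
  rewrite (_ : _ < _); last by lra.
  by rewrite -EFinB muleC; congr (_%:E * _)%E; ring.
- by apply/measurable_EFinP; apply: measurableT_comp.
- by rewrite lee_fin mulr_ge0// ltW.
Qed.

(** Integrated over the radius, the term at scale [rho] is [2 N rho^g], a geometric sequence;
    bounded partial integrals give bounded partial sums for almost every radius. *)
Lemma ae_shell_sum u x (g : R) : L1 u -> 0 < g ->
  {ae leb, forall r, exists S, forall K,
    \sum_(k < K) shell_mass u x r (dyad 1 k) * dyad 1 k `^ (g - 1) <= S}.
Proof.
move=> Iu g0; pose N := \int[lam]_y `|u y|.
have N0 : 0 <= N by exact: Rintegral_ge0.
have rk k : 0 < dyad (1 : R) k by exact: dyad_gt0.
have q01 := half_powR_lt1 g0; set q := 2 `^ (- g) in q01.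
apply: (@ae_series_bounded _ _ _ leb (fun k r => shell_mass u x r (dyad 1 k) * dyad 1 k `^ (g - 1))
  (2 * N / (1 - q))).
- by move=> k r; rewrite mulr_ge0 ?powR_ge0// shell_mass_ge0.
- by move=> k; apply: measurable_funM => //; have [] := shell_mass_Tonelli x Iu (rk k).
- move=> K; rewrite (eq_bigr (fun k : 'I_K => (2 * N * q ^+ k)%:E)); last first.
    move=> k _; have [mk Ek] := shell_mass_Tonelli x Iu (rk k).
    transitivity (\int[leb]_r ((dyad (1 : R) k `^ (g - 1))%:E * (shell_mass u x r (dyad 1 k))%:E))%E.
      by apply: eq_integral => r _; rewrite -EFinM mulrC.
    rewrite ge0_integralZl//; first last.
    - by rewrite lee_fin powR_ge0.
    - by move=> r _; rewrite lee_fin shell_mass_ge0.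
    - exact/measurable_EFinP.
    rewrite Ek -EFinM -/N; congr EFin.
    have -> : q ^+ k = dyad 1 k `^ (g - 1) * dyad 1 k.
      by rewrite powRB1// divfK ?gt_eqF// dyad_powR// powR1 mul1r.
    ring.
  rewrite sumEFin lee_fin -mulr_sumr ler_wpM2l ?mulr_ge0//.
  exact: geometric_sum_le.
Qed.

Lemma BVc_cut_ball (alpha : R) u x : 0 <= alpha < 1 -> BVc alpha u ->
  {ae leb, forall r : R, 0 < r -> forall beta : R, alpha < beta < 1 ->
    BVc beta (fun y => u y * \1_(cball x r) y)}.
Proof.
move=> alpha01 [[Iu [K cK uK]] uV]; have /andP[a0 a1] := alpha01.
have [V V0 HV] := frac_var_finite a0 Iu uV.
(* The null set of radii must not depend on [beta], so the sums are controlled for the countably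
   many exponents [1/(p+2)]. These are below 1 and tend to 0, so one of them is at most [beta]. *)
have : {ae leb, forall r (p : nat), exists S, forall K,
    \sum_(k < K) shell_mass u x r (dyad 1 k) * dyad 1 k `^ (p.+2%:R^-1 - 1) <= S}.
  by apply/ae_foralln => p; apply: ae_shell_sum => //; rewrite invr_gt0.
apply: (@filterS _ _ (ae_filter_ringOfSetsType leb)) => r Hr r0 beta /andP[ab b1].
have b0 : 0 < beta by exact: le_lt_trans ab.
pose p := Num.truncn beta^-1.
have pb : p.+2%:R^-1 <= beta.
  rewrite -[leRHS]invrK lef_pV2 ?posrE ?invr_gt0// (le_trans (ltW (truncnS_gt _)))//.
  by rewrite ler_nat.
have p1 : 0 < (p.+2%:R^-1 : R) < 1 by rewrite invr_gt0 ltr0n/= invf_lt1 ?ltr0n// ltr1n.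
have [S HS] := Hr p.
have ab1 : alpha < beta <= 1 by rewrite ab ltW.
have [X X0 HX] := pairing_cut_ball alpha01 Iu V0 HV ab1 p1 pb HS.
have Iw : L1 (fun y => u y * \1_(cball x r) y).
  apply: (@L1M _ _ _ _ 1) => //; last by move=> y; exact: indic_norm_le1.
  by apply: measurable_indic; exact: measurable_cball.
split.
  split => //; exists K => //; apply: ae_imp uK => y uy /uy ->; exact: mul0r.
have b01 : 0 <= beta <= 1 by rewrite !ltW.
exact: le_lt_trans (frac_var_le b01 Iw X0 HX) (ltry _).
Qed.

End almost_every_radius.

(** * Hoelder exhaustion *)

Section weak_gradient.
Context {R : realType} {m : nat}.
Notation n := m.+1.
Notation lam := (@lebesgue_rV R n).
Implicit Types (x y h : 'rV[R]_n) (f psi : 'rV[R]_n -> R) (j : 'I_n).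
Variables (beta V : R) (u : 'rV[R]_n -> R).
Hypotheses (beta01 : 0 < beta < 1) (Iu : L1 u) (V0 : 0 <= V).
Hypothesis uV : forall G (l : 'I_m -> R) f (L : R), (forall i, lipf (G i)) ->
  (forall i, 0 <= l i) -> (forall i, is_lip (l i) (G (lift ord0 i))) -> lipf f -> 0 <= L ->
  hoelder_fun beta L f -> `|pairing G u f| <= V * L * \prod_i l i.

Lemma weak_gradient_le j f (L : R) : lipf f -> 0 <= L -> hoelder_fun beta L f ->
  `|\int[lam]_x (u x * pd j f x)| <= V * L.
Proof.
move=> lf L0 fL.
have lG i : lipf (other_coords (R := R) j i) by exact: lipf_coord.
have l0 (i : 'I_m) : 0 <= (1 : R) by [].
have Gl i : is_lip 1 (other_coords (R := R) j (lift ord0 i)).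
  move=> x y; rewrite mul1r; have := coord_le_norm (x - y); rewrite /other_coords.
  by move=> /(_ (if unlift ord0 (lift ord0 i) is Some i' then lift j i' else j)); rewrite !mxE.
have := uV lG l0 Gl lf L0 fL; rewrite big1// mulr1 pairingE.
have -> : \int[lam]_x (u x * jac (upd (other_coords j) ord0 f) x) =
    \int[lam]_x ((-1) ^+ j * (u x * pd j f x)).
  by apply: eq_Rintegral => x _; rewrite jac_other_coords; exact: mulrCA.
have [K K0 fK] := lf.
rewrite RintegralZl//; first by rewrite normrM normrX normrN1 expr1n mul1r.
apply: (@L1M _ _ _ _ K) => //; first exact: measurable_pd.
by move=> x; exact: pd_le.
Qed.

Lemma hoelder_translate f (L : R) h : hoelder_fun beta L f -> hoelder_fun beta L (fun y => f (y + h)).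
Proof. by move=> fL x y; have := fL (x + h) (y + h); rewrite opprD addrACA subrr addr0. Qed.

Let Idiff f h : lipf f -> L1 (fun x => u x * (f (x + h) - f x)).
Proof.
move=> lf; have [K K0 fK] := lf; apply: (@L1M _ _ _ _ (K * `|h|)) => //.
  by apply: measurable_funB; apply: lipf_measurable => //; exact: lipf_translate.
by move=> x; rewrite (le_trans (fK _ _))// addrAC subrr add0r.
Qed.

Let Phi j f (t : R) := \int[lam]_x (u x * (f (x + t *: delta_mx ord0 j) - f x)).

Let PhiB j f (s t : R) : lipf f -> Phi j f (t + s) - Phi j f s =
  \int[lam]_x (u x * (f (x + t *: delta_mx ord0 j + s *: delta_mx ord0 j) -
                      f (x + s *: delta_mx ord0 j))).
Proof.
move=> lf; rewrite /Phi -RintegralB//; [|exact: Idiff|exact: Idiff].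
apply: eq_Rintegral => x _; rewrite -mulrBr; congr (_ * _).
by rewrite scalerDl addrA; ring.
Qed.

(** Differentiation under the integral: the quotients converge almost everywhere and are bounded by
    the Lipschitz constant, so that a multiple of [u] dominates. *)
Let Phi_derive j f (s : R) : lipf f ->
  is_derive s 1 (Phi j f) (\int[lam]_x (u x * pd j (fun y => f (y + s *: delta_mx ord0 j)) x)).
Proof.
move=> lf; have [K K0 fK] := lf; pose e : 'rV[R]_n := delta_mx ord0 j.
pose g y := f (y + s *: e); have lg : lipf g by exact: lipf_translate.
have gK : is_lip K g by move=> x y; rewrite (le_trans (fK _ _))// opprD addrACA subrr addr0.
suff H : (fun h : R => h^-1 *: ((Phi j f \o shift s) (h *: 1) - Phi j f s)) @ 0^' -->
    \int[lam]_x (u x * pd j g x).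
  apply: DeriveDef; first by apply/cvg_ex; eexists; exact: H.
  exact: (cvg_lim _ H).
apply/cvgr_dnbhsP => t_ [tn0 t0].
rewrite (_ : (fun k => _) = fun k => \int[lam]_x (u x * diff_quot e g (t_ k) x)); last first.
  apply/funext => k; rewrite /= scaler1 PhiB//.
  rewrite -[LHS]RintegralZl//; last exact: (@Idiff g (t_ k *: e) lg).
  apply: eq_Rintegral => x _; rewrite /diff_quot /g [t_ k *: e + x]addrC.
  ring.
have dqK (t : R) x : t != 0 -> `|diff_quot e g t x| <= K.
  move=> tn; rewrite /diff_quot normrM normfV ler_pdivrMl ?normr_gt0// mulrC.
  by rewrite (le_trans (gK _ _))// addrK normrZ norm_delta_mx mulr1.
apply: (@L1_dominatedM _ _ _ _ _ K Iu).
- move=> k; apply: measurable_funM => //; apply: measurable_funB; last exact: lipf_measurable.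
  under eq_fun do rewrite addrC; exact: lipf_measurable (lipf_translate _ lg).
- exact: measurable_pd.
- apply: ae_imp (good_ae lg) => x /(_ j); rewrite derivableE => /cvg_ex[l ql].
  rewrite /pd derive_diff_quot (cvg_lim _ ql)//.
  by move/cvgr_dnbhsP : ql; apply.
- by move=> k x; exact: dqK.
Qed.

(** Mean value theorem for [Phi]. Its derivative is bounded through the Hoelder constant, which
    translation preserves. *)
Lemma translate_coord_le j f (L t : R) : lipf f -> 0 <= L -> hoelder_fun beta L f -> 0 <= t ->
  `|\int[lam]_x (u x * (f (x + t *: delta_mx ord0 j) - f x))| <= t * (V * L).
Proof.
move=> lf L0 fL t0.
have D s := Phi_derive j s lf.
have cP : {within `[0, t], continuous (Phi j f)}.
  by apply: derivable_within_continuous => s _; exact: (@ex_derive _ _ _ _ _ _ _ (D s)).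
have [c _] := MVT_segment t0 (fun s _ => D s) cP.
have -> : Phi j f 0 = 0.
  rewrite /Phi (_ : (fun x => _) = fun=> 0) ?Rintegral_cst ?mul0r//.
  by apply/funext => x; rewrite scale0r addr0 subrr mulr0.
rewrite !subr0 -/(Phi j f t) => ->; rewrite normrM (ger0_norm t0) mulrC ler_wpM2l//.
by apply: weak_gradient_le => //; [exact: lipf_translate|exact: hoelder_translate].
Qed.

(** The translation is decomposed into moves along the axes; after one move the remaining ones act
    on a translate of the function, with the same Hoelder constant. *)
Lemma translate_le f (L : R) h : lipf f -> 0 <= L -> hoelder_fun beta L f ->
  `|\int[lam]_x (u x * (f (x + h) - f x))| <= n%:R * `|h| * (V * L).
Proof.
move=> lf L0 fL; have VL : 0 <= V * L by rewrite mulr_ge0.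
have step g j (t : R) : lipf g -> hoelder_fun beta L g ->
    `|\int[lam]_x (u x * (g (x + t *: delta_mx ord0 j) - g x))| <= `|t| * (V * L).
  move=> lg gL; have [t0|/ltW t0] := leP 0 t.
    by rewrite [X in _ <= X * _]ger0_norm//; exact: translate_coord_le.
  have mt0 : 0 <= - t by rewrite oppr_ge0.
  (* A negative move is undone by a positive one applied to the translate, at the price of a
     sign. *)
  pose g' := fun y => g (y + t *: delta_mx ord0 j).
  have lg' : lipf g' by exact: lipf_translate.
  have := translate_coord_le j lg' L0 (hoelder_translate (t *: delta_mx ord0 j) gL) mt0.
  rewrite (ler0_norm t0); congr (_ <= _); rewrite -normrN -mulN1r -RintegralZl//.
    congr `|_|; apply: eq_Rintegral => x _; rewrite /g' scaleNr subrK; ring.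
  exact: (@Idiff g' (- t *: delta_mx ord0 j) lg').
have main (s : seq 'I_n) g : lipf g -> hoelder_fun beta L g ->
    `|\int[lam]_x (u x * (g (x + \sum_(j <- s) h ord0 j *: delta_mx ord0 j) - g x))| <=
    \sum_(j <- s) `|h ord0 j| * (V * L).
  elim: s g => [|j s IH] g lg gL.
    rewrite !big_nil (_ : (fun x => _) = fun=> 0) ?Rintegral_cst ?mul0r ?normr0//.
    by apply/funext => x; rewrite addr0 subrr mulr0.
  rewrite !big_cons; set a := h ord0 j *: _; set b := \sum_(j <- s) _.
  have -> : \int[lam]_x (u x * (g (x + (a + b)) - g x)) =
      \int[lam]_x (u x * (g (x + b + a) - g (x + a))) + \int[lam]_x (u x * (g (x + a) - g x)).
    rewrite -RintegralD//; first 1 last.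
    - have := @Idiff (fun y => g (y + a)) b (lipf_translate _ lg); exact.
    - exact: Idiff.
    apply: eq_Rintegral => x _; rewrite [a + b]addrC addrA; ring.
  apply: le_trans (ler_normD _ _) _; rewrite addrC; apply: lerD; first exact: step.
  exact: (IH (fun y => g (y + a)) (lipf_translate _ lg) (hoelder_translate _ gL)).
have := main (index_enum 'I_n) f lf fL.
have -> : \sum_(j <- index_enum 'I_n) h ord0 j *: delta_mx ord0 j = h by rewrite [RHS]row_sum_delta.
move=> /le_trans; apply; rewrite -mulr_suml ler_wpM2r//.
apply: (@le_trans _ _ (\sum_(j < n) `|h|)); first by apply: ler_sum => j _; exact: coord_le_norm.
by rewrite sumr_const card_ord -[leLHS]mulr_natl.
Qed.

End weak_gradient.

(** * Averages over cubes *)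

Section box_average.
Context {R : realType} {m : nat}.
Notation n := m.+1.
Notation lam := (@lebesgue_rV R n).
Implicit Types (x y h s z : 'rV[R]_n) (rho : R).

(** Half-open with a corner at the origin, so that it is exactly the disjoint union of [2^n]
    translates of the cube of half the side. *)
Definition corner_box rho : set 'rV[R]_n := rV_box (fun=> `[0, rho[%classic).

Lemma corner_boxP rho s : corner_box rho s <-> forall i, 0 <= s ord0 i < rho.
Proof. by split => H i; have := H i; rewrite /= in_itv. Qed.

Lemma measurable_corner_box rho : measurable (corner_box rho).
Proof. exact: measurable_rV_box. Qed.

Lemma lam_corner_box rho : 0 < rho -> lam (corner_box rho) = (rho ^+ n)%:E.
Proof.
move=> r0; rewrite lebesgue_rV_rV_box//.
rewrite (eq_bigr (fun=> rho%:E)) ?prodEFin ?prodr_const ?card_ord// => i _.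
by rewrite lebesgue_measure_itv/= lte_fin r0 oppr0 addr0.
Qed.

Lemma L1_corner_box rho : 0 < rho -> L1 (\1_(corner_box rho) : 'rV[R]_n -> R).
Proof.
move=> r0; apply: L1_indic; first exact: measurable_corner_box.
by rewrite lam_corner_box// ltry.
Qed.

Lemma integral_corner_box rho : 0 < rho -> \int[lam]_s \1_(corner_box rho) s = rho ^+ n.
Proof. by move=> r0; rewrite integral_indicR ?lam_corner_box//; exact: measurable_corner_box. Qed.

Lemma corner_box_norm rho s : corner_box rho s -> `|s| <= rho.
Proof.
move=> /corner_boxP H; apply: norm_rV_le => [|i].
  by have /andP[s0 /ltW] := H ord0; exact: le_trans.
by have /andP[s0 /ltW sr] := H i; rewrite ger0_norm.
Qed.

Variable phi : 'rV[R]_n -> R.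
Hypotheses (lp : lipf phi) (phi1 : forall x, `|phi x| <= 1).

Definition box_avg rho x := (rho ^+ n)^-1 * \int[lam]_s (\1_(corner_box rho) s * phi (x + s)).

Let mphi x : measurable_fun setT (fun s => phi (x + s)).
Proof. by under eq_fun do rewrite addrC; exact: lipf_measurable (lipf_translate _ lp). Qed.

Let Ibox rho x : 0 < rho -> L1 (fun s => \1_(corner_box rho) s * phi (x + s)).
Proof. by move=> r0; apply: (@L1M _ _ _ _ 1) => //; exact: L1_corner_box. Qed.

Lemma box_avg_le1 rho x : 0 < rho -> `|box_avg rho x| <= 1.
Proof.
move=> r0; have p0 : 0 < rho ^+ n by rewrite exprn_gt0.
rewrite normrM normfV (gtr0_norm p0) ler_pdivrMl// mulr1 -integral_corner_box//.
apply: le_norm_integral; [exact: L1_measurable (Ibox _ r0)| |exact: L1_corner_box].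
by move=> s; rewrite normrM ger0_norm ?indicE// ler_piMr// ?phi1.
Qed.

Lemma box_avg_dist rho x (K : R) : 0 < rho -> 0 <= K -> is_lip K phi ->
  `|phi x - box_avg rho x| <= K * rho.
Proof.
move=> r0 K0 pK; have p0 : 0 < rho ^+ n by rewrite exprn_gt0.
have IB := L1_corner_box r0.
have -> : phi x - box_avg rho x =
    (rho ^+ n)^-1 * \int[lam]_s (\1_(corner_box rho) s * (phi x - phi (x + s))).
  have -> : \int[lam]_s (\1_(corner_box rho) s * (phi x - phi (x + s))) =
    \int[lam]_s (phi x * \1_(corner_box rho) s) - \int[lam]_s (\1_(corner_box rho) s * phi (x + s)).
    rewrite -RintegralB//; [|exact: L1Z|exact: Ibox].
    by apply: eq_Rintegral => s _; ring.
  rewrite RintegralZl// integral_corner_box// mulrBr mulrCA mulVf ?mulr1//.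
  by rewrite gt_eqF.
rewrite normrM normfV (gtr0_norm p0) ler_pdivrMl// -integral_corner_box// mulrC -RintegralZl//.
apply: le_norm_integral; last exact: L1Z.
  apply: measurable_funM; first exact: L1_measurable IB.
  exact: measurable_funB.
move=> s; rewrite normrM ger0_norm ?indicE// mulrC.
case: (boolP (s \in _)) => [/set_mem sb|_]; last by rewrite !mulr0.
rewrite !mulr1; apply: le_trans (pK _ _) _.
by rewrite opprD addrA subrr sub0r normrN ler_wpM2l// corner_box_norm.
Qed.

(** With [d = |x - y| < rho], both cubes contain a cube of side [rho - d], and
    [rho^n - (rho - d)^n <= n d rho^(n-1)]. For larger [d] the total volume is already small
    enough. *)
Lemma corner_box_overlap rho x y : 0 < rho ->
  \int[lam]_z `|\1_(corner_box rho) (z - x) - \1_(corner_box rho) (z - y)| <=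
  2 * n%:R * `|x - y| * rho ^+ m.
Proof.
move=> r0; have IB r : 0 < r -> forall a, L1 (fun z => \1_(corner_box r) (z - a)).
  by move=> r1 a; exact: (@L1_translate _ _ _ (- a) (L1_corner_box r1)).
have EB r : 0 < r -> forall a, \int[lam]_z \1_(corner_box r) (z - a) = r ^+ n.
  move=> r1 a; rewrite -(integral_corner_box r1).
  exact: (@integral_translate _ _ _ (- a) (L1_measurable (L1_corner_box r1))).
have [rd|dr] := leP rho `|x - y|.
  apply: (@le_trans _ _ (\int[lam]_z (\1_(corner_box rho) (z - x) + \1_(corner_box rho) (z - y)))).
    apply: le_Rintegral; first exact: measurableT.
    - by apply: L1_norm; apply: L1B; exact: IB.
    - by apply: L1D; exact: IB.
    - move=> z _; apply: le_trans (ler_normB _ _) _.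
      by rewrite !ger0_norm// indicE.
  rewrite RintegralD//; [|exact: IB|exact: IB]; rewrite !EB//.
  have H : rho ^+ n <= n%:R * `|x - y| * rho ^+ m.
    rewrite exprS ler_wpM2r ?exprn_ge0 ?(ltW r0)//.
    by apply: le_trans rd _; rewrite ler_peMl// ler1n.
  have -> : 2 * n%:R * `|x - y| * rho ^+ m =
    n%:R * `|x - y| * rho ^+ m + n%:R * `|x - y| * rho ^+ m by ring.
  exact: lerD.
have [d dE] : exists d, d = `|x - y| by exists `|x - y|.
have d0 : 0 <= d by rewrite dE.
rewrite -dE in dr *.
have rd0 : 0 < rho - d by rewrite subr_gt0.
(* The lower corner of the intersection of the two cubes. *)
pose p : 'rV[R]_n := \row_i Num.max (x ord0 i) (y ord0 i).
have px z : corner_box (rho - d) (z - p) -> corner_box rho (z - x) /\ corner_box rho (z - y).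
  move=> /corner_boxP H; split; apply/corner_boxP => i; have := H i; rewrite !mxE;
    have := coord_le_norm (x - y) i; rewrite !mxE -dE ler_norml => /andP[H1 H2];
    have [H3|H3] := leP (x ord0 i) (y ord0 i) => /andP[H4 H5]; apply/andP; split; lra.
apply: (@le_trans _ _ (\int[lam]_z (\1_(corner_box rho) (z - x) + \1_(corner_box rho) (z - y) -
    2 * \1_(corner_box (rho - d)) (z - p)))).
  apply: le_Rintegral; first exact: measurableT.
  - by apply: L1_norm; apply: L1B; exact: IB.
  - by apply: L1B; [apply: L1D; exact: IB|apply: L1Z; exact: IB].
  - move=> z _; rewrite !indicE.
    case: (boolP (z - p \in _)) => [/set_mem /px[/mem_set -> /mem_set ->]|_].
      by rewrite subrr normr0; lra.
    by rewrite mulr0 subr0; apply: le_trans (ler_normB _ _) _; rewrite !ger0_norm.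
rewrite RintegralB//; [|by apply: L1D; exact: IB|by apply: L1Z; exact: IB].
rewrite RintegralD//; [|exact: IB|exact: IB].
rewrite RintegralZl//; last exact: IB.
rewrite !EB//.
have sr : 0 <= rho - d <= rho by apply/andP; split; [exact: ltW|lra].
have E : rho - (rho - d) = d by ring.
have := expr_diff_le m sr; rewrite E => H.
have -> : 2 * n%:R * d * rho ^+ m = 2 * (n%:R * d * rho ^+ m) by ring.
move: H; lra.
Qed.

(** Two averages of a function bounded by 1 differ at most by the normalized volume of the symmetric
    difference; the Lipschitz constant of [phi] does not enter. *)
Lemma box_avg_lip rho : 0 < rho -> is_lip (2 * n%:R / rho) (box_avg rho).
Proof.
move=> r0 x y; have p0 : 0 < rho ^+ n by rewrite exprn_gt0.
have E a : \int[lam]_s (\1_(corner_box rho) s * phi (a + s)) =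
    \int[lam]_z (\1_(corner_box rho) (z - a) * phi z).
  rewrite -(@integral_translate _ _ _ (- a) (L1_measurable (Ibox a r0))).
  by apply: eq_Rintegral => z _; rewrite [a + _]addrC subrK.
have I a : L1 (fun z => \1_(corner_box rho) (z - a) * phi z).
  apply: (@L1M _ _ _ _ 1); [|exact: lipf_measurable|exact: phi1].
  exact: (@L1_translate _ _ _ (- a) (L1_corner_box r0)).
rewrite /box_avg -mulrBr !E -RintegralB//; [|exact: I|exact: I].
rewrite normrM normfV (gtr0_norm p0) ler_pdivrMl//.
have -> : rho ^+ n * (2 * n%:R / rho * `|x - y|) = 2 * n%:R * `|x - y| * rho ^+ m.
  by rewrite exprS; field; rewrite gt_eqF.
apply: le_trans _ (corner_box_overlap x y r0).
apply: le_norm_integral.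
- by apply: L1_measurable; exact: L1B.
- by move=> z; rewrite -mulrBl normrM ler_piMr// phi1.
- by apply: L1_norm; apply: L1B; exact: (@L1_translate _ _ _ (- _) (L1_corner_box r0)).
Qed.

Lemma lipf_box_avg rho : 0 < rho -> lipf (box_avg rho).
Proof.
by move=> r0; exists (2 * n%:R / rho); [rewrite divr_ge0 ?mulr_ge0// ltW|exact: box_avg_lip].
Qed.

Definition vertex (e : {ffun 'I_n -> bool}) : 'rV[R]_n := \row_i (e i)%:R.

Lemma vertex_norm e : `|vertex e| <= 1.
Proof. by apply: norm_rV_le => // i; rewrite mxE ger0_norm//; case: (e i). Qed.

Lemma indic_corner_box rho s : \1_(corner_box rho) s = \prod_i (0 <= s ord0 i < rho)%R%:R :> R.
Proof.
rewrite indicE; case: (boolP (s \in _)) => [/set_mem /corner_boxP H|H].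
  by rewrite big1// => i _; rewrite H.
have [i /negbTE Hi] : exists i, ~~ (0 <= s ord0 i < rho).
  apply/existsP; rewrite -negb_forall; apply: contra H => /forallP H.
  by apply/mem_set/corner_boxP.
by rewrite (bigD1 i)//= Hi mul0r.
Qed.

Lemma box_avg_half rho x : 0 < rho ->
  box_avg rho x = (2 ^+ n)^-1 * \sum_e box_avg (rho / 2) (x + (rho / 2) *: vertex e).
Proof.
move=> r0; have h0 : 0 < rho / 2 by rewrite divr_gt0.
pose B := corner_box (rho / 2).
have E e : \int[lam]_s (\1_B s * phi (x + (rho / 2) *: vertex e + s)) =
    \int[lam]_s (\1_B (s - (rho / 2) *: vertex e) * phi (x + s)).
  rewrite -(@integral_translate _ _ _ (- ((rho / 2) *: vertex e)) (L1_measurable (Ibox _ h0))).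
  by apply: eq_Rintegral => s _; congr (_ * phi _); rewrite -addrA [_ *: _ + _]addrC subrK.
have I e : L1 (fun s => \1_B (s - (rho / 2) *: vertex e) * phi (x + s)).
  apply: (@L1M _ _ _ _ 1) => //.
  exact: (@L1_translate _ _ _ (- ((rho / 2) *: vertex e)) (L1_corner_box h0)).
rewrite /box_avg (eq_bigr (fun e => (rho / 2) ^- n *
  \int[lam]_s (\1_B (s - (rho / 2) *: vertex e) * phi (x + s)))); last by move=> e _; rewrite E.
rewrite -mulr_sumr -Rintegral_sum// mulrA; congr (_ * _).
  by rewrite -invfM -exprMn mulrCA divff// mulr1.
apply: eq_Rintegral => s _; rewrite -mulr_suml; congr (_ * _).
rewrite indic_corner_box.
rewrite (eq_bigr (fun i => \sum_(b : bool) (0 <= s ord0 i - (rho / 2) * b%:R < rho / 2)%R%:R)); last first.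
  move=> i _; rewrite big_bool /= mulr1 mulr0 subr0.
  move: (s ord0 i) => t; have [t0|t0] := leP 0 t; have [tr|tr] := ltP t (rho / 2);
    have [tr2|tr2] := ltP t rho; have [tr3|tr3] := leP 0 (t - rho / 2);
    have [tr4|tr4] := ltP (t - rho / 2) (rho / 2); rewrite /= ?addr0 ?add0r//; exfalso; lra.
(* Each side is split into its two halves; expanding the product of the sums yields one small cube
   for each vertex [e]. *)
rewrite bigA_distr_bigA /=; apply: eq_bigr => e _; rewrite indic_corner_box.
by apply: eq_bigr => i _; rewrite !mxE.
Qed.

End box_average.

Section translation_modulus.
Context {R : realType} {m : nat}.
Notation n := m.+1.
Notation lam := (@lebesgue_rV R n).
Implicit Types (x y h : 'rV[R]_n) (f phi psi : 'rV[R]_n -> R).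
Variables (beta V : R) (u : 'rV[R]_n -> R).
Hypotheses (beta01 : 0 < beta < 1) (Iu : L1 u) (V0 : 0 <= V).
Hypothesis uV : forall G (l : 'I_m -> R) f (L : R), (forall i, lipf (G i)) ->
  (forall i, 0 <= l i) -> (forall i, is_lip (l i) (G (lift ord0 i))) -> lipf f -> 0 <= L ->
  hoelder_fun beta L f -> `|pairing G u f| <= V * L * \prod_i l i.

Let Ib f (b : R) : lipf f -> (forall x, `|f x| <= b) -> L1 (fun x => u x * f x).
Proof. by move=> lf fb; apply: (@L1M _ _ _ _ b) => //; exact: lipf_measurable. Qed.

Lemma box_avg_translate phi h (rho : R) : lipf phi -> (forall x, `|phi x| <= 1) -> 0 < rho ->
  `|\int[lam]_x (u x * (box_avg phi rho (x + h) - box_avg phi rho x))| <=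
  n%:R * `|h| * (V * (2 * n%:R * rho `^ (- beta))).
Proof.
move=> lp p1 r0.
have L0 : 0 <= 2 * n%:R * rho `^ (- beta) by rewrite mulr_ge0 ?powR_ge0// mulr_ge0.
apply: (translate_le Iu V0 uV) => //; first exact: lipf_box_avg.
rewrite -[2 * n%:R]mulr1; apply: bounded_lip_hoelder => //.
- by case/andP: beta01 => /ltW -> /ltW ->.
- by rewrite ler_peMr// ler1n.
- by move=> x; exact: box_avg_le1.
- by rewrite mulr1; exact: box_avg_lip.
Qed.

Lemma box_avg_half_dist phi (rho : R) : lipf phi -> (forall x, `|phi x| <= 1) -> 0 < rho ->
  `|\int[lam]_x (u x * (box_avg phi rho x - box_avg phi (rho / 2) x))| <=
  2 * n%:R ^+ 2 * V * rho `^ (1 - beta).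
Proof.
move=> lp p1 r0; have h0 : 0 < rho / 2 by rewrite divr_gt0.
have lA := lipf_box_avg lp p1 h0; have A1 x := box_avg_le1 lp p1 x h0.
set A := box_avg phi (rho / 2) in lA A1 *.
have ID e : L1 (fun x => u x * (A (x + (rho / 2) *: vertex e) - A x)).
  apply: (@Ib _ 2); first by apply: lipfB => //; exact: lipf_translate.
  by move=> x; apply: le_trans (ler_normB _ _) _; rewrite (_ : 2 = 1 + 1)// lerD.
have -> : \int[lam]_x (u x * (box_avg phi rho x - A x)) =
    (2 ^+ n)^-1 * \sum_(e : {ffun 'I_n -> bool})
      \int[lam]_x (u x * (A (x + (rho / 2) *: vertex e) - A x)).
  rewrite -Rintegral_sum// -RintegralZl//; last exact: L1_sum.
  apply: eq_Rintegral => x _; rewrite box_avg_half// -/A -[X in _ = _ * X]mulr_sumr sumrB sumr_const.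
  rewrite card_ffun card_bool card_ord mulrCA; congr (_ * _).
  by rewrite mulrBr -[A x *+ _]mulr_natl natrX mulKf// gt_eqF.
have p0 : 0 < (2 : R) ^+ n by rewrite exprn_gt0.
rewrite normrM normfV (gtr0_norm p0) ler_pdivrMl//.
apply: le_trans (ler_norm_sum _ _ _) _.
apply: (@le_trans _ _ (\sum_(e : {ffun 'I_n -> bool}) 2 * n%:R ^+ 2 * V * rho `^ (1 - beta))); last first.
  by rewrite sumr_const card_ffun card_bool card_ord -[leLHS]mulr_natl natrX.
apply: ler_sum => e _; apply: le_trans (box_avg_translate _ lp p1 h0) _.
rewrite normrZ (ger0_norm (ltW h0)).
have H1 : rho / 2 * `|vertex e| <= rho / 2 by rewrite ler_piMr ?(ltW h0)// vertex_norm.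
have q0 : 0 <= (rho / 2) `^ (- beta) := powR_ge0 _ _.
have H2 : rho / 2 * (rho / 2) `^ (- beta) <= rho `^ (1 - beta).
  have -> : rho / 2 * (rho / 2) `^ (- beta) = (rho / 2) `^ (1 - beta).
    by rewrite powR_add// powRr1// ltW.
  apply: powR_mono; [by rewrite subr_ge0; case/andP: beta01 => _ /ltW|exact: ltW|].
  by rewrite ler_pdivrMr// ler_peMr ?(ltW r0)// ler1n.
have K0 : 0 <= 2 * n%:R ^+ 2 * V by rewrite !mulr_ge0.
apply: le_trans (ler_wpM2l K0 H2).
have -> : n%:R * (rho / 2 * `|vertex e|) * (V * (2 * n%:R * (rho / 2) `^ (- beta))) =
  2 * n%:R ^+ 2 * V * (rho / 2 * `|vertex e| * (rho / 2) `^ (- beta)) by ring.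
by rewrite ler_wpM2l// ler_wpM2r.
Qed.

Definition smooth_const : R := 2 * n%:R ^+ 2 / (1 - (2 : R) `^ (- (1 - beta))).

Let q01 : 0 <= (2 : R) `^ (- (1 - beta)) < 1.
Proof. by apply: half_powR_lt1; rewrite subr_gt0; case/andP: beta01. Qed.

Lemma smooth_const_ge0 : 0 <= smooth_const.
Proof. by rewrite divr_ge0 ?mulr_ge0// subr_ge0 ltW//; case/andP: q01. Qed.

(** Successive halvings cost [rho^(1-beta)] at each scale, summed geometrically since [beta < 1]. *)
Lemma box_avg_weak_dist phi (rho : R) : lipf phi -> (forall x, `|phi x| <= 1) -> 0 < rho ->
  `|\int[lam]_x (u x * (phi x - box_avg phi rho x))| <= smooth_const * V * rho `^ (1 - beta).
Proof.
move=> lp p1 r0; pose A k := box_avg phi (dyad rho k).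
have rk k : 0 < dyad rho k by exact: dyad_gt0.
have lA k : lipf (A k) by exact: lipf_box_avg.
have A1 k x : `|A k x| <= 1 by exact: box_avg_le1.
have ID f g : lipf f -> lipf g -> (forall x, `|f x| <= 1) -> (forall x, `|g x| <= 1) ->
    L1 (fun x => u x * (f x - g x)).
  move=> lf lg f1 g1; apply: (@Ib _ 2); first exact: lipfB.
  by move=> x; apply: le_trans (ler_normB _ _) _; rewrite (_ : 2 = 1 + 1)// lerD.
have tele K : `|\int[lam]_x (u x * (A K x - A 0%N x))| <=
    \sum_(k < K) 2 * n%:R ^+ 2 * V * dyad rho k `^ (1 - beta).
  elim: K => [|K IH].
    rewrite big_ord0 (_ : (fun x => _) = fun=> 0) ?Rintegral_cst ?mul0r ?normr0//.
    by apply/funext => x; rewrite subrr mulr0.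
  rewrite big_ord_recr /=.
  have -> : \int[lam]_x (u x * (A K.+1 x - A 0%N x)) =
      \int[lam]_x (u x * (A K x - A 0%N x)) - \int[lam]_x (u x * (A K x - A K.+1 x)).
    rewrite -RintegralB//; [|exact: ID|exact: ID].
    by apply: eq_Rintegral => x _; ring.
  apply: le_trans (ler_normB _ _) (lerD IH _).
  by rewrite /A dyadS; exact: box_avg_half_dist.
have sumle K : \sum_(k < K) 2 * n%:R ^+ 2 * V * dyad rho k `^ (1 - beta) <=
    smooth_const * V * rho `^ (1 - beta).
  rewrite (eq_bigr (fun k : 'I_K => 2 * n%:R ^+ 2 * V * rho `^ (1 - beta) *
      (2 `^ (- (1 - beta))) ^+ k)); last by move=> k _; rewrite dyad_powR// mulrA.
  rewrite -mulr_sumr.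
  have -> : smooth_const * V * rho `^ (1 - beta) = 2 * n%:R ^+ 2 * V * rho `^ (1 - beta) *
    (1 - 2 `^ (- (1 - beta)))^-1 by rewrite /smooth_const; ring.
  apply: ler_wpM2l; last exact: geometric_sum_le.
  by rewrite mulr_ge0 ?powR_ge0// !mulr_ge0.
have [K K0 pK] := lp; set U := \int[lam]_x `|u x|.
have U0 : 0 <= U by exact: Rintegral_ge0.
(* The Lipschitz constant of [phi] only decides at which scale the average is close enough to [phi]
   to stop the sum. *)
apply/ler_addgt0Pl => e e0.
have d0 : 0 < e / (K * U + 1) by rewrite divr_gt0// ltr_wpDl// mulr_ge0.
have [N /(_ N (leqnn N)) HN] := dyad_small r0 d0.
have -> : \int[lam]_x (u x * (phi x - box_avg phi rho x)) =
    \int[lam]_x (u x * (phi x - A N x)) + \int[lam]_x (u x * (A N x - A 0%N x)).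
  rewrite -RintegralD//; [|exact: ID|exact: ID].
  apply: eq_Rintegral => x _; rewrite /A /dyad expr0 divr1; ring.
apply: le_trans (ler_normD _ _) (lerD _ (le_trans (tele N) (sumle N))).
apply: (@le_trans _ _ (K * dyad rho N * U)).
  apply: L1_norm_mul_le => //.
    by apply: measurable_funB; apply: lipf_measurable.
  by move=> x; exact: box_avg_dist.
rewrite mulrAC; apply: le_trans (ler_wpM2l (mulr_ge0 K0 U0) HN) _.
by rewrite mulrCA ger_pMr// ler_pdivrMr ?mul1r ?lerDl// ltr_wpDl// mulr_ge0.
Qed.

Definition modulus_const : R := 2 * smooth_const + 2 * n%:R ^+ 2.

Lemma modulus_const_ge0 : 0 <= modulus_const.
Proof.
apply: addr_ge0; last by rewrite mulr_ge0.
by apply: mulr_ge0 => //; exact: smooth_const_ge0.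
Qed.

(** At the scale [|h|], both [phi] and its translate are replaced by averages, which accounts for
    [2 smooth_const]; translating the average costs [2 n^2]. *)
Lemma weak_modulus phi h : lipf phi -> (forall x, `|phi x| <= 1) -> h != 0 ->
  `|\int[lam]_x (u x * (phi (x + h) - phi x))| <= modulus_const * V * `|h| `^ (1 - beta).
Proof.
move=> lp p1 h0; have r0 : 0 < `|h| by rewrite normr_gt0.
set rho := `|h| in r0 *.
pose phi' x := phi (x + h).
have lp' : lipf phi' by exact: lipf_translate.
have p1' x : `|phi' x| <= 1 by exact: p1.
have AE x : box_avg phi rho (x + h) = box_avg phi' rho x.
  by rewrite /box_avg; congr (_ * _); apply: eq_Rintegral => s _; rewrite /phi' addrAC.
have lA := lipf_box_avg lp p1 r0; have A1 x := box_avg_le1 lp p1 x r0.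
have lA' := lipf_box_avg lp' p1' r0; have A1' x := box_avg_le1 lp' p1' x r0.
have ID f g : lipf f -> lipf g -> (forall x, `|f x| <= 1) -> (forall x, `|g x| <= 1) ->
    L1 (fun x => u x * (f x - g x)).
  move=> lf lg f1 g1; apply: (@Ib _ 2); first exact: lipfB.
  by move=> x; apply: le_trans (ler_normB _ _) _; rewrite (_ : 2 = 1 + 1)// lerD.
have -> : \int[lam]_x (u x * (phi (x + h) - phi x)) =
    \int[lam]_x (u x * (phi' x - box_avg phi' rho x)) -
    \int[lam]_x (u x * (phi x - box_avg phi rho x)) +
    \int[lam]_x (u x * (box_avg phi' rho x - box_avg phi rho x)).
  rewrite -RintegralB//; [|exact: ID|exact: ID].
  rewrite -RintegralD//; [|by apply: L1B; exact: ID|exact: ID].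
  by apply: eq_Rintegral => x _; rewrite /phi'; ring.
have H1 := box_avg_weak_dist lp' p1' r0.
have H2 := box_avg_weak_dist lp p1 r0.
have H3 := box_avg_translate h lp p1 r0.
have E3 : n%:R * rho * (V * (2 * n%:R * rho `^ (- beta))) = 2 * n%:R ^+ 2 * V * rho `^ (1 - beta).
  rewrite powR_add// powRr1 ?(ltW r0)//; ring.
rewrite -/rho E3 in H3.
have E4 : \int[lam]_x (u x * (box_avg phi rho (x + h) - box_avg phi rho x)) =
    \int[lam]_x (u x * (box_avg phi' rho x - box_avg phi rho x)).
  by apply: eq_Rintegral => x _; rewrite AE.
rewrite E4 in H3.
have alg (a b c A B : R) : `|a| <= A -> `|b| <= A -> `|c| <= B -> `|a - b + c| <= A + A + B.
  move=> aA bA cB; apply: le_trans (ler_normD _ _) (lerD _ cB).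
  by apply: le_trans (ler_normB _ _) _; exact: lerD.
have -> : modulus_const * V * rho `^ (1 - beta) =
  (smooth_const * V * rho `^ (1 - beta) + smooth_const * V * rho `^ (1 - beta)) +
  2 * n%:R ^+ 2 * V * rho `^ (1 - beta) by rewrite /modulus_const; ring.
exact: alg H1 H2 H3.
Qed.

End translation_modulus.

(** * The L^1 norm by duality with Lipschitz functions *)

Section duality.
Context {R : realType} {n : nat}.
Notation lam := (@lebesgue_rV R n).
Implicit Types (w : 'rV[R]_n -> R).

(** Truncation to [[-1, 1]], written with positive parts so that [lipf_max0] applies. *)
Definition clamp (t : R) := Num.max 0 (t + 1) - Num.max 0 (t - 1) - 1.

Lemma clamp_le1 t : `|clamp t| <= 1.
Proof.
rewrite /clamp ler_norml; apply/andP.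
by have [?|?] := leP 0 (t + 1); have [?|?] := leP 0 (t - 1); split; lra.
Qed.

Lemma clampM t : `|t| - 1 <= t * clamp t.
Proof.
rewrite /clamp; have [t1|t1] := leP 0 (t + 1); have [t2|t2] := leP 0 (t - 1); try lra.
- by rewrite ger0_norm; lra.
- rewrite subr0 addrK -expr2; have := sqr_ge0 t.
  suff : `|t| <= 1 by lra.
  by rewrite ler_norml; apply/andP; split; lra.
- by rewrite ler0_norm; lra.
Qed.

(** A Lipschitz substitute for the sign of [w]: the truncation of [psi / d], with [psi] close to [w]
    in L^1. By [clampM] it recovers [|psi|] up to [d] on the support, and [d] is small against the
    volume of the cube. *)
Lemma L1_duality w (B : R) : L1 w ->
  (forall phi, lipf phi -> (forall x, `|phi x| <= 1) -> `|\int[lam]_x (w x * phi x)| <= B) ->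
  \int[lam]_x `|w x| <= B.
Proof.
move=> Iw H; apply/ler_addgt0Pl => e0 e00; pose e := e0 / 3.
have e1 : 0 < e by rewrite divr_gt0.
have [_ /(_ _ e1)[psi [lp [M pM] Hp]]] := L1_lip_approx Iw.
have cp : csupp psi by exists M.
have Ip := lipf_csupp_L1 lp cp.
pose vol := fine (lam (cube M)); have v0 : 0 <= vol by exact: fine_ge0.
pose d := e / (vol + 1).
have d0 : 0 < d by rewrite divr_gt0// ltr_wpDl.
have dv : d * vol <= e.
  by rewrite /d mulrAC ler_pdivrMr ?ltr_wpDl// ler_wpM2l ?ltW// ltrDl.
pose phi x := clamp (d^-1 * psi x).
have lphi : lipf phi.
  apply: lipfB; last exact: lipf_cst.
  apply: lipfB; apply: lipf_max0.
    by apply: lipfD; [exact: lipfZ|exact: lipf_cst].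
  by apply: lipfB; [exact: lipfZ|exact: lipf_cst].
have phi1 x : `|phi x| <= 1 by exact: clamp_le1.
have mphi := lipf_measurable lphi.
have Iwphi : L1 (fun x => w x * phi x) by exact: (@L1M _ _ _ _ 1).
have Iwp : L1 (fun x => w x - psi x) by exact: L1B.
have Idphi : L1 (fun x => (w x - psi x) * phi x) by exact: (@L1M _ _ _ _ 1).
have pt x : `|w x| <= (w x * phi x - (w x - psi x) * phi x) + d * \1_(cube M) x + `|w x - psi x|.
  have -> : w x * phi x - (w x - psi x) * phi x = psi x * phi x by ring.
  have : `|w x| <= `|psi x| + `|w x - psi x|.
    by rewrite -[X in `|X|](subrK (psi x)) addrC [leRHS]addrC [X in _ <= X]addrC ler_normD.
  suff : `|psi x| <= psi x * phi x + d * \1_(cube M) x by lra.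
  rewrite indicE; have [xM|xM] := leP `|x| M; last first.
    by rewrite pM// normr0 mul0r add0r mulr_ge0// ltW.
  rewrite mem_set// mulr1 /phi; have := clampM (d^-1 * psi x).
  rewrite normrM gtr0_norm ?invr_gt0// => /(ler_wpM2l (ltW d0)).
  rewrite mulrBr !mulrA divff ?gt_eqF// !mul1r mulr1; lra.
have I1 : L1 (fun x => w x * phi x - (w x - psi x) * phi x) by exact: L1B.
have I2 : L1 (fun x : 'rV[R]_n => d * \1_(cube M) x) by apply: L1Z; exact: L1_indic_cube.
have I3 : L1 (fun x => `|w x - psi x|) by exact: L1_norm.
apply: (@le_trans _ _ (\int[lam]_x
  ((w x * phi x - (w x - psi x) * phi x) + d * \1_(cube M) x + `|w x - psi x|))).
  apply: le_Rintegral; [exact: measurableT|exact: L1_norm|by apply: L1D => //; exact: L1D|].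
  by move=> x _; exact: pt.
rewrite RintegralD//; last exact: L1D.
rewrite RintegralD// RintegralB// RintegralZl//; last exact: L1_indic_cube.
rewrite (integral_indicR (measurable_cube M)) -/vol.
have H1 := H phi lphi phi1.
have H2 : `|\int[lam]_x ((w x - psi x) * phi x)| <= e.
  by apply: le_trans (@L1_norm_mul_le _ _ _ _ 1 Iwp mphi phi1) _; rewrite mul1r.
have E : e0 = e + e + e by rewrite /e; field.
rewrite E; move: H1 H2 Hp dv; rewrite !ler_norml => /andP[_ H1] /andP[H2 _].
move: (\int[lam]_x (w x * phi x)) (\int[lam]_x ((w x - psi x) * phi x))
  (\int[lam]_x `|w x - psi x|) (d * vol) H1 H2 => a b c p; lra.
Qed.

End duality.

Section modulus.
Context {R : realType} {m : nat}.
Notation n := m.+1.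
Notation lam := (@lebesgue_rV R n).
Implicit Types (x y h s z : 'rV[R]_n).
Variables (beta V : R) (u : 'rV[R]_n -> R).
Hypotheses (beta01 : 0 < beta < 1) (Iu : L1 u) (V0 : 0 <= V).
Hypothesis uV : forall G (l : 'I_m -> R) f (L : R), (forall i, lipf (G i)) ->
  (forall i, 0 <= l i) -> (forall i, is_lip (l i) (G (lift ord0 i))) -> lipf f -> 0 <= L ->
  hoelder_fun beta L f -> `|pairing G u f| <= V * L * \prod_i l i.

Notation C := (modulus_const (R := R) (m := m) beta * V).

(** By duality; a change of variables moves the translation onto the test function, with [-h], where
    [weak_modulus] applies. *)
Lemma L1_modulus h : \int[lam]_x `|u (x + h) - u x| <= C * `|h| `^ (1 - beta).
Proof.
have C0 : 0 <= C by rewrite mulr_ge0// modulus_const_ge0.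
have [->|h0] := eqVneq h 0.
  have -> : (fun x => `|u (x + 0) - u x|) = fun=> 0.
    by apply/funext => x; rewrite addr0 subrr normr0.
  by rewrite Rintegral_cst// mul0r; apply: mulr_ge0 => //; exact: powR_ge0.
have Ih := L1_translate h Iu.
apply: L1_duality; first exact: L1B.
move=> phi lp p1; have h0' : - h != 0 by rewrite oppr_eq0.
have := weak_modulus beta01 Iu V0 uV lp p1 h0'.
rewrite normrN; congr (`|_| <= _).
have mphi := lipf_measurable lp.
have Iup : L1 (fun x => u x * phi x) by exact: (@L1M _ _ _ _ 1).
have Iuph : L1 (fun x => u x * phi (x - h)).
  apply: (@L1M _ _ _ _ 1) => //; exact: lipf_measurable (lipf_translate _ lp).
have Ihp : L1 (fun x => u (x + h) * phi x) by exact: (@L1M _ _ _ _ 1).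
under eq_Rintegral do rewrite mulrBr.
under [RHS]eq_Rintegral do rewrite mulrBl.
rewrite !RintegralB//; congr (_ - _).
rewrite -(@integral_translate _ _ _ (- h) (L1_measurable Ihp)).
by apply: eq_Rintegral => x _; rewrite subrK.
Qed.

Definition osc_mass rho x := \int[lam]_s (\1_(supball 0 rho) s * `|u (x + s) - u x|).

Let mu : measurable_fun setT u. Proof. exact: L1_measurable. Qed.

Lemma measurable_rV_add : measurable_fun [set: 'rV[R]_n * 'rV[R]_n] (fun p => p.1 + p.2).
Proof.
apply: measurable_fun_rVP => i; under eq_fun do rewrite mxE.
apply: measurable_funD.
  by apply: (measurableT_comp (measurable_coord_rV i)).
by apply: (measurableT_comp (measurable_coord_rV i)).
Qed.

Let Isup (rho : R) : 0 <= rho -> L1 (\1_(supball 0 rho) : 'rV[R]_n -> R).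
Proof.
move=> r0; apply: L1_indic; first exact: measurable_supball.
by rewrite lam_supball// ltry.
Qed.

Let Iosc rho x : 0 <= rho -> L1 (fun s => \1_(supball 0 rho) s * `|u (x + s) - u x|).
Proof.
move=> r0.
have Ius : L1 (fun s => u (x + s)) by under eq_fun do rewrite addrC; exact: L1_translate.
apply: (@L1_le _ _ _ (fun s => `|u (x + s)| + `|u x| * \1_(supball 0 rho) s)).
- apply: measurable_funM; first by apply: measurable_indic; exact: measurable_supball.
  by apply: measurableT_comp => //; apply: measurable_funB => //; exact: L1_measurable.
- move=> s; rewrite indicE ger0_norm ?mulr_ge0//; case: (s \in _).
    by rewrite mul1r mulr1 ler_normB.
  by rewrite mul0r mulr0 addr0.
- by apply: L1D; [exact: L1_norm|apply: L1Z; exact: Isup].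
Qed.

Lemma osc_mass_ge0 rho x : 0 <= osc_mass rho x.
Proof. by apply: Rintegral_ge0 => s _; rewrite mulr_ge0// indicE. Qed.

(** Tonelli exchanges point and shift; [L1_modulus] bounds each shift, and the shifts fill a cube of
    volume [(2 rho)^n]. *)
Lemma osc_mass_Tonelli rho : 0 < rho -> measurable_fun setT (osc_mass rho) /\
  (\int[lam]_x (osc_mass rho x)%:E <= ((2 * rho) ^+ n * (C * rho `^ (1 - beta)))%:E)%E.
Proof.
move=> r0; have r0' := ltW r0.
pose F (p : 'rV[R]_n * 'rV[R]_n) := (\1_(supball 0 rho) p.2 * `|u (p.1 + p.2) - u p.1|)%:E.
have mF : measurable_fun setT F.
  apply/measurable_EFinP; apply: measurable_funM.
    by apply: measurableT_comp => //; apply: measurable_indic; exact: measurable_supball.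
  apply: measurableT_comp => //; apply: measurable_funB; last exact: (measurableT_comp mu).
  exact: (measurableT_comp mu measurable_rV_add).
have F0 p : (0 <= F p)%E by rewrite lee_fin mulr_ge0// indicE.
have SE x : (\int[lam]_s F (x, s) = (osc_mass rho x)%:E)%E.
  by rewrite /osc_mass -integral_EFin//; exact: Iosc.
have mFx := @measurable_fun_fubini_tonelli_F _ _ _ _ _ lam F mF F0.
have H := @fubini_tonelli _ _ _ _ _ lam lam F mF F0.
split.
  apply/measurable_EFinP; apply: eq_measurable_fun mFx => x _.
  by rewrite /fubini_F SE.
have -> : (\int[lam]_x (osc_mass rho x)%:E = \int[lam]_x \int[lam]_s F (x, s))%E.
  by apply: eq_integral => x _; rewrite SE.
rewrite H; clear H mFx SE.
have Iuh s : L1 (fun x => `|u (x + s) - u x|) by apply: L1_norm; apply: L1B => //; exact: L1_translate.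
have C0 : 0 <= C by rewrite mulr_ge0// modulus_const_ge0.
apply: (@le_trans _ _ (\int[lam]_s ((C * rho `^ (1 - beta)) * \1_(supball 0 rho) s)%:E)%E); last first.
  rewrite integral_EFin; last by apply: L1Z; exact: Isup.
  rewrite lee_fin RintegralZl//; last exact: Isup.
  rewrite integral_indicR ?lam_supball//; last exact: measurable_supball.
  by rewrite mulrC.
apply: ge0_le_integral => //.
- by move=> s _; apply: integral_ge0 => x _.
- exact: (@measurable_fun_fubini_tonelli_G _ _ _ _ _ lam F mF F0).
- by apply/measurable_EFinP; apply: L1_measurable; apply: L1Z; exact: Isup.
move=> s _.
have -> : (\int[lam]_x F (x, s) = (\int[lam]_x (\1_(supball 0 rho) s * `|u (x + s) - u x|))%:E)%E.
  by rewrite -integral_EFin//; apply: L1Z; exact: Iuh.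
rewrite lee_fin RintegralZl//; last exact: Iuh.
rewrite indicE; case: (boolP (s \in _)) => [/set_mem|_]; last by rewrite mul0r mulr0.
rewrite /supball /= subr0 mul1r mulr1 => sr; apply: le_trans (L1_modulus s) _.
by rewrite ler_wpM2l// powR_mono// subr_ge0; case/andP: beta01 => _ /ltW.
Qed.

(* The triangle inequality through [z], integrated over the ball of radius
   [rho / 2] around the midpoint of [x] and [y]. *)
Lemma osc_mass_bound rho x y : 0 < rho -> `|x - y| <= rho ->
  rho ^+ n * `|u x - u y| <= osc_mass rho x + osc_mass rho y.
Proof.
move=> r0 xy; have r0' := ltW r0.
pose p := 2^-1 *: (x + y).
have h0 : 0 <= rho / 2 by rewrite divr_ge0.
have E a : osc_mass rho a = \int[lam]_z (\1_(supball 0 rho) (z - a) * `|u z - u a|).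
  rewrite /osc_mass -(@integral_translate _ _ _ (- a) (L1_measurable (Iosc a r0'))).
  by apply: eq_Rintegral => z _; rewrite [a + _]addrC subrK.
have I a : L1 (fun z => \1_(supball 0 rho) (z - a) * `|u z - u a|).
  have := @L1_translate _ _ _ (- a) (Iosc a r0').
  by under eq_fun do rewrite [a + _]addrC subrK.
have Ip : L1 (\1_(supball p (rho / 2)) : 'rV[R]_n -> R).
  apply: L1_indic; first exact: measurable_supball.
  by rewrite lam_supball// ltry.
have -> : rho ^+ n * `|u x - u y| = \int[lam]_z (`|u x - u y| * \1_(supball p (rho / 2)) z).
  rewrite RintegralZl// integral_indicR ?lam_supball//; last exact: measurable_supball.
  by rewrite /= mulrC; congr (_ * _ ^+ _); field.
rewrite !E -RintegralD//; [|exact: I|exact: I].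
apply: le_Rintegral.
- exact: measurableT.
- exact: L1Z.
- exact: L1D.
move=> z _; rewrite indicE; case: (boolP (z \in _)) => [/set_mem zp|_]; last first.
  by rewrite mulr0 addr_ge0// mulr_ge0// indicE.
have near a : `|p - a| = 2^-1 * `|x - y| -> \1_(supball 0 rho) (z - a) = 1 :> R.
  move=> pa; rewrite indicE mem_set// /supball /= subr0.
  have := ler_distD p z a; move: zp; rewrite /supball /= pa; lra.
rewrite !near; first last.
- rewrite (_ : p - x = - (2^-1 *: (x - y))) ?normrN ?normrZ ?ger0_norm//.
  by apply/rowP => i; rewrite !mxE; field.
- rewrite (_ : p - y = 2^-1 *: (x - y)) ?normrZ ?ger0_norm//.
  by apply/rowP => i; rewrite !mxE; field.
by rewrite !mul1r mulr1 [`|u z - u x|]distrC; exact: ler_distD.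
Qed.

End modulus.

Section hoelder_exhaustion.
Context {R : realType} {m : nat}.
Notation n := m.+1.
Notation lam := (@lebesgue_rV R n).
Implicit Types (u : 'rV[R]_n -> R) (x y : 'rV[R]_n).

(** [j] is the least index whose successor scale is below [d]; minimality gives the first
    inequality, and [d <= 1] settles [j = 0]. *)
Lemma dyad_bracket (d : R) : 0 < d <= 1 -> exists j, d <= dyad 1 j /\ dyad 1 j <= 2 * d.
Proof.
move=> /andP[d0 d1]; have d2 : 0 < d / 2 by rewrite divr_gt0.
have [N /(_ N (leqnn N)) HN] := dyad_small ltr01 d2.
have ex : exists j, dyad 1 j.+1 < d.
  exists N; apply: le_lt_trans (_ : d / 2 < d).
    by rewrite dyadS (le_trans _ HN)// ler_pdivrMr// ler_peMr ?ler1n// ltW ?dyad_gt0.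
  by rewrite ltr_pdivrMr// ltr_pMr// ltr1n.
exists (ex_minn ex); case: ex_minnP => j jd jmin; split.
  case: j jd jmin => [_ _|j jd jmin]; first by rewrite /dyad expr0 divr1.
  by rewrite leNgt; apply/negP => /jmin; rewrite ltnn.
by move: jd; rewrite dyadS ltr_pdivrMr// mulrC => /ltW.
Qed.

Lemma markov_norm u (t : R) : L1 u -> 0 < t ->
  (lam [set x | (t < `|u x|)%R] <= ((\int[lam]_x `|u x|) / t)%:E)%E.
Proof.
move=> Iu t0; have mu := L1_measurable Iu.
have mu' : measurable_fun setT (EFin \o u) by exact/measurable_EFinP.
have := @le_integral_abse _ _ _ lam setT measurableT (EFin \o u) t mu' t0.
rewrite setTI; have -> : (\int[lam]_x `|(EFin \o u) x| = (\int[lam]_x `|u x|)%:E)%E.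
  by rewrite -integral_EFin//; exact: L1_norm.
move=> H; rewrite EFinM lee_pdivlMr// muleC; apply: le_trans H.
have mn : measurable_fun setT (fun x => `|u x|) by exact: measurableT_comp.
rewrite lee_pmul2l//; apply: le_measure; rewrite ?inE.
- have := mn measurableT _ (@measurable_itv R `]t, +oo[); rewrite setTI.
  by congr measurable; apply/seteqP; split => x; rewrite /= in_itv /= andbT.
- have := mn measurableT _ (@measurable_itv R `[t, +oo[); rewrite setTI.
  by congr measurable; apply/seteqP; split => x; rewrite /= in_itv /= andbT lee_fin.
- by move=> x /= /ltW; rewrite lee_fin.
Qed.

Lemma BVc_hoelder_exhaustion (alpha beta : R) u : 0 < alpha < 1 -> 0 < beta < 1 ->
  BVc beta u -> alpha + beta < 1 ->
  exists (C : R) (v : 'rV[R]_n -> R) (D : nat -> set 'rV[R]_n),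
    [/\ 0 <= C,
        measurable_fun setT v,
        {ae lam, forall x, v x = u x},
        (forall j k, (1 <= j <= k)%N -> D j `<=` D k) &
        forall k, (1 <= k)%N ->
          [/\ measurable (D k),
              (lam (~` D k) <= (C * k%:R^-1)%:E)%E &
              forall x y, D k x -> D k y ->
                `|v x - v y| <= C * k%:R * enorm (x - y) `^ alpha]].
Proof.
move=> /andP[a0 a1] beta01 [[Iu _] uoo] ab; have /andP[b0 b1] := beta01.
have [V V0 uV] := frac_var_finite (ltW b0) Iu uoo.
pose C0 := modulus_const (R := R) (m := m) beta * V.
have C00 : 0 <= C0 by rewrite mulr_ge0// modulus_const_ge0.
pose U := \int[lam]_x `|u x|; have U0 : 0 <= U by exact: Rintegral_ge0.
have g0 : 0 < 1 - alpha - beta by lra.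
have q01 := half_powR_lt1 g0; set q := 2 `^ (- _) in q01.
pose rho k := dyad (1 : R) k; have rk k : 0 < rho k by exact: dyad_gt0.
(* The volume normalizes the mean oscillation up to [2^n]. By [osc_mass_Tonelli] the integral of
   [a_ k] is of order [rho^(1-alpha-beta)], summable because [alpha + beta < 1]. *)
pose c k := rho k `^ (- alpha) / rho k ^+ n.
have c0 k : 0 < c k by rewrite divr_gt0 ?powR_gt0// exprn_gt0.
pose a_ k x := c k * osc_mass u (rho k) x.
have a0_ k x : 0 <= a_ k x by rewrite mulr_ge0 ?osc_mass_ge0// ltW.
have T k := osc_mass_Tonelli beta01 Iu V0 uV (rk k).
have ma k : measurable_fun setT (a_ k) by apply: measurable_funM => //; have [] := T k.
pose C1 := 2 ^+ n * C0 / (1 - q).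
have q1 : 0 < 1 - q by rewrite subr_gt0; case/andP: q01.
have C10 : 0 <= C1 by apply: divr_ge0 (ltW q1); apply: mulr_ge0 C00; exact: exprn_ge0.
have aC K : (\sum_(k < K) \int[lam]_x (a_ k x)%:E <= C1%:E)%E.
  apply: (@le_trans _ _ (\sum_(k < K) (2 ^+ n * C0 * q ^+ k)%:E)%E); last first.
    rewrite sumEFin lee_fin -mulr_sumr; apply: ler_wpM2l.
      by apply: mulr_ge0 C00; exact: exprn_ge0.
    exact: geometric_sum_le.
  apply: lee_sum => k _; have [mo Ho] := T k.
  have -> : (\int[lam]_x (a_ k x)%:E = (c k)%:E * \int[lam]_x (osc_mass u (rho k) x)%:E)%E.
    rewrite -ge0_integralZl//.
    - exact/measurable_EFinP.
    - by move=> x _; rewrite lee_fin osc_mass_ge0.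
    - by rewrite lee_fin ltW.
  apply: le_trans (lee_wpmul2l _ Ho) _; first by rewrite lee_fin ltW.
  rewrite -EFinM lee_fin le_eqVlt; apply/orP; left; apply/eqP.
  have -> : q ^+ k = rho k `^ (- alpha) * rho k `^ (1 - beta).
    by rewrite -powR_add// dyad_powR// powR1 mul1r; congr (powR _ _ ^+ _); ring.
  rewrite exprMn /c -/C0; field.
  by rewrite gt_eqF// exprn_gt0.
pose D k := series_le a_ k%:R `&` [set x | `|u x| <= k%:R].
(* [C1] and [U] come from Markov's inequality for the series and for [|u|], and 4 from the Hoelder
   estimate. The Borel function [u] serves as its own representative. *)
exists (C1 + U + 4), u, D; split.
- by rewrite !addr_ge0.
- exact: L1_measurable.
- exact: aeW.
- move=> j k /andP[_ jk] x [H1 H2]; have jk' : j%:R <= k%:R :> R by rewrite ler_nat.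
  by split; [move=> K; exact: le_trans (H1 K) jk'|exact: le_trans H2 jk'].
move=> k k1; have k0 : 0 < k%:R :> R by rewrite ltr0n.
have mu : measurable_fun setT (fun x => `|u x|).
  by apply: measurableT_comp => //; exact: L1_measurable.
have mS := measurable_series_le ma k%:R.
have mN : measurable [set x : 'rV[R]_n | `|u x| <= k%:R].
  have := mu measurableT _ (@measurable_itv R `]-oo, k%:R]); rewrite setTI.
  by congr measurable; apply/seteqP; split => x; rewrite /= in_itv.
split; first exact: measurableI.
  rewrite setCI; apply: le_trans (measureU2 _ _ _) _; [exact: measurableC|exact: measurableC|].
  apply: le_trans (leeD (series_markov a0_ ma aC k0) _) _.
    rewrite (_ : ~` _ = [set x | k%:R < `|u x|]); first exact: markov_norm.
    by apply/seteqP; split => x /=; rewrite ltNge => /negP.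
  rewrite -EFinD lee_fin -mulrDl ler_wpM2r ?invr_ge0 ?ler0n// lerDl//.
move=> x y [Sx Nx] [Sy Ny].
have [->|xy] := eqVneq x y; first by rewrite subrr normr0 !mulr_ge0 ?powR_ge0// !addr_ge0.
have d0 : 0 < `|x - y| by rewrite normr_gt0 subr_eq0.
have P : `|x - y| `^ alpha <= enorm (x - y) `^ alpha.
  by apply: powR_mono; [exact: ltW|exact: normr_ge0|exact: norm_le_enorm].
suff H : `|u x - u y| <= 4 * k%:R * `|x - y| `^ alpha.
  apply: le_trans H _; apply: le_trans (ler_wpM2l _ P) _; first by rewrite mulr_ge0.
  by rewrite ler_wpM2r ?powR_ge0// ler_wpM2r// lerDr addr_ge0.
(* At distance above 1 the bound [|u| <= k] suffices, the power of the distance being at least 1. *)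
have [d1|d1] := leP `|x - y| 1; last first.
  apply: (@le_trans _ _ (2 * k%:R)).
    apply: le_trans (ler_normB _ _) _; move: Nx Ny => /= Nx Ny; lra.
  apply: (@le_trans _ _ (4 * k%:R * 1)); first by lra.
  rewrite ler_wpM2l ?mulr_ge0// -(powRr0 `|x - y|) ler_powR// ltW//.
have dd : 0 < `|x - y| <= 1 by rewrite d0.
(* [|x - y| <= rho j] makes [osc_mass_bound] applicable; its two terms are at most [k] each, and
   [rho j <= 2 |x - y|] converts [rho j ^ alpha] at the cost of another factor 2. *)
have [j [dj jd]] := dyad_bracket dd.
have term z : series_le a_ k%:R z -> a_ j z <= k%:R.
  move=> /(_ j.+1); rewrite big_ord_recr /=; apply: le_trans; rewrite lerDr.
  by apply: sumr_ge0 => i _.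
have := osc_mass_bound Iu (rk j) dj => /(ler_wpM2l (ltW (c0 j))).
rewrite mulrDr mulrA => H; have H' := le_trans H (lerD (term _ Sx) (term _ Sy)).
have cE : c j * rho j ^+ n = rho j `^ (- alpha) by rewrite /c divfK// gt_eqF// exprn_gt0.
rewrite cE powRN mulrC ler_pdivrMr ?powR_gt0// in H'.
apply: le_trans H' _.
have P2 : rho j `^ alpha <= 2 * `|x - y| `^ alpha.
  apply: le_trans (powR_mono (ltW a0) (ltW (rk j)) jd) _.
  rewrite powRM// ler_wpM2r ?powR_ge0//; apply: (@powR_le_nat _ alpha 1).
  by rewrite !ltW.
have k0' := ltW k0.
have := ler_wpM2l (addr_ge0 k0' k0') P2.
by move/le_trans; apply; rewrite le_eqVlt; apply/orP; left; apply/eqP; ring.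
Qed.

End hoelder_exhaustion.

Theorem corollary4p13 (R : realType) (n : nat) (n_ge1 : (1 <= n)%N) :
  [/\ (forall alpha beta : R, 0 < alpha <= 1 -> 1 - alpha < beta <= 1 ->
       exists C : R, forall u : 'rV[R]_n -> R, is_Lip alpha u ->
       forall r : R, 0 < r ->
         BVc beta (fun y => u y * \1_(cball 0 r) y) /\
         forall x : 'rV[R]_n, cball 0 r x ->
           (frac_var beta (fun y => ((u y - u x) * \1_(cball 0 r) y)%R) <=
            (C * r `^ (alpha + beta + n%:R - 1))%:E *
              Lip_on (cball 0 r) alpha u)%E),
      (forall alpha beta : R, 0 < alpha < 1 -> 0 < beta < 1 ->
       forall u : 'rV[R]_n -> R, BVc beta u -> alpha + beta < 1 ->
       exists (C : R) (v : 'rV[R]_n -> R) (D : nat -> set 'rV[R]_n),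
         [/\ 0 <= C,
             measurable_fun setT v,
             {ae lebesgue_rV n, forall x, v x = u x},
             (forall j k, (1 <= j <= k)%N -> D j `<=` D k) &
             forall k, (1 <= k)%N ->
               [/\ measurable (D k),
                   (lebesgue_rV n (~` D k) <= (C * k%:R^-1)%:E)%E &
                   forall x y, D k x -> D k y ->
                     `|v x - v y| <= C * k%:R * enorm (x - y) `^ alpha]]),
      (forall (U : set 'rV[R]_n) (d : R), bounded_set U -> open U ->
       box_dim (boundary U) d -> n%:R - 1 <= d < n%:R ->
       forall delta : R, d < delta <= n%:R ->
         BVc (delta - (n%:R - 1)) (\1_U : 'rV[R]_n -> R)) &
      (forall (alpha : R) (u : 'rV[R]_n -> R) (x : 'rV[R]_n),
       0 <= alpha < 1 -> BVc alpha u ->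
       {ae @lebesgue_measure R, forall r : R, 0 < r ->
         forall beta : R, alpha < beta < 1 ->
           BVc beta (fun y => u y * \1_(cball x r) y)})].
Proof.
case: n n_ge1 => // m _; split.
- exact: BVc_hoelder_ball.
- by move=> alpha beta a01 b01 u Bu ab; exact: (BVc_hoelder_exhaustion a01 b01 Bu ab).
- by move=> U d bU oU dU nd delta dd; exact: (BVc_indic_open bU oU dU nd dd).
- by move=> alpha u x a01 Bu; exact: BVc_cut_ball a01 Bu.
Qed.
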